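(* For $n\in\mathbb{N}$ let $q_n:=\mathbb{P}(\eta_{n+1}\ne\eta_n\mid\mathcal{F}_{n-1})$, and let $q:=1/4$. Then there exists $\varepsilon>0$ such that, almost surely, for all but finitely many $n$, $|q_n-q|\le \mathrm{e}^{-n^{\varepsilon}}$.
   Context: Fix $\lambda=\mu\in(0,\infty)$. Write $\mathbb{Z}_+=\{0,1,2,\ldots\}$, $\mathbb{N}=\{1,2,3,\ldots\}$, $\mathbb{R}_+=[0,\infty)$. $P(\kappa)$ denotes a Poisson random variable with mean $\kappa\in\mathbb{R}_+$; for a random variable $W\ge 0$, $P(W)$ denotes a random variable that, conditional on $W$, is Poisson with mean $W$. For $k\in\mathbb{Z}_+$, $\zeta(k)$ denotes a random variable distributed as the time to empty (first time with $0$ customers) of an M/M/1 queue with arrival rate and service rate both $\lambda$ started from $k$ customers; for a $\mathbb{Z}_+$-valued random variable $W$, $\zeta(W)$ is, conditional on $W$, distributed as the time to empty from $W$ customers. Let $\xi_0,\xi_1,\ldots$ be i.i.d. with $\mathbb{P}(\xi_n=\pm1)=1/2$ (tie-breakers, independent of the other random ingredients). The greedy server on $\mathbb{Z}$, observed at the successive times at which it empties a queue, is the Markov process $\Psi_n=(Q_n,X_n,T_n)$, $n\in\mathbb{Z}_+$, with $Q_n=(Q_n(x))_{x\in\mathbb{Z}}\in(\mathbb{Z}_+\cup\{*\})^{\mathbb{Z}}$, $X_n\in\mathbb{Z}$, $T_n\in\mathbb{R}_+$ (the symbol $*$ means the queue has not yet been inspected). Initially $Q_0(x)=0$ for $x\in\{-1,0,1\}$,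 $Q_0(x)=*$ for $|x|\ge2$, $X_0=0$, $T_0=0$. Given $(Q_n,X_n,T_n)$: - $\eta_{n+1}=+1$ if $Q_n(X_n+1)>Q_n(X_n-1)$, $\eta_{n+1}=-1$ if $Q_n(X_n-1)>Q_n(X_n+1)$, and $\eta_{n+1}=\xi_n$ if $Q_n(X_n+1)=Q_n(X_n-1)$; $X_{n+1}=X_n+\eta_{n+1}$. - $\tau_{n+1}$ is distributed as $1+\zeta(Q_n(X_{n+1})+P(\lambda))$; $T_{n+1}=T_n+\tau_{n+1}$. - For each $k\in\mathbb{Z}\setminus\{X_{n+1}\}$ with $Q_n(k)\ne *$, $Q_{n+1}(k)$ is distributed as $Q_n(k)+P(\lambda\tau_{n+1})$, independently for each $k$. - If $Q_n(X_{n+1}+1)=*$ then $Q_{n+1}(X_{n+1}+1)$ is distributed as $P(\lambda T_{n+1})$, and if $Q_n(X_{n+1}-1)=*$ then $Q_{n+1}(X_{n+1}-1)$ is distributed as $P(\lambda T_{n+1})$, independently; all other entries equal to $*$ remain $*$. - $Q_{n+1}(X_{n+1})=0$. The filtration is $\mathcal{F}_n=\sigma(\Psi_0,\xi_0,\Psi_1,\xi_1,\ldots,\Psi_n,\xi_n)$; in particular $X_{n+1}$ and $\eta_{n+1}$ are $\mathcal{F}_n$-measurable. *)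

(* Defs.v *)
From mathcomp Require Import all_boot all_order all_algebra.
From mathcomp Require Import all_classical all_reals all_analysis.

Set Implicit Arguments.
Unset Strict Implicit.
Unset Printing Implicit Defensive.

Import Order.TTheory GRing.Theory Num.Theory.
Import numFieldNormedType.Exports.

Local Open Scope classical_set_scope.
Local Open Scope ring_scope.

(* [Y] is a version of the conditional probability of the event [A] given the
   sub-sigma-algebra [G]. *)
Definition is_cond_prob (R : realType) (d : measure_display)
    (Omega : measurableType d) (P : probability Omega R)
    (G : set (set Omega)) (A : set Omega) (Y : Omega -> R) : Prop :=
  [/\ forall B : set R, measurable B -> G (Y @^-1` B),
      P.-integrable setT (EFin \o Y)
    & forall C, G C -> (\int[P]_(w in C) (Y w)%:E = P (A `&` C))%E].

(* P(P(kappa) = k). The library's [poisson_prob] has an unused [nat] argument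
   (here [0]); unlike [poisson_pmf] it is the Dirac mass at 0 for kappa = 0. *)
Definition poisson_mass (R : realType) (kappa : R) (k : nat) : R :=
  fine (poisson_prob kappa 0 [set k]).

Section MM1.
Context (R : realType) (d : measure_display) (Omega : measurableType d).
Variable P : probability Omega R.

(* A : interarrival times, S : service times; all of them are independent,
   with A i ~ Exp(lambda) and S i ~ Exp(mu). *)
Definition MM1_input (lambda mu : R) (A S : nat -> {RV P >-> R}) : Prop :=
  forall (n : nat) (B C : nat -> set R),
    (forall i, measurable (B i)) -> (forall i, measurable (C i)) ->
    P (\bigcap_(i in `I_n) (A i @^-1` B i `&` S i @^-1` C i)) =
    (\prod_(i < n) (exponential_prob lambda (B i) *
                    exponential_prob mu (C i)))%E.

(* Exactly [n] of the epochs u 0, u 0 + u 1, u 0 + u 1 + u 2, ... are <= t. *)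
Definition epochs_by (u : nat -> R) (t : R) (n : nat) : Prop :=
  \sum_(i < n) u i <= t < \sum_(i < n.+1) u i.

(* First time at which the number of customers is 0, starting from k. Until
   then the server is never idle, so the service completions are the epochs of
   the renewal sequence of service times, and the queue is empty when
   k + #arrivals = #completions. *)
Definition time_to_empty (A S : nat -> {RV P >-> R}) (k : nat) (w : Omega) :
    \bar R :=
  ereal_inf [set t%:E | t in [set t | 0 <= t /\ exists n m : nat,
    [/\ epochs_by (fun i => A i w) t n, epochs_by (fun i => S i w) t m
      & (k + n = m)%N]]].

(* Law of zeta(k). *)
Definition zeta_law (A S : nat -> {RV P >-> R}) (k : nat) (B : set R) :
    \bar R :=
  P [set w | exists2 t, time_to_empty A S k w = t%:E & B t].

End MM1.

(* Law of 1 + zeta(m + P(lambda)), where [zeta k] is the law of zeta(k). *)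
Definition service_law (R : realType) (lambda : R)
    (zeta : nat -> set R -> \bar R) (m : nat) (B : set R) : \bar R :=
  (\sum_(0 <= j <oo) (poisson_mass lambda j)%:E *
     zeta (m + j)%N [set t | B (1 + t)%R])%E.

Section GreedyServer.
Context (R : realType) (d : measure_display) (Omega : measurableType d).

(* Queue lengths live in Z_+ U {*}, with * represented by [None]. *)
Definition queue_count (v : option nat) : nat := odflt 0%N v.

(* Increment chosen from position x when the tie-breaker is s. The value given
   by [queue_count] to * plays no role: along the process both neighbours of
   the server have always been inspected. *)
Definition greedy_move (q : int -> option nat) (x s : int) : int :=
  let r := queue_count (q (x + 1)) in
  let l := queue_count (q (x - 1)) in
  if (l < r)%N then 1 else if (r < l)%N then -1 else s.

(* Conditional probability that Q_{n+1}(k) = v given that Q_n(k) = u,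
   X_{n+1} = x, tau_{n+1} = tau and T_{n+1} = T. *)
Definition site_mass (lambda : R) (u : option nat) (x : int) (tau T : R)
    (k : int) (v : option nat) : R :=
  if k == x then (v == Some 0%N)%:R else
  match u, v with
  | Some a, Some b =>
      if (a <= b)%N then poisson_mass (lambda * tau) (b - a) else 0
  | Some _, None => 0
  | None, Some b =>
      if `|k - x| == 1 then poisson_mass (lambda * T) b else 0
  | None, None => (`|k - x| != 1)%:R
  end.

Variables (Q : nat -> int -> Omega -> option nat) (X : nat -> Omega -> int).
Variables (T : nat -> Omega -> R) (xi : nat -> Omega -> int).

(* eta_n, meaningful for n >= 1. *)
Definition eta (n : nat) (w : Omega) : int :=
  greedy_move (fun x => Q n.-1 x w) (X n.-1 w) (xi n.-1 w).

Definition tau (n : nat) (w : Omega) : R := T n w - T n.-1 w.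

(* Generators of sigma(Psi_n) and of sigma(xi_n). *)
Definition state_events (n : nat) : set (set Omega) :=
  [set E | exists x v, E = Q n x @^-1` [set v]] `|`
  [set E | exists z, E = X n @^-1` [set z]] `|`
  [set E | exists2 B, measurable B & E = T n @^-1` B].

Definition tie_events (n : nat) : set (set Omega) :=
  [set E | exists s, E = xi n @^-1` [set s]].

Definition past_events (n : nat) : set (set Omega) :=
  \bigcup_(i in `I_n) (state_events i `|` tie_events i).

(* F_n = sigma(Psi_0, xi_0, ..., Psi_n, xi_n). *)
Definition history (n : nat) : set (set Omega) := <<s past_events n.+1 >>.

(* sigma(Psi_0, xi_0, ..., Psi_{n-1}, xi_{n-1}, Psi_n). *)
Definition history_before_tie (n : nat) : set (set Omega) :=
  <<s past_events n `|` state_events n >>.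

(* sigma(F_n, T_{n+1}) = sigma(F_n, tau_{n+1}). *)
Definition history_with_time (n : nat) : set (set Omega) :=
  <<s past_events n.+1 `|`
      [set E | exists2 B, measurable B & E = T n.+1 @^-1` B] >>.

Record greedy_server (P : probability Omega R) (lambda : R)
    (zeta : nat -> set R -> \bar R) : Prop := GreedyServer {
  gs_measurable : forall n, state_events n `|` tie_events n `<=` measurable;
  gs_T_ge0 : forall n w, 0 <= T n w;
  gs_Q0 : forall x w, Q 0 x w = if `|x| <= 1 then Some 0%N else None;
  gs_X0 : forall w, X 0 w = 0;
  gs_T0 : forall w, T 0 w = 0;
  (* Together with the next conditional laws, which are given F_n, this says
     that the xi_n are i.i.d. and independent of the other ingredients. *)
  gs_xi : forall n s, s = 1 \/ s = -1 ->
    is_cond_prob P (history_before_tie n) (xi n @^-1` [set s])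
      (fun=> 1 / 2%:R);
  gs_X : forall n w, X n.+1 w = X n w + eta n.+1 w;
  gs_tau : forall n B, measurable B ->
    is_cond_prob P (history n) (tau n.+1 @^-1` B)
      (fun w => fine (service_law lambda zeta
                        (queue_count (Q n (X n.+1 w) w)) B));
  gs_Q : forall n (J : seq int) (v : int -> option nat), uniq J ->
    is_cond_prob P (history_with_time n)
      [set w | forall k, k \in J -> Q n.+1 k w = v k]
      (fun w => \prod_(k <- J) site_mass lambda (Q n k w) (X n.+1 w)
                  (tau n.+1 w) (T n.+1 w) k (v k))
}.

End GreedyServer.

(* Main.v *)
From HB Require Import structures.
Require Import Defs.
From mathcomp Require Import all_boot all_order all_algebra.
From mathcomp Require Import all_classical all_reals all_analysis.
From mathcomp Require Import measurable_realfun.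
From mathcomp Require Import zify ring lra.

Import Order.TTheory GRing.Theory Num.Theory.
Import numFieldNormedType.Exports.

Local Open Scope classical_set_scope.
Local Open Scope ring_scope.

Set Implicit Arguments.
Unset Strict Implicit.
Unset Printing Implicit Defensive.

(** At a departure the server stands on a queue that it has just emptied and
    leaves for the longer neighbour, which has [y] customers, say; the queue
    beyond that one has [l]. During the next service, which lasts
    [1 + zeta (y + P(lambda))], the queue left behind grows from 0 and the queue
    ahead grows from [l] by independent Poisson arrivals, and the server turns
    back if the queue behind ends up longer, a tie being resolved by a fair coin.
    The difference of the two counts is a simple random walk that jumps at rate
    [2 * lambda], and so is, independently, the critical queue being served. So
    the turn is decided by the place where a planar simple random walk started
    near [(l, y)] leaves the upper half-plane: its probability is essentially the
    harmonic measure of a half-line with end-point 0, and this is 1/4 when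
    [l = y], because the diagonal splits the quadrant into two symmetric halves.
    A maximum principle shows that at [(l, y)] the harmonic measure differs from
    1/4 by at most [3 * |l - y| / y] ([harmonic_quarter]).

    The planar walk is not constructed. The Laplace transform of [zeta k] is
    computed by optional stopping ([stopped_transform], [zeta_laplace]). It gives
    the generating function of the number of jumps that an independent walk makes
    by the time [zeta k], as the [k]-th power of the root of a quadratic
    equation, and that equation is the harmonicity of the turning probability
    ([corner_prob_quarter]). Replacing the fixed time by the service time of the
    greedy server gives [turn_back_quarter], and [turn_law] identifies
    [turn_back] with the conditional probability of a turn given the past.

    It remains to see that [l] and [y] are close. Service times grow doubly
    exponentially ([service_growth]): a queue left behind refills during the next
    service, so the Laplace transform of a service time at [y ^ 2] is bounded by
    that of the preceding one at [y]. In particular the last service dwarfs the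
    total duration of the previous ones, and all queues met by the server consist
    almost only of customers who arrived during that service. By Chebyshev's
    inequality and the Borel-Cantelli lemma ([ae_usual]), these queues agree up
    to a relative error of order [m / 2 ^ m] at the [m]-th departure, for all
    large [m] ([usual_turn_error]); this beats [expR (- n `^ 2^-1)]. *)

(** * Integration against restricted measures and densities *)

Section Density.
Local Open Scope ereal_scope.
Context (d : measure_display) (T : measurableType d) (R : realType).
Variables (mu nu : {measure set T -> \bar R}) (g : T -> R).
Hypotheses (mg : measurable_fun setT g) (g_ge0 : forall x, (0 <= g x)%R).
Hypothesis nuE : forall A, measurable A -> nu A = \int[mu]_(x in A) (g x)%:E.

Import HBNNSimple.

Let nuE_nnsfun (h : {nnsfun T >-> R}) :
  \int[nu]_x (h x)%:E = \int[mu]_x ((h x)%:E * (g x)%:E).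
Proof.
under eq_integral do rewrite fimfunE -fsumEFin//.
rewrite ge0_integral_fsum//; last 2 first.
- by move=> r; exact/measurable_EFinP/measurable_funM.
- by move=> r x _; rewrite nnfun_muleindic_ge0.
under [RHS]eq_integral => x _.
  rewrite fimfunE -fsumEFin// ge0_mule_fsuml; last first.
    by move=> r; rewrite EFinM nnfun_muleindic_ge0.
  over.
rewrite ge0_integral_fsum//; last 2 first.
- move=> r; apply: emeasurable_funM; last exact/measurable_EFinP.
  by apply/measurable_EFinP/measurable_funM.
- move=> r x _; apply: mule_ge0; last by rewrite lee_fin.
  by rewrite EFinM nnfun_muleindic_ge0.
apply: eq_fsbigr => r _.
have [r0|r0] := ltP r 0%R.
  by rewrite !integral0_eq// => x _;
    rewrite preimage_nnfun0// indicE in_set0 mulr0 ?mul0e.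
have mr : measurable (h @^-1` [set r]) by [].
rewrite (integralZl_indic_nnsfun)// integral_indic// setIT nuE//.
rewrite integral_mkcond -ge0_integralZl//; last 2 first.
- apply/measurable_restrict => //.
  exact/measurable_EFinP/measurable_funTS.
- by move=> x _; apply: erestrict_ge0 => y _; rewrite lee_fin.
apply: eq_integral => x _; rewrite patchE indicE.
by case: ifPn => _; rewrite /= ?mulr1 ?mulr0 ?mul0e ?mule0.
Qed.

(** Integrating against a density: simple functions first, then monotone
    limits. *)
Lemma ge0_integral_density (f : T -> \bar R) :
  measurable_fun setT f -> (forall x, 0 <= f x) ->
  \int[nu]_x f x = \int[mu]_x (f x * (g x)%:E).
Proof.
move=> mf f0; pose f_ := nnsfun_approx measurableT mf.
have cvf x : (f_ n x)%:E @[n --> \oo] --> f x.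
  exact: cvg_nnsfun_approx.
have ndf x : nondecreasing_seq (fun n => (f_ n x)%:E).
  by move=> m n mn; rewrite lee_fin; exact/lefP/nd_nnsfun_approx.
have -> : \int[nu]_x f x = limn (fun n => \int[nu]_x (f_ n x)%:E).
  rewrite -monotone_convergence//.
  - by apply: eq_integral => x _; apply/esym/cvg_lim.
  - by move=> n; exact/measurable_EFinP.
  - by move=> n x _; rewrite lee_fin.
under eq_fun do rewrite nuE_nnsfun.
rewrite -monotone_convergence//.
- apply: eq_integral => x _; apply/cvg_lim => //.
  exact: cvgeZr.
- by move=> n; apply: emeasurable_funM; exact/measurable_EFinP.
- by move=> n x _; rewrite mule_ge0 ?lee_fin.
- move=> x _ m n mn; rewrite lee_wpmul2r ?lee_fin//.
  by have := ndf x m n mn; rewrite lee_fin.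
Qed.

End Density.

Section Restriction.
Local Open Scope ereal_scope.
Context (d : measure_display) (T : measurableType d) (R : realType).

(** A restriction has an indicator for density. *)
Lemma ge0_integral_mrestr (mu : {measure set T -> \bar R}) (D : set T)
    (mD : measurable D) (f : T -> \bar R) :
  measurable_fun setT f -> (forall x, 0 <= f x) ->
  \int[mrestr mu mD]_x f x = \int[mu]_(x in D) f x.
Proof.
move=> mf f0.
rewrite (@ge0_integral_density _ _ _ mu (mrestr mu mD) (\1_D))//.
- rewrite [RHS]integral_mkcond; apply: eq_integral => x _.
  rewrite patchE indicE.
  by case: ifPn => _; rewrite ?mule1 ?mule0.
- move=> A mA; rewrite /mrestr integral_indic//.
  by rewrite setIC.
Qed.

End Restriction.

(** * Freezing a variable that is independent of the past *)

(** Product measures ask for a canonical finite measure; this provides one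
    without changing the underlying set function. *)
Lemma finite_measure_exists (d : measure_display) (T : measurableType d)
    (R : realType) (mu : {measure set T -> \bar R}) :
  (mu setT < +oo)%E ->
  exists nu : {finite_measure set T -> \bar R}, (nu : set T -> \bar R) = mu.
Proof.
move=> muT; have mT := @measurableT _ T.
by exists (mfrestr mT muT); apply/funext => A; rewrite /= /mfrestr /mrestr /= setIT.
Qed.

Lemma image_measure_exists (d d' : measure_display) (T : measurableType d)
    (U : measurableType d') (R : realType) (mu : {measure set T -> \bar R})
    (f : T -> U) (mf : measurable_fun setT f) :
  exists nu : {measure set U -> \bar R},
    (nu : set U -> \bar R) = pushforward mu f.
Proof. by unshelve eexists (pushforward mu f). Qed.

Lemma measurable_id_sub (d : measure_display) (Om : measurableType d)
    (G : set (set Om)) :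
  <<s G >> `<=` measurable ->
  measurable_fun setT (id : Om -> g_sigma_algebraType G).
Proof. by move=> sG _ B mB; rewrite setTI; exact: sG. Qed.

Section Freezing.
Local Open Scope ereal_scope.
Context (d : measure_display) (Om : measurableType d) (R : realType).
Variables (P : probability Om R) (G : set (set Om)).
Hypothesis sG : <<s G >> `<=` measurable.
Variables (D : set Om) (mD : measurable D).
Context (dU : measure_display) (U : measurableType dU).
Variables (X : Om -> U) (mX : measurable_fun setT X).
Variable nu : {measure set U -> \bar R}.
Hypothesis nu_fin : nu setT < +oo.
Hypothesis indep : forall C B, <<s G >> C -> measurable B ->
  P (D `&` C `&` X @^-1` B) = P (D `&` C) * nu B.

(** If [X] has, on the event [D], the law [nu] independently of a
    sub-sigma-algebra, then in an expectation over [D] every quantity measurable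
    for that sub-sigma-algebra may be frozen while [X] is integrated against
    [nu]; the two finite measures on the product agree on rectangles. *)
Lemma freezing (F : g_sigma_algebraType G * U -> \bar R) :
  measurable_fun setT F -> (forall z, 0 <= F z) ->
  \int[P]_(w in D) F (w, X w) = \int[P]_(w in D) \int[nu]_x F (w, x).
Proof.
move=> mF F0.
have mid := measurable_id_sub sG.
pose pr (w : Om) : g_sigma_algebraType G * U := (w, X w).
have mpr : measurable_fun setT pr by exact/measurable_fun_pairP.
have [nu' nu'E] := finite_measure_exists nu_fin.
have [m0 m0E] := image_measure_exists (mrestr P mD) mid.
have [m1 m1E] : exists m : {finite_measure set (g_sigma_algebraType G) -> \bar R},
    (m : set _ -> \bar R) = m0.
  apply: finite_measure_exists.
  rewrite m0E /pushforward preimage_setT /mrestr.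
  by apply: le_lt_trans (probability_le1 P _) (ltry 1); exact: measurableI.
have [m' m'E] := image_measure_exists (mrestr P mD) mpr.
have m'prod X0 : measurable X0 -> (m1 \x nu')%E X0 = m' X0.
  apply: product_measure_unique => A B mA mB.
  rewrite [RHS](_ : _ = P (A `&` D) * nu B); last first.
    congr (_ * _); last exact: (congr1 (@^~ B) nu'E).
    exact: (etrans (congr1 (@^~ A) m1E) (congr1 (@^~ A) m0E)).
  rewrite m'E /pushforward /mrestr.
  rewrite [A `&` D]setIC -indep//; congr (P _).
  by apply/seteqP; split => w /=; rewrite /pr/=; tauto.
transitivity (\int[m']_z F z).
  rewrite m'E ge0_integral_pushforward//= preimage_setT.
  rewrite ge0_integral_mrestr//; exact: measurableT_comp.
rewrite -(@eq_measure_integral _ _ _ _ m' (m1 \x nu')%E); last first.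
  by move=> A mA _; exact: m'prod.
rewrite fubini_tonelli1// /fubini_F.
have -> : \int[m1]_x \int[nu']_y F (x, y) =
    \int[pushforward (mrestr P mD) (id : Om -> g_sigma_algebraType G)]_x \int[nu']_y F (x, y).
  have e := etrans m1E m0E.
  exact: (congr1 (fun m => integral m setT (fun x => \int[nu']_y F (x, y))) e).
have mFF : measurable_fun [set: g_sigma_algebraType G]
   (fun x => \int[nu']_y F (x, y)).
  exact: measurable_fun_fubini_tonelli_F.
rewrite ge0_integral_pushforward//=; last first.
  by move=> x _; apply: integral_ge0.
rewrite preimage_setT ge0_integral_mrestr//.
- by apply: eq_integral => w _ /=; rewrite nu'E.
- exact: (measurableT_comp mFF mid).
- by move=> w; apply: integral_ge0.
Qed.

End Freezing.

(** * Exponential variables *)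

Section ExponentialVariable.
Local Open Scope ereal_scope.
Context (d : measure_display) (Om : measurableType d) (R : realType).
Variables (P : probability Om R) (X : {RV P >-> R}) (lambda : R).
Hypothesis lambda_gt0 : (0 < lambda)%R.
Hypothesis lawX : forall B, measurable B ->
  P (X @^-1` B) = exponential_prob lambda B.

(** Exponential tilting of an exponential law beyond a level [c]: the integrand
    is again a multiple of an exponential density, of rate [lambda - beta]. *)
Lemma exponential_tilted_tail (c beta : R) : (0 <= c)%R -> (beta < lambda)%R ->
  \int[P]_w (\1_(`]c, +oo[) (X w) * expR (beta * X w))%:E =
  (lambda / (lambda - beta) * expR (- (lambda - beta) * c))%:E.
Proof.
move=> c0 bl; have lb : (0 < lambda - beta)%R by rewrite subr_gt0.
have lbn : (lambda - beta)%R != 0%R by rewrite gt_eqF.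
pose X' : Om -> measurableTypeR R := X.
have mX' : measurable_fun setT X'.
  have mX : measurable_fun setT X by [].
  exact: mX.
pose f (x : measurableTypeR R) := (\1_(`]c, +oo[) x * expR (beta * x))%:E.
have mE : measurable_fun setT (fun x : measurableTypeR R => expR (beta * x)).
  apply: (@continuous_measurable_fun R) => x.
  apply: continuous_comp; last exact: continuous_expR.
  exact: mulrl_continuous.
have mf : measurable_fun setT f.
  apply/measurable_EFinP; exact: measurable_funM.
have f0 x : 0 <= f x by rewrite lee_fin mulr_ge0 ?expR_ge0.
have [nu nuE] := image_measure_exists P mX'.
transitivity (\int[nu]_x f x).
  by rewrite nuE ge0_integral_pushforward.
rewrite (@ge0_integral_density _ _ _ lebesgue_measure _
  (exponential_pdf lambda))//.
- have -> : \int[lebesgue_measure]_x ((\1_(`]c, +oo[) x * expR (beta * x))%:E *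
        (exponential_pdf lambda x)%:E) =
      \int[lebesgue_measure]_(x in `]c, +oo[)
         (lambda * expR (- (lambda - beta) * x))%:E.
    rewrite [RHS]integral_mkcond; apply: eq_integral => x _.
    rewrite patchE indicE; case: ifPn => xc; last by rewrite mul0r mul0e.
    move: xc; rewrite inE/= in_itv/= andbT => xc.
    rewrite mul1r -EFinM exponential_pdfE ?(le_trans c0 (ltW xc))//.
    by rewrite mulrCA -expRD; congr (_ * expR _)%:E; ring.
  have cE (a : R) : continuous (fun x : R^o => expR (a * x)%R : R^o).
    move=> x; apply: continuous_comp; last exact: continuous_expR.
    exact: mulrl_continuous.
  rewrite integral_itv_obnd_cbnd; last first.
    apply/measurable_EFinP; apply: measurable_funTS; apply: measurable_funM => //.
    by apply: (@continuous_measurable_fun R); exact: cE.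
  rewrite (@ge0_continuous_FTC2y _ _
    (fun x => - (lambda / (lambda - beta) * expR (- (lambda - beta) * x)))%R c 0%R).
  + by rewrite -EFinB sub0r opprK.
  + by move=> x _; rewrite mulr_ge0 ?expR_ge0// ltW.
  + apply: continuous_subspaceT => x.
    apply: (@continuousM _ R^o (fun=> lambda)
      (fun x : R => expR (- (lambda - beta) * x)%R)); last exact: cE.
    exact: cst_continuous.
  + rewrite -oppr0; apply: cvgN; rewrite -[X in _ --> X](mulr0 (lambda / (lambda - beta))%R).
    apply: cvgMr.
    rewrite (_ : (fun x => expR (- (lambda - beta) * x)%R) =
               (fun z => expR (- z)%R) \o (fun z => (lambda - beta) * z)%R); last first.
      by apply: eq_fun => x; rewrite mulNr.
    apply: (@cvg_comp _ _ _ _ _ _ (pinfty_nbhs R)); last exact: cvgr_expR.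
    exact: gt0_cvgMry.
  + by move=> x _; exact: ex_derive.
  + apply: cvg_at_right_filter; apply: cvgN; apply: cvgMr; exact: cE.
  + move=> x _; rewrite derive1E.
    have h1 : is_derive x (1 : R)%R (fun y : R => - (lambda - beta) * y)%R
        (- (lambda - beta))%R.
      by apply: is_derive_eq; rewrite /GRing.scale/= mulr1.
    have h2 := @is_derive1_comp _ expR _ _ _ _ (is_derive_expR _) h1.
    have h3 := is_deriveN (is_deriveZ (lambda / (lambda - beta))%R h2).
    have e : (fun y : R =>
        - (lambda / (lambda - beta) * expR (- (lambda - beta) * y)))%R =
        (- ((lambda / (lambda - beta))%R \*:
           (expR \o (fun y : R => - (lambda - beta) * y))))%R by [].
    rewrite e (@derive_val _ _ _ _ _ _ _ h3) /GRing.scale/=.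
    by field.
- exact: measurable_exponential_pdf.
- by move=> x; apply: exponential_pdf_ge0; exact: ltW.
- by move=> A mA; rewrite nuE -[LHS]/(P (X @^-1` A)) lawX.
Qed.

End ExponentialVariable.

(** * The arrival and service clocks of the reference queue *)

Section ClockIndependence.
Local Open Scope ereal_scope.
Context (d : measure_display) (Om : measurableType d) (R : realType).
Variables (P : probability Om R) (A S : nat -> {RV P >-> R}) (lambda : R).
Hypothesis lambda_gt0 : (0 < lambda)%R.
Hypothesis inputAS : MM1_input lambda lambda A S.

(** Arrivals and services play the same part in the independence statements, so
    they are merged into one family indexed by a boolean. *)
Definition clock (b : bool) (i : nat) : {RV P >-> R} := if b then A i else S i.

Definition cylinder (N : nat) (B : bool -> nat -> set R) : set Om :=
  \bigcap_(i in `I_N) (A i @^-1` B true i `&` S i @^-1` B false i).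

(** Cylinders that put no constraint on the clock [(b, j)]: a pi-system
    generating the sigma-algebra of all the other clocks. *)
Definition other_clocks (b : bool) (j : nat) : set (set Om) :=
  [set E | exists N B, [/\ forall b i, measurable (B b i),
                           B b j = setT & E = cylinder N B]].

Lemma measurable_cylinder N B :
  (forall b i, measurable (B b i)) -> measurable (cylinder N B).
Proof.
move=> mB; apply: fin_bigcap_measurable => // i _.
by apply: measurableI; exact: measurable_funPTI.
Qed.

Lemma other_clocks_measurable b j : other_clocks b j `<=` measurable.
Proof. by move=> E [N [B [mB _ ->]]]; exact: measurable_cylinder. Qed.

Lemma sigma_other_clocks_measurable b j :
  <<s other_clocks b j >> `<=` measurable.
Proof.
apply: smallest_sub; first exact: sigma_algebra_measurable.
exact: other_clocks_measurable.
Qed.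

(** Cylinders of different depths can be compared after unconstrained levels
    have been added. *)
Lemma cylinder_widen N N' B : (N <= N')%N ->
  cylinder N B = cylinder N' (fun b i => if (i < N)%N then B b i else setT).
Proof.
move=> NN'; apply/seteqP; split => w H i /= iN.
  by case: ifPn => // iN'; exact: H.
by have := H i (leq_trans iN NN'); rewrite iN.
Qed.

Lemma cylinderI N B C :
  cylinder N B `&` cylinder N C = cylinder N (fun b i => B b i `&` C b i).
Proof.
apply/seteqP; split => w /=.
  by move=> [HB HC] i iN; have [] := HB i iN; have [] := HC i iN.
by move=> H; split => i iN; have [[? ?] [? ?]] := H i iN.
Qed.

Lemma setI_closed_other_clocks b j : setI_closed (other_clocks b j).
Proof.
move=> _ _ [N [B [mB Bj ->]]] [M [C [mC Cj ->]]].
rewrite (cylinder_widen _ (leq_maxl N M)) (cylinder_widen C (leq_maxr N M)).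
rewrite cylinderI; do 2 eexists; split; last reflexivity.
- by move=> b' i; apply: measurableI; case: ifPn.
- by rewrite /= Bj Cj !if_same setIT.
Qed.

Let expT : exponential_prob lambda [set: R] = 1.
Proof. exact: integral_exponential_pdf. Qed.

Lemma cylinder_prob N B : (forall b i, measurable (B b i)) ->
  P (cylinder N B) = \prod_(i < N) (exponential_prob lambda (B true i) *
                                    exponential_prob lambda (B false i)).
Proof. by move=> mB; exact: inputAS. Qed.

Lemma clock_law b j B : measurable B ->
  P (clock b j @^-1` B) = exponential_prob lambda B.
Proof.
move=> mB.
pose C b' i := if (b' == b) && (i == j) then B else [set: R].
have -> : clock b j @^-1` B = cylinder j.+1 C.
  apply/seteqP; split => w /= H.
    move=> i /= iN; rewrite /C; move: H; rewrite /clock.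
    by case: (b) => H; split => //=; case: eqP => //= ->.
  have := H j (ltnSn j); rewrite /C !eqxx !andbT /clock.
  by case: (b) => /= -[].
rewrite cylinder_prob; last by move=> b' i; rewrite /C; case: ifP.
rewrite (bigD1 (@ord_max j))//= big1; last first.
  move=> i ij; rewrite /C (_ : (i == j :> nat) = false) ?andbF ?expT ?mule1//.
  by apply/negbTE; apply: contra ij => /eqP ij; apply/eqP/val_inj.
by rewrite mule1 /C eqxx !andbT; case: (b) => /=; rewrite expT ?mule1 ?mul1e.
Qed.

Lemma clock_indep_cylinder b j N B C : (forall b i, measurable (B b i)) ->
  B b j = setT -> measurable C ->
  P (cylinder N B `&` clock b j @^-1` C) =
  P (cylinder N B) * exponential_prob lambda C.
Proof.
move=> mB Bj mC.
pose M := maxn N j.+1; rewrite (cylinder_widen _ (leq_maxl N j.+1)) -/M.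
set B' := fun _ _ => _.
have mB' b' i : measurable (B' b' i) by rewrite /B'; case: ifP.
have B'j : B' b j = setT by rewrite /B' Bj if_same.
pose C' b' i := if (b' == b) && (i == j) then C else B' b' i.
have jM : (j < M)%N by rewrite /M leq_maxr.
have -> : cylinder M B' `&` clock b j @^-1` C = cylinder M C'.
  apply/seteqP; split => w /=.
    move=> [H HC] i /= iM; have [H1 H2] := H i iM.
    rewrite /C'; case: (eqVneq i j) => [ij|ij]; rewrite ?andbF//= !andbT.
    by subst i; move: HC; rewrite /clock; case: (b) => /=.
  move=> H; split.
    move=> i /= iM; have := H i iM; rewrite /C' /=.
    case: (eqVneq i j) => [ij|ij]; rewrite ?andbF//= !andbT.
    by subst i; move: B'j; case: (b) => /= -> [].
  by have := H j jM; rewrite /C' eqxx !andbT /clock; case: (b) => /= -[].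
have mC' b' i : measurable (C' b' i) by rewrite /C'; case: ifP.
rewrite !cylinder_prob// (bigD1 (Ordinal jM))//= [in RHS](bigD1 (Ordinal jM))//=.
have -> : exponential_prob lambda (C' true j) * exponential_prob lambda (C' false j)
    = exponential_prob lambda (B' true j) * exponential_prob lambda (B' false j)
      * exponential_prob lambda C.
  rewrite /C' eqxx !andbT; move: B'j; case: (b) => /= ->; rewrite expT.
    by rewrite mul1e muleC.
  by rewrite mule1.
rewrite -!muleA; congr (_ * (_ * _)); rewrite muleC; congr (_ * _).
apply: eq_bigr => i ij; rewrite /C' (_ : (i == j :> nat) = false) ?andbF//.
by apply/negbTE; apply: contra ij => /eqP ij; apply/eqP/val_inj.
Qed.

(** Independence extends from the cylinders to the sigma-algebra that they
    generate, because two finite measures that agree on a pi-system agree there;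
    the trivial intersections match the hypothesis of [freezing]. *)
Lemma clock_indep b j E C : <<s other_clocks b j >> E -> measurable C ->
  P (setT `&` E `&` clock b j @^-1` C) =
  P (setT `&` E) * distribution P (clock b j) C.
Proof.
move=> sE mC; rewrite setTI.
have mXC : measurable (clock b j @^-1` C) by exact: measurable_funPTI.
have p0 : (0 <= fine (P (clock b j @^-1` C)))%R by exact: fine_ge0.
pose c : {nonneg R} := NngNum p0.
have pE : (fine (P (clock b j @^-1` C)))%:E = P (clock b j @^-1` C).
  by rewrite fineK// fin_num_measure.
have -> : P E * distribution P (clock b j) C = mscale c P E.
  by rewrite /mscale/= pE muleC.
rewrite -[LHS]/(mrestr P mXC E).
apply: (@g_sigma_algebra_measure_unique _ _ _ (other_clocks b j)
  (@other_clocks_measurable b j) (fun=> setT)) => //.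
- move=> _; exists 0%N, (fun _ _ => setT); split => //.
  by apply/seteqP; split => // w _ i.
- by rewrite bigcup_const//; exists 0%N.
- exact: setI_closed_other_clocks.
- move=> _ [N [B [mB Bj ->]]]; 
  rewrite -[LHS]/(P (cylinder N B `&` clock b j @^-1` C)).
  rewrite -[RHS]/((fine (P (clock b j @^-1` C)))%:E * P (cylinder N B)) pE.
  by rewrite clock_law// clock_indep_cylinder// muleC.
- move=> _; rewrite -[X in X < _]/(P (setT `&` clock b j @^-1` C)) setTI.
  by rewrite -ge0_fin_numE// fin_num_measure.
Qed.

Lemma measurable_other_clock b j b' i : (b', i) != (b, j) ->
  measurable_fun setT
    (clock b' i : g_sigma_algebraType (other_clocks b j) -> R).
Proof.
move=> bi _ C mC; rewrite setTI; apply: sub_sigma_algebra.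
pose B b0 i0 := if (b0 == b') && (i0 == i) then C else [set: R].
exists i.+1, B; split.
- by move=> b0 i0; rewrite /B; case: ifP.
- rewrite /B; case: ifP => // /andP[/eqP bb /eqP ji].
  by move: bi; rewrite bb ji eqxx.
- apply/seteqP; split => w /= H.
    move=> i0 /= iN; rewrite /B; move: H; rewrite /clock/=.
    by case: (b') => H; split => //=; case: eqP => //= ->.
  have := H i (ltnSn i); rewrite /B !eqxx !andbT /clock.
  by case: (b') => /= -[].
Qed.

(** Special case of [freezing] in which the integrand is a product. *)
Lemma integral_clock_product b j
    (g : g_sigma_algebraType (other_clocks b j) -> \bar R) (f : R -> \bar R) :
  measurable_fun setT g -> (forall w, 0 <= g w) ->
  measurable_fun setT f -> (forall x, 0 <= f x) ->
  \int[P]_w (g w * f (clock b j w)) =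
  \int[P]_w g w * \int[P]_w f (clock b j w).
Proof.
move=> mg g0 mf f0.
have sG := @sigma_other_clocks_measurable b j.
have mid := measurable_id_sub sG.
have nuT : distribution P (clock b j) setT < +oo.
  by rewrite probability_setT ltry.
rewrite (@freezing _ _ _ _ _ sG setT measurableT _ _ _ _
  (distribution P (clock b j)) nuT (@clock_indep b j)
  (fun z => g z.1 * f z.2)) /=.
- under eq_integral => w _ do
    rewrite ge0_integralZl// ge0_integral_distribution//.
  rewrite ge0_integralZr//; last by apply: integral_ge0 => x _; exact: f0.
  exact: (measurableT_comp mg mid).
- by [].
- apply: emeasurable_funM; first exact: (measurableT_comp mg measurable_fst).
  exact: (measurableT_comp mf measurable_snd).
- by move=> z; rewrite mule_ge0.
Qed.

End ClockIndependence.

(** * Epochs of the reference queue before it empties *)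

Lemma indic_congr (R : pzRingType) (T U : Type) (A : set T) (B : set U) x y :
  (A x <-> B y) -> \1_A x = \1_B y :> R.
Proof.
move=> h; rewrite !indicE; congr (nat_of_bool _)%:R.
by apply/idP/idP => /set_mem/h/mem_set.
Qed.

Section Epochs.
Context (d : measure_display) (T : measurableType d) (R : realType).
Implicit Types (u : nat -> T -> R) (f g : T -> R).

Definition epoch u (n : nat) (w : T) : R := \sum_(i < n) u i w.

Lemma epochS u n w : epoch u n.+1 w = epoch u n w + u n w.
Proof. by rewrite /epoch big_ord_recr. Qed.

Lemma epoch0 u w : epoch u 0 w = 0.
Proof. by rewrite /epoch big_ord0. Qed.

Lemma measurable_epoch u n :
  (forall i, (i < n)%N -> measurable_fun setT (u i)) ->
  measurable_fun setT (epoch u n).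
Proof.
move=> mu; elim: n mu => [|n IH] mu.
  by rewrite (_ : epoch u 0 = cst 0)//; apply/funext => w; rewrite epoch0.
rewrite (_ : epoch u n.+1 = (epoch u n \+ u n)); last first.
  by apply/funext => w; rewrite epochS.
apply: measurable_funD; last exact: mu.
by apply: IH => i iN; apply: mu; rewrite ltnS ltnW.
Qed.

Lemma measurable_le_set f g : measurable_fun setT f -> measurable_fun setT g ->
  measurable [set w | f w <= g w].
Proof.
move=> mf mg; have := measurable_fun_ler mf mg measurableT.
by move=> /(_ [set true] I); rewrite setTI.
Qed.

Lemma measurable_lt_set f g : measurable_fun setT f -> measurable_fun setT g ->
  measurable [set w | f w < g w].
Proof.
move=> mf mg; have := measurable_fun_ltr mf mg measurableT.
by move=> /(_ [set true] I); rewrite setTI.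
Qed.

(** Started from [k] customers, the queue has not emptied by the end of the
    service number [k + n]: each of these services ends after enough arrivals. *)
Definition still_busy (a s : nat -> T -> R) (k n : nat) : set T :=
  [set w | (forall i, (i < n)%N -> epoch a i.+1 w <= epoch s (k + i) w) /\
           (forall i, (i < k + n)%N -> 0 <= s i w)].

Lemma still_busyS a s k n : still_busy a s k n.+1 =
  still_busy a s k n `&` [set w | epoch a n.+1 w <= epoch s (k + n) w] `&`
  [set w | 0 <= s (k + n)%N w].
Proof.
apply/seteqP; split => w /=.
  move=> [H1 H2]; split; [split; [split|]|] => [i iN|i iN||].
  - by apply: H1; rewrite ltnS ltnW.
  - by apply: H2; rewrite addnS ltnS ltnW.
  - exact: H1.
  - by apply: H2; rewrite addnS.
move=> [[[H1 H2] H3] H4]; split => i.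
  by rewrite ltnS leq_eqVlt => /orP[/eqP ->//|]; exact: H1.
by rewrite addnS ltnS leq_eqVlt => /orP[/eqP ->//|]; exact: H2.
Qed.

Lemma measurable_still_busy a s k n :
  (forall i, (i < n)%N -> measurable_fun setT (a i)) ->
  (forall i, (i < k + n)%N -> measurable_fun setT (s i)) ->
  measurable (still_busy a s k n).
Proof.
move=> ma ms.
have -> : still_busy a s k n =
    (\bigcap_(i in `I_n) [set w | epoch a i.+1 w <= epoch s (k + i) w]) `&`
    (\bigcap_(i in `I_(k + n)) [set w | 0 <= s i w]).
  by apply/seteqP; split => w /= [H1 H2]; split => i /=; by [apply: H1|apply: H2].
apply: measurableI; apply: fin_bigcap_measurable => // i /= iN.
  apply: measurable_le_set; apply: measurable_epoch => j jN.
    by apply: ma; apply: leq_trans jN iN.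
  by apply: ms; apply: (leq_trans jN); rewrite leq_add2l ltnW.
apply: measurable_le_set; first exact: measurable_cst.
exact: ms.
Qed.

Lemma epoch_le_busy a s k n w : still_busy a s k n w ->
  epoch a n w <= epoch s (k + n) w.
Proof.
move=> [H1 H2]; case: n H1 H2 => [|n] H1 H2.
  rewrite epoch0 /epoch; apply: sumr_ge0 => i _.
  exact: H2.
apply: (le_trans (H1 n _)) => //; rewrite addnS epochS lerDl H2// addnS//.
Qed.

End Epochs.

Section TimeToEmptyTransform.
Local Open Scope ereal_scope.
Context (d : measure_display) (Om : measurableType d) (R : realType).
Variables (P : probability Om R) (A S : nat -> {RV P >-> R}) (lambda : R).
Hypothesis lambda_gt0 : (0 < lambda)%R.
Hypothesis inputAS : MM1_input lambda lambda A S.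

Lemma clock_neg_null b j : P [set w | (clock A S b j w < 0)%R] = 0.
Proof.
rewrite (_ : [set w | _] = clock A S b j @^-1` `]-oo, 0%R[); last first.
  by apply/seteqP; split => w /=; rewrite in_itv.
rewrite (clock_law lambda_gt0 inputAS)// /exponential_prob integral0_eq//.
by move=> x /=; rewrite in_itv/= => x0; rewrite lt0_exponential_pdf.
Qed.

(** Clocks take nonpositive values with probability zero, but not nowhere: all
    path-wise statements about epochs have to be relativized to this event. *)
Lemma clock_le0_null b j : P [set w | (clock A S b j w <= 0)%R] = 0.
Proof.
have h := @exponential_tilted_tail _ _ _ P (clock A S b j) lambda lambda_gt0
  (clock_law lambda_gt0 inputAS b j) 0%R 0%R (lexx _) lambda_gt0.
have m : measurable [set w | (0 < clock A S b j w)%R].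
  by apply: measurable_lt_set.
have : P [set w | (0 < clock A S b j w)%R] = 1.
  rewrite -[RHS](_ : (lambda / (lambda - 0) * expR (- (lambda - 0) * 0))%:E = _).
    rewrite -h; transitivity
      (\int[P]_w (\1_[set w | (0 < clock A S b j w)%R] w)%:E).
      by rewrite integral_indic// setIT.
    apply: eq_integral => w _; rewrite mul0r expR0 mulr1.
    by congr (_%:E); apply: indic_congr; rewrite /= in_itv/= andbT.
  by rewrite subr0 divff ?gt_eqF// mulr0 expR0 mulr1.
move=> p1.
rewrite (_ : [set w | _] = ~` [set w | (0 < clock A S b j w)%R]); last first.
  by apply/seteqP; split => w /=; rewrite leNgt => /negP.
by rewrite probability_setC// p1 subee.
Qed.

Lemma expectation_exp_clock b j (beta : R) : (beta < lambda)%R ->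
  \int[P]_w (expR (beta * clock A S b j w))%:E = (lambda / (lambda - beta))%:E.
Proof.
move=> bl.
have h := @exponential_tilted_tail _ _ _ P (clock A S b j) lambda lambda_gt0
  (clock_law lambda_gt0 inputAS b j) 0%R beta (lexx _) bl.
rewrite mulr0 expR0 mulr1 in h; rewrite -h.
have mE : measurable_fun setT (fun w => (expR (beta * clock A S b j w))%R).
  by apply: measurableT_comp => //; exact: measurable_funM.
apply: ge0_ae_eq_integral => //.
- exact/measurable_EFinP.
- apply/measurable_EFinP; apply: measurable_funM => //.
  apply: measurableT_comp => //; exact: measurable_indic.
exists [set w | (clock A S b j w <= 0)%R]; split.
- by apply: measurable_le_set.
- exact: clock_le0_null.
move=> w /= /not_implyP[_]; apply: contra_notP => /negP; rewrite -ltNge => w0.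
by rewrite indicE mem_set ?mul1r//= in_itv/= w0.
Qed.

End TimeToEmptyTransform.

(** * Optional stopping for the exponential martingale *)

Section StoppedExponentialMartingale.
Local Open Scope ereal_scope.
Context (d : measure_display) (Om : measurableType d) (R : realType).
Variables (P : probability Om R) (A S : nat -> {RV P >-> R}) (lambda : R).
Hypothesis lambda_gt0 : (0 < lambda)%R.
Hypothesis inputAS : MM1_input lambda lambda A S.

(** Tilted tail of an arrival clock beyond a level that depends on the other
    clocks only: this is where the exponential law loses its memory. *)
Lemma clock_overshoot b j (beta : R)
    (g c : g_sigma_algebraType (other_clocks A S b j) -> R) :
  (beta < lambda)%R ->
  measurable_fun setT g -> measurable_fun setT c ->
  (forall w, 0 <= g w)%R -> (forall w, g w != 0 -> 0 <= c w)%R ->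
  \int[P]_w (g w * (\1_[set v | (c v < clock A S b j v)%R] w
                    * expR (beta * clock A S b j w)))%:E =
  \int[P]_w (lambda / (lambda - beta) *
             (g w * expR (- (lambda - beta) * c w)))%:E.
Proof.
move=> bl mg mc g0 c0.
have sG := @sigma_other_clocks_measurable _ _ _ P A S b j.
have nuT : distribution P (clock A S b j) setT < +oo.
  by rewrite probability_setT ltry.
pose F (z : g_sigma_algebraType (other_clocks A S b j) * R) :=
  (g z.1 * (\1_[set v : g_sigma_algebraType (other_clocks A S b j) * R |
     (c v.1 < v.2)%R] z * expR (beta * z.2)))%:E.
have mF : measurable_fun setT F.
  apply/measurable_EFinP; apply: measurable_funM.
    exact: (measurableT_comp mg measurable_fst).
  apply: measurable_funM; last by apply: measurableT_comp => //; exact: measurable_funM.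
  apply: measurable_indic; apply: measurable_lt_set; last exact: measurable_snd.
  exact: (measurableT_comp mc measurable_fst).
have F0 z : 0 <= F z by rewrite lee_fin !mulr_ge0.
rewrite [LHS](_ : _ = \int[P]_w F (w, clock A S b j w)); last first.
  by apply: eq_integral => w _; rewrite /F/= !indicE.
rewrite (@freezing _ _ _ _ _ sG setT measurableT _ _ _ _
  (distribution P (clock A S b j)) nuT 
  (@clock_indep _ _ _ _ _ _ _ lambda_gt0 inputAS b j) F)//.
apply: eq_integral => w _.
have Fw : (fun x => F (w, x)) = (fun x => (g w)%:E *
    (\1_(`]c w, +oo[) x * expR (beta * x))%:E).
  apply/funext => x; rewrite /F/= -EFinM; congr (_ * (_ * _))%:E.
  by apply: indic_congr; rewrite /= in_itv/= andbT.
have mI : measurable_fun setT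
    (fun x => (\1_(`]c w, +oo[) x * expR (beta * x))%:E).
  apply/measurable_EFinP; apply: measurable_funM; first exact: measurable_indic.
  by apply: measurableT_comp => //; exact: measurable_funM.
rewrite Fw ge0_integralZl//; last by rewrite lee_fin.
rewrite (ge0_integral_distribution (clock A S b j) mI)/=; last first.
  by move=> x; rewrite lee_fin mulr_ge0.
have [gw|gw] := eqVneq (g w) 0%R; first by rewrite gw mul0e mul0r mulr0.
rewrite (@exponential_tilted_tail _ _ _ P (clock A S b j) lambda lambda_gt0
  (clock_law lambda_gt0 inputAS b j) (c w) beta (c0 w gw) bl).
by rewrite -EFinM mulrCA.
Qed.

Lemma expectation_exp_clock_ge0 b j (beta : R) : (beta < lambda)%R ->
  \int[P]_w (\1_(`[0%R, +oo[) (clock A S b j w) *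
             expR (beta * clock A S b j w))%:E = (lambda / (lambda - beta))%:E.
Proof.
move=> bl.
have mE : measurable_fun setT (fun w => expR (beta * clock A S b j w))%R.
  by apply: measurableT_comp => //; exact: measurable_funM.
have mI (D : set R) : measurable D -> measurable_fun setT
    (fun w => (\1_D (clock A S b j w) * expR (beta * clock A S b j w))%:E).
  move=> mD; apply/measurable_EFinP; apply: measurable_funM => //.
  by apply: measurableT_comp => //; exact: measurable_indic.
have m0 : measurable (`[0%R, +oo[%classic : set R) by exact: measurable_itv.
have m1 : measurable (`]0%R, +oo[%classic : set R) by exact: measurable_itv.
have mI0 := mI _ m0; have mI1 := mI _ m1.
apply/eqP; rewrite eq_le; apply/andP; split.
  rewrite -(expectation_exp_clock lambda_gt0 inputAS b j bl).
  apply: ge0_le_integral => //.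
  - exact/measurable_EFinP.
  - by move=> w _; rewrite lee_fin ler_piMl// indicE lern1 leq_b1.
have h := @exponential_tilted_tail _ _ _ P (clock A S b j) lambda lambda_gt0
  (clock_law lambda_gt0 inputAS b j) 0%R beta (lexx _) bl.
rewrite mulr0 expR0 mulr1 in h; rewrite -h.
apply: ge0_le_integral => //.
move=> w _; rewrite lee_fin ler_wpM2r// !indicE ler_nat.
case: (boolP (clock A S b j w \in `]0%R, +oo[%classic)) => // /set_mem /=.
by rewrite in_itv/= andbT => /ltW w0; rewrite mem_set//= in_itv/= w0.
Qed.

Let a (i : nat) : Om -> R := A i.
Let s (i : nat) : Om -> R := S i.

Let a_fun j i : i != j ->
  measurable_fun setT (a i : g_sigma_algebraType (other_clocks A S true j) -> R).
Proof.
move=> ij; have := @measurable_other_clock _ _ _ P A S true j true i.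
by apply; apply: contra ij => /eqP[->].
Qed.

Let s_fun j i : measurable_fun setT
  (s i : g_sigma_algebraType (other_clocks A S true j) -> R).
Proof. exact: (@measurable_other_clock _ _ _ P A S true j false i). Qed.

Let a_fun' j i : measurable_fun setT
  (a i : g_sigma_algebraType (other_clocks A S false j) -> R).
Proof. exact: (@measurable_other_clock _ _ _ P A S false j true i). Qed.

Let s_fun' j i : i != j ->
  measurable_fun setT (s i : g_sigma_algebraType (other_clocks A S false j) -> R).
Proof.
move=> ij; have := @measurable_other_clock _ _ _ P A S false j false i.
by apply; apply: contra ij => /eqP[->].
Qed.

Lemma integral_clock_productR b j
    (g : g_sigma_algebraType (other_clocks A S b j) -> R) (f : R -> R) :
  measurable_fun setT g -> (forall w, 0 <= g w)%R ->
  measurable_fun setT f -> (forall v, 0 <= f v)%R ->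
  \int[P]_w (g w * f (clock A S b j w))%:E =
  \int[P]_w (g w)%:E * \int[P]_w (f (clock A S b j w))%:E.
Proof.
move=> mg g0 mf f0.
rewrite -(@integral_clock_product _ _ _ P A S lambda lambda_gt0 inputAS b j
  (EFin \o g) (EFin \o f)) => [|||//|//].
- by apply: eq_integral => w _; rewrite EFinM.
- exact/measurable_EFinP.
- by move=> w; rewrite lee_fin.
- exact/measurable_EFinP.
Qed.

Lemma service_transform (alpha : R) N : (0 < alpha)%R ->
  \int[P]_w (\1_[set v | forall i, (i < N)%N -> (0 <= s i v)%R] w *
             expR (- alpha * epoch s N w))%:E =
  ((lambda / (lambda + alpha)) ^+ N)%:E.
Proof.
move=> alpha0; elim: N => [|N IH].
  rewrite expr0; rewrite [LHS](_ : _ = \int[P]_w (cst 1 w)).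
    by rewrite integral_cst//= probability_setT mule1.
  apply: eq_integral => w _; rewrite epoch0 mulr0 expR0 mulr1 indicE mem_set//.
have bl : (- alpha < lambda)%R by rewrite (lt_trans _ lambda_gt0)// oppr_lt0.
pose g (w : g_sigma_algebraType (other_clocks A S false N)) :=
  (\1_[set v | forall i, (i < N)%N -> (0 <= s i v)%R] w *
             expR (- alpha * epoch s N w))%:E.
have mset : measurable ([set v | forall i, (i < N)%N -> (0 <= s i v)%R] :
    set (g_sigma_algebraType (other_clocks A S false N))).
  rewrite (_ : [set v | _] = \bigcap_(i in `I_N) [set v | (0 <= s i v)%R])//.
  apply: fin_bigcap_measurable => // i /= iN.
  apply: measurable_le_set; first exact: measurable_cst.
  by apply: s_fun'; rewrite ltn_eqF.
have mg : measurable_fun setT g.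
  apply/measurable_EFinP; apply: measurable_funM; first exact: measurable_indic.
  apply: measurableT_comp => //; apply: measurable_funM => //.
  by apply: measurable_epoch => i iN; apply: s_fun'; rewrite ltn_eqF.
pose f (x : R) := (\1_(`[0%R, +oo[) x * expR (- alpha * x))%:E.
have mf : measurable_fun setT f.
  apply/measurable_EFinP; apply: measurable_funM; first exact: measurable_indic.
  by apply: measurableT_comp => //; exact: measurable_funM.
have g0 w : 0 <= g w by rewrite lee_fin mulr_ge0.
have f0 x : 0 <= f x by rewrite lee_fin mulr_ge0.
have := @integral_clock_product _ _ _ P A S lambda lambda_gt0 inputAS false N
  g f mg g0 mf f0.
rewrite IH (expectation_exp_clock_ge0 false N bl) opprK -EFinM -exprSr => <-.
apply: eq_integral => w _; rewrite /g /f epochS mulrDr expRD -EFinM mulrACA.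
congr (_ * _)%:E.
rewrite -[X in _ = (_ * X)%R]/(\1_(s N @^-1` `[0%R, +oo[) w).
rewrite -[RHS]/((\1_[set v | forall i, (i < N)%N -> (0 <= s i v)%R] \* \1_(s N @^-1` `[0%R, +oo[)) w)%R -indicI.
apply: indic_congr; rewrite /= in_itv/= andbT; split.
  by move=> H; split=> [i iN|]; apply: H; rewrite ltnS ?leqnn// ltnW.
move=> [H sN] i.
by rewrite ltnS leq_eqVlt => /orP[/eqP ->//|]; exact: H.
Qed.


Section Stopping.
Variables (k : nat) (beta sigma : R).
Hypotheses (beta_gt0 : (0 < beta)%R) (beta_lt : (beta < lambda)%R).
Hypotheses (sigma_gt0 : (0 < sigma)%R)
  (sigmaE : (sigma * (lambda - beta) = beta ^+ 2)%R).

Let lag n w : R := (epoch s (k + n) w - epoch a n w)%R.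
Let Z n w : R := expR (- sigma * epoch s (k + n) w - beta * lag n w).
Let G n : set Om := still_busy a s k n.
(** Up to the factor [expR (- sigma * t)], the exponential martingale at the end
    of the service number [k + n] is the exponential of [beta] times the delay
    until the next arrival; the relation [sigmaE] makes it a martingale. This is
    its mean on the event that the queue has not emptied before. *)
Let x n := \int[P]_w (\1_(G n) w * Z n w * expR (beta * a n w))%:E.
(** Contribution of the paths on which the queue empties now. *)
Let y n := \int[P]_w (\1_(G n) w * expR (- sigma * epoch s (k + n) w) *
  \1_[set v | (lag n v < a n v)%R] w)%:E.
Let kA := (lambda / (lambda - beta))%R.
Let kS := (lambda / (lambda + (sigma + beta)))%R.

Let kA_gt0 : (0 < kA)%R.
Proof. by rewrite divr_gt0// subr_gt0. Qed.

Let kAS : (kA * kS = 1)%R.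
Proof.
have h1 : (lambda - beta != 0)%R by rewrite gt_eqF// subr_gt0.
have h2 : (lambda + (sigma + beta) != 0)%R by rewrite gt_eqF// !addr_gt0.
have e : ((lambda - beta) * (lambda + (sigma + beta)) = lambda ^+ 2)%R.
  by have := sigmaE; lra.
by rewrite /kA /kS mulf_div e -expr2 divff// expf_neq0// gt_eqF.
Qed.

Section Measurability.
Context (d' : measure_display) (T : measurableType d').
Variables (a' s' : nat -> T -> R) (n : nat).
Hypothesis ma : forall i, (i < n)%N -> measurable_fun setT (a' i).
Hypothesis ms : forall i, (i < k + n)%N -> measurable_fun setT (s' i).

Let mlag : measurable_fun setT
  (fun w => epoch s' (k + n) w - epoch a' n w)%R.
Proof. by apply: measurable_funB; apply: measurable_epoch. Qed.

Let mZ : measurable_fun setT (fun w => expR (- sigma * epoch s' (k + n) w -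
   beta * (epoch s' (k + n) w - epoch a' n w)))%R.
Proof.
apply: measurableT_comp => //; apply: measurable_funB.
  by apply: measurable_funM => //; exact: measurable_epoch.
exact: measurable_funM.
Qed.

Let mGZ : measurable_fun setT (fun w => \1_(still_busy a' s' k n) w *
   expR (- sigma * epoch s' (k + n) w -
   beta * (epoch s' (k + n) w - epoch a' n w)))%R.
Proof.
apply: measurable_funM => //; apply: measurable_indic.
exact: measurable_still_busy.
Qed.

Let mGs : measurable_fun setT (fun w => \1_(still_busy a' s' k n) w *
   expR (- sigma * epoch s' (k + n) w))%R.
Proof.
apply: measurable_funM.
  by apply: measurable_indic; exact: measurable_still_busy.
apply: measurableT_comp => //; apply: measurable_funM => //.
exact: measurable_epoch.
Qed.

Lemma measurable_stopping :
  [/\ measurable_fun setT (fun w => epoch s' (k + n) w - epoch a' n w)%R,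
   measurable_fun setT (fun w => \1_(still_busy a' s' k n) w *
   expR (- sigma * epoch s' (k + n) w -
   beta * (epoch s' (k + n) w - epoch a' n w)))%R &
   measurable_fun setT (fun w => \1_(still_busy a' s' k n) w *
   expR (- sigma * epoch s' (k + n) w))%R].
Proof. by split. Qed.

End Measurability.

(** When the queue empties, the next arrival comes after the end of the service,
    and the time left until then is exponential. *)
Let R1 n : \int[P]_w (\1_(G n) w * Z n w *
    (\1_[set v | (lag n v < a n v)%R] w * expR (beta * a n w)))%:E =
  kA%:E * y n.
Proof.
have [m1 m2 m3] := @measurable_stopping _
  (g_sigma_algebraType (other_clocks A S true n)) a s n
  (fun i h => a_fun (negbT (ltn_eqF h))) (fun i _ => @s_fun n i).
have lag0 w : \1_(G n) w != 0%R :> R -> (0 <= lag n w)%R.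
  rewrite indicE pnatr_eq0 eqb0 negbK inE => /epoch_le_busy.
  by rewrite subr_ge0.
rewrite (clock_overshoot (b := true) beta_lt m2 m1); last 2 first.
- by move=> w; rewrite mulr_ge0.
- by move=> w; rewrite mulf_eq0 negb_or => /andP[/lag0].
have h := clock_overshoot (b := true) (j := n) lambda_gt0 m3 m1.
rewrite [y n](_ : _ = \int[P]_w (lambda / (lambda - 0) *
   ((\1_(G n) w * expR (- sigma * epoch s (k + n) w)) *
    expR (- (lambda - 0) * lag n w)))%:E); last first.
  rewrite -h.
  - by apply: eq_integral => w _; rewrite mul0r expR0 mulr1.
  - by move=> w; rewrite mulr_ge0.
  - by move=> w; rewrite mulf_eq0 negb_or => /andP[/lag0].
rewrite -ge0_integralZl//.
- apply: eq_integral => w _; rewrite -EFinM subr0 divff ?gt_eqF// mul1r.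
  congr (_%:E); rewrite /kA -!mulrA -!expRD; congr (_ * (_ * (_ * expR _)))%R.
  by rewrite /lag; ring.
- apply/measurable_EFinP; apply: measurable_funM => //.
  have [n1 n2 n3] := @measurable_stopping _ Om a s n (fun i _ => @measurable_funPT _ _ _ _ (A i)) (fun i _ => @measurable_funPT _ _ _ _ (S i)).
  apply: measurable_funM => //; apply: measurableT_comp => //.
  exact: measurable_funM.
- by move=> w _; rewrite lee_fin !mulr_ge0// ?subr0 ?invr_ge0 ltW.
- by rewrite lee_fin ltW.
Qed.


Let mA i : measurable_fun setT (a i). Proof. exact: measurable_funPT. Qed.
Let mS i : measurable_fun setT (s i). Proof. exact: measurable_funPT. Qed.

Let Gexp n : [/\ measurable_fun setT (lag n),
   measurable_fun setT (fun w => \1_(G n) w * Z n w)%R &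
   measurable_fun setT (fun w => \1_(G n) w *
   expR (- sigma * epoch s (k + n) w))%R].
Proof. by have := @measurable_stopping _ Om a s n (fun i _ => mA i) (fun i _ => mS i). Qed.

Let x' n := \int[P]_w (\1_(G n) w * Z n w *
   (\1_[set v | (a n v <= lag n v)%R] w * expR (beta * a n w)))%:E.

(** When it does not, one more arrival and one more service bring the factors
    [kA] and [kS], which compensate each other. *)
Let R2 n : x n.+1 = x' n.
Proof.
have [m1 m2 m3] := @measurable_stopping _
  (g_sigma_algebraType (other_clocks A S true n.+1)) a s n.+1
  (fun i h => a_fun (negbT (ltn_eqF h))) (fun i _ => @s_fun n.+1 i).
rewrite /x (integral_clock_productR (b := true) (j := n.+1)
  (g := (fun w => \1_(G n.+1) w * Z n.+1 w)%R)
  (f := (fun v => expR (beta * v))%R))//; last 2 first.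
- by move=> w; rewrite mulr_ge0 ?expR_ge0.
- by apply: measurableT_comp => //; exact: measurable_funM.
rewrite (expectation_exp_clock lambda_gt0 inputAS)// -/kA.
pose g (w : g_sigma_algebraType (other_clocks A S false (k + n))) :=
  (\1_(G n) w * Z n w *
   (\1_[set v | (a n v <= lag n v)%R] w * expR (beta * a n w)))%R.
have g0 w : (0 <= g w)%R by rewrite !mulr_ge0 ?expR_ge0.
have mg : measurable_fun setT g.
  have [n1 n2 n3] := @measurable_stopping _
    (g_sigma_algebraType (other_clocks A S false (k + n))) a s n
    (fun i _ => @a_fun' _ i) (fun i h => s_fun' (negbT (ltn_eqF h))).
  apply: measurable_funM => //; apply: measurable_funM.
    by apply: measurable_indic; apply: measurable_le_set => //; exact: a_fun'.
  by apply: measurableT_comp => //; apply: measurable_funM => //; exact: a_fun'.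
have -> : \int[P]_w (\1_(G n.+1) w * Z n.+1 w)%:E = \int[P]_w (g w *
    (\1_(`[0%R, +oo[) (s (k + n)%N w) * expR (- (sigma + beta) * s (k + n)%N w)))%:E.
  apply: eq_integral => w _; congr (_%:E).
  have -> : \1_(G n.+1) w = (\1_(G n) w * \1_[set v | (a n v <= lag n v)%R] w *
      \1_(`[0%R, +oo[) (s (k + n)%N w))%R :> R.
    rewrite /G still_busyS !indicI; congr (_ * _ * _)%R; apply: indic_congr => /=.
      by rewrite epochS /lag lerBrDl.
    by rewrite in_itv/= andbT.
  rewrite /g /Z /lag addnS !epochS.
  set I1 := \1_(G n) w; set I2 := \1_[set v | _] w; set I3 := \1_(`[0%R, +oo[) _.
  have -> : expR (- sigma * (epoch s (k + n) w + s (k + n)%N w) -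
     beta * (epoch s (k + n) w + s (k + n)%N w - (epoch a n w + a n w))) =
     (expR (- sigma * epoch s (k + n) w - beta * (epoch s (k + n) w - epoch a n w))
      * expR (beta * a n w) * expR (- (sigma + beta) * s (k + n)%N w))%R.
    by rewrite -!expRD; congr expR; ring.
  by ring.
rewrite (integral_clock_productR (b := false) (j := (k + n)%N) (g := g)
  (f := (fun v => \1_(`[0%R, +oo[) v * expR (- (sigma + beta) * v))%R))//; last first.
  apply: measurable_funM; first exact: measurable_indic.
  by apply: measurableT_comp => //; exact: measurable_funM.
rewrite (expectation_exp_clock_ge0 false); last first.
  by rewrite (lt_trans _ lambda_gt0)// oppr_lt0 addr_gt0.
by rewrite opprK -/kS -muleA -EFinM mulrC kAS mule1.
Qed.

Let x_ge0 n : 0 <= x n.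
Proof. by apply: integral_ge0 => w _; rewrite lee_fin !mulr_ge0 ?expR_ge0. Qed.

Let y_ge0 n : 0 <= y n.
Proof. by apply: integral_ge0 => w _; rewrite lee_fin !mulr_ge0 ?expR_ge0. Qed.

(** Optional stopping, one step at a time. *)
Let R3 n : x n = kA%:E * y n + x n.+1.
Proof.
have [m1 m2 m3] := Gexp n.
have mea : measurable_fun setT (fun w => expR (beta * a n w)).
  by apply: measurableT_comp => //; exact: measurable_funM.
rewrite R2 /x' -R1 -ge0_integralD//; last 4 first.
- by move=> w _; rewrite lee_fin !mulr_ge0 ?expR_ge0.
- apply/measurable_EFinP; apply: measurable_funM => //; apply: measurable_funM => //.
  by apply: measurable_indic; apply: measurable_lt_set.
- by move=> w _; rewrite lee_fin !mulr_ge0 ?expR_ge0.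
- apply/measurable_EFinP; apply: measurable_funM => //; apply: measurable_funM => //.
  by apply: measurable_indic; apply: measurable_le_set.
apply: eq_integral => w _; rewrite -EFinD -mulrDr -mulrDl; congr (_ * _)%:E.
case: (ltP (lag n w) (a n w)) => h; rewrite !indicE.
  by rewrite mem_set// memNset ?addr0 ?mul1r//=; apply/negP; rewrite -ltNge.
by rewrite memNset ?mem_set ?add0r ?mul1r//=; apply/negP; rewrite -leNgt.
Qed.

Let x0E : x 0%N = (kA * kS ^+ k)%:E.
Proof.
have [m1 m2 m3] := @measurable_stopping _
  (g_sigma_algebraType (other_clocks A S true 0)) a s 0
  (fun i h => a_fun (negbT (ltn_eqF h))) (fun i _ => @s_fun 0 i).
rewrite /x (integral_clock_productR (b := true) (j := 0)
  (g := (fun w => \1_(G 0) w * Z 0 w)%R) (f := (fun v => expR (beta * v))%R))//; last 2 first.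
- by move=> w; rewrite mulr_ge0 ?expR_ge0.
- by apply: measurableT_comp => //; exact: measurable_funM.
rewrite (expectation_exp_clock lambda_gt0 inputAS)// -/kA [RHS]EFinM muleC; congr (_ * _).
rewrite /kS -service_transform ?addr_gt0//; apply: eq_integral => w _.
congr (_ * _)%:E.
  by apply: indic_congr; rewrite /G /still_busy/= addn0; split => [[]|].
by rewrite /Z /lag addn0 epoch0; congr expR; ring.
Qed.

(** The remainder decreases geometrically, so that nothing is lost at infinity. *)
Let x_bound n : x n.+1 <= ((lambda / (lambda + sigma)) ^+ (k + n))%:E.
Proof.
have [m1 m2 m3] := Gexp n.
have mea : measurable_fun setT (fun w => expR (beta * a n w)).
  by apply: measurableT_comp => //; exact: measurable_funM.
rewrite R2 -service_transform//; apply: ge0_le_integral => //.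
- by move=> w _; rewrite lee_fin !mulr_ge0 ?expR_ge0.
- apply/measurable_EFinP; apply: measurable_funM => //; apply: measurable_funM => //.
  by apply: measurable_indic; apply: measurable_le_set.
- apply/measurable_EFinP; apply: measurable_funM.
    apply: measurable_indic; rewrite (_ : [set v | _] =
      \bigcap_(i in `I_(k + n)) [set v | (0 <= s i v)%R])//.
    apply: fin_bigcap_measurable => // i /= iN.
    by apply: measurable_le_set => //; exact: mS.
  apply: measurableT_comp => //; apply: measurable_funM => //.
  by apply: measurable_epoch => i _; exact: mS.
move=> w _; rewrite lee_fin [\1_(G n) w]indicE.
have [Gw|_] := boolP (w \in G n); last by rewrite !mul0r mulr_ge0.
rewrite [X in (_ <= X * _)%R](_ : _ = 1%R); last first.
  by rewrite indicE mem_set//; exact: (set_mem Gw).2.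
rewrite !mul1r [\1_ _ w]indicE.
have [Lw|_] := boolP (w \in [set v | (a n v <= lag n v)%R]); last first.
  by rewrite mul0r mulr0.
rewrite mul1r /Z -expRD ler_expR; move: Lw; rewrite inE/= => Lw.
have : (0 <= beta * (lag n w - a n w))%R by rewrite mulr_ge0 ?subr_ge0// ltW.
by lra.
Qed.

(** The sum telescopes: the Laplace transform of the epoch at which the queue
    empties. *)
Lemma stopped_transform : \sum_(0 <= n <oo) y n = (kS ^+ k)%:E.
Proof.
have telescope N : kA%:E * \sum_(0 <= n < N) y n + x N = (kA * kS ^+ k)%:E.
  elim: N => [|N IH]; first by rewrite big_nil mule0 add0e x0E.
  rewrite big_nat_recr//= ge0_muleDr//; last by apply: sume_ge0.
  by rewrite -addeA -R3 IH.
have x_fin n : x n \is a fin_num.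
  rewrite ge0_fin_numE//; case: n => [|n]; first by rewrite x0E ltry.
  exact: le_lt_trans (x_bound n) (ltry _).
have sumE N : \sum_(0 <= n < N) y n = (kS ^+ k - kA^-1 * fine (x N))%:E.
  have kAn0 : (kA != 0)%R by rewrite gt_eqF.
  rewrite -[LHS]mul1e -(mulVf kAn0) EFinM -muleA.
  have := telescope N; rewrite -[x N in X in X -> _](fineK (x_fin N)) => /eqP.
  rewrite eq_sym -sube_eq ?fin_num_adde_defl// => /eqP <-.
  by rewrite -EFinB -EFinM mulrBr mulrA mulVf// mul1r.
apply/cvg_lim => //.
rewrite (_ : (fun n => _) = (fun N => (kS ^+ k - kA^-1 * fine (x N))%:E)); last first.
  exact/funext.
apply: cvg_EFin; first exact: nearW.
rewrite (_ : (fine \o _) = (fun N => kS ^+ k - kA^-1 * fine (x N))%R)//.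
rewrite -[X in _ --> X]subr0 -(mulr0 (kA^-1)%R).
apply: cvgB; first exact: cvg_cst.
apply: cvgMr; rewrite -(@cvg_shiftS _ (fun n => fine (x n)))/=.
pose rho := (lambda / (lambda + sigma))%R.
have rho01 : (0 <= rho < 1)%R.
  rewrite divr_ge0/= ?(ltW lambda_gt0) ?addr_ge0 ?ltW//.
  by rewrite ltr_pdivrMr ?addr_gt0// mul1r ltrDl.
apply: (@squeeze_cvgr _ _ _ _ (cst 0%R) (fun n => rho ^+ k * rho ^+ n)%R).
- apply: nearW => n; rewrite fine_ge0//= -exprD.
  have := x_bound n; rewrite -[x n.+1](fineK (x_fin _)) lee_fin.
  by [].
- exact: cvg_cst.
- rewrite -[X in _ --> X](mulr0 (rho ^+ k)%R); apply: cvgMr.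
  apply: cvg_expr; rewrite ger0_norm; by case/andP: rho01.
Qed.

End Stopping.

End StoppedExponentialMartingale.

(** * The law of the time to empty *)

Section TimeToEmptyLaw.
Local Open Scope ereal_scope.
Context (d : measure_display) (Om : measurableType d) (R : realType).
Variables (P : probability Om R) (A S : nat -> {RV P >-> R}) (lambda : R).
Hypothesis lambda_gt0 : (0 < lambda)%R.
Hypothesis inputAS : MM1_input lambda lambda A S.
Variable k : nat.

Let a (i : nat) : Om -> R := A i.
Let s (i : nat) : Om -> R := S i.
Let tte : Om -> \bar R := time_to_empty A S k.

Let mA i : measurable_fun setT (a i). Proof. exact: measurable_funPT. Qed.
Let mS i : measurable_fun setT (s i). Proof. exact: measurable_funPT. Qed.

(* The times at which exactly [n] customers have arrived and [k + n] have left
   form an interval; its left end is the only candidate it contributes. *)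
Let lo n w : R := Num.max (Num.max 0%R (epoch a n w)) (epoch s (k + n) w).
Let hi n w : R := Num.min (epoch a n.+1 w) (epoch s (k + n).+1 w).
(** The only time at which the queue can be empty after [n] arrivals: both the
    [n]-th arrival and the [k + n]-th service have occurred, the next ones have
    not. *)
Let candidate n w : \bar R := if (lo n w < hi n w)%R then (lo n w)%:E else +oo.

Let tteE w : tte w = einfs (fun n => candidate n w) 0%N.
Proof.
have loP (n : nat) (t : R) : (0 <= t)%R -> epochs_by (fun i => A i w) t n ->
    epochs_by (fun i => S i w) t (k + n) -> (lo n w <= t < hi n w)%R.
  move=> t0 /andP[a1 a2] /andP[s1 s2].
  by rewrite !ge_max lt_min t0 a1 s1 a2 s2.
have hiP (n : nat) : (lo n w < hi n w)%R -> [/\ (0 <= lo n w)%R,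
    epochs_by (fun i => A i w) (lo n w) n &
    epochs_by (fun i => S i w) (lo n w) (k + n)].
  rewrite lt_min => /andP[h1 h2]; split.
  - by rewrite !le_max lexx.
  - by apply/andP; split=> //; rewrite !le_max lexx !orbT.
  - by apply/andP; split=> //; rewrite !le_max lexx !orbT.
apply/eqP; rewrite eq_le; apply/andP; split.
  apply: le_ereal_inf_tmp => _ [n _ <-]; rewrite /candidate.
  case: ifPn => [lh|_]; last by rewrite leey.
  have [h1 h2 h3] := hiP n lh.
  apply: ge_ereal_inf; exists (lo n w)%:E => //=; exists (lo n w) => //; split => //.
  by exists n, (k + n)%N.
apply: le_ereal_inf_tmp => _ [t [t0 [n [m [h1 h2 knm]]]] <-].
rewrite -knm in h2; have /andP[lt th] := loP n t t0 h1 h2.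
apply: ge_ereal_inf; exists (candidate n w); first by exists n.
by rewrite /candidate (le_lt_trans lt th) lee_fin.
Qed.

(** The uncountable infimum over times is a countable one over the number of
    arrivals. *)
Lemma measurable_time_to_empty : measurable_fun setT tte.
Proof.
rewrite (_ : tte = fun w => einfs (fun n => candidate n w) 0%N); last exact/funext.
apply: measurable_fun_einfs => n; apply: measurable_fun_ifT => //.
- apply: measurable_fun_ltr.
    apply: measurable_maxr; last by apply: measurable_epoch => i _; exact: mS.
    by apply: measurable_maxr => //; apply: measurable_epoch => i _; exact: mA.
  apply: measurable_minr; apply: measurable_epoch => i _; [exact: mA|exact: mS].
- apply/measurable_EFinP.
  apply: measurable_maxr; last by apply: measurable_epoch => i _; exact: mS.
  by apply: measurable_maxr => //; apply: measurable_epoch => i _; exact: mA.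
Qed.

Lemma time_to_empty_ge0 w : 0 <= tte w.
Proof. by apply: le_ereal_inf_tmp => _ [t [t0 _] <-]; rewrite lee_fin. Qed.

Let fin_set : set Om := [set w | tte w \is a fin_num].

Let m_fin_set : measurable fin_set.
Proof.
have := emeasurable_fin_num measurableT measurable_time_to_empty.
by rewrite setTI.
Qed.

Let m_fine_tte : measurable_fun setT (fine \o tte).
Proof.
by apply: measurableT_comp measurable_time_to_empty; exact: fine_measurable.
Qed.

Lemma zeta_lawE B : measurable B ->
  zeta_law A S k B = P ((fine \o tte) @^-1` B `&` fin_set).
Proof.
move=> mB; congr (P _); apply/seteqP; split => w /=.
  by move=> [t tE Bt]; rewrite /fin_set/= /tte tE.
by move=> [Bt fw]; exists (fine (tte w)) => //; rewrite fineK.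
Qed.

(** [zeta_law] is a bare set function; integrals require a measure with the same
    values. *)
Lemma zeta_measure_exists : exists nu : {measure set R -> \bar R},
  (forall B, measurable B -> nu B = zeta_law A S k B) /\
  (forall f : R -> \bar R, measurable_fun setT f -> (forall x, 0 <= f x) ->
     \int[nu]_x f x = \int[P]_(w in fin_set) f (fine (tte w))).
Proof.
have [nu nuE] := image_measure_exists (mrestr P m_fin_set) m_fine_tte.
exists nu; split => [B mB|f mf f0]; first by rewrite zeta_lawE// nuE.
rewrite nuE ge0_integral_pushforward// preimage_setT ge0_integral_mrestr//.
  exact: measurableT_comp.
by move=> w /=.
Qed.

Let stops n w := (epoch s (k + n) w < epoch a n.+1 w)%R.

(** On this almost sure event epochs increase, so that the queue empties at the
    end of the first service that precedes the next arrival. *)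
Let positive : set Om :=
  [set w | forall i, (0 < a i w)%R /\ (0 < s i w)%R].

Let positive_ae : P.-negligible (~` positive).
Proof.
apply: (@negligibleS _ _ _ _ (\bigcup_i ([set w | (clock A S true i w <= 0)%R] `|`
    [set w | (clock A S false i w <= 0)%R]))).
  move=> w /= /existsNP[i]; move=> /not_andP[] /negP; rewrite -leNgt => h.
    by exists i => //; left.
  by exists i => //; right.
apply: negligible_bigcup => i; apply: negligibleU.
  exists [set w | (clock A S true i w <= 0)%R]; split => //.
    exact: measurable_le_set.
  exact: (clock_le0_null lambda_gt0 inputAS).
exists [set w | (clock A S false i w <= 0)%R]; split => //.
  exact: measurable_le_set.
exact: (clock_le0_null lambda_gt0 inputAS).
Qed.

Let epoch_mono (u : nat -> Om -> R) w i j : (forall i, (0 < u i w)%R) ->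
  (i <= j)%N -> (epoch u i w <= epoch u j w)%R.
Proof.
move=> u0 /subnK <-; elim: (j - i)%N => [|n IH]; first by rewrite add0n.
by rewrite addSn epochS (le_trans IH)// lerDl ltW.
Qed.

Let tte_stops n w : positive w -> still_busy a s k n w -> stops n w ->
  tte w = (epoch s (k + n) w)%:E.
Proof.
move=> pw Gw sw.
have ap i : (0 < a i w)%R by have [] := pw i.
have sp i : (0 < s i w)%R by have [] := pw i.
apply/eqP; rewrite eq_le; apply/andP; split.
  apply: ge_ereal_inf; exists (epoch s (k + n) w)%:E => //=.
  exists (epoch s (k + n) w) => //; split.
    by rewrite -(epoch0 s w); apply: epoch_mono.
  exists n, (k + n)%N; split => //; apply/andP; split.
  - exact: epoch_le_busy Gw.
  - exact: sw.
  - exact: lexx.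
  - by rewrite -[ltRHS]/(epoch s (k + n).+1 w) epochS ltrDl.
apply: le_ereal_inf_tmp => _ [t [t0 [m [m' [/andP[a1 a2] /andP[s1 s2] km]]]] <-].
rewrite lee_fin; apply: le_trans (s1); rewrite -km -/(epoch s (k + m) w).
apply: epoch_mono => //; rewrite leq_add2l leqNgt; apply/negP => mn.
have := Gw.1 m mn; apply/negP; rewrite -ltNge.
by apply: le_lt_trans a2; rewrite km; exact: s1.
Qed.

Let tte_fin w : positive w -> fin_set w ->
  exists2 n, still_busy a s k n w & stops n w.
Proof.
move=> pw fw.
have sp i : (0 < s i w)%R by have [] := pw i.
have ex : exists n, stops n w.
  apply: contrapT => /forallNP h; move: fw; rewrite /fin_set/=.
  rewrite (_ : tte w = +oo)//; apply/eqP; rewrite -leye_eq.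
  apply: le_ereal_inf_tmp => _ [t [t0 [m [m' [/andP[a1 a2] /andP[s1 s2] km]]]] <-].
  by case: (h m); rewrite /stops km; apply: le_lt_trans a2; exact: s1.
exists (ex_minn ex); case: ex_minnP => // n sn nmin.
split => [i iN|i _]; last by rewrite ltW.
rewrite leNgt; apply/negP => si; have := nmin i si.
by rewrite leqNgt iN.
Qed.

Let integrand_series (f : R -> \bar R) w : (forall x, 0 <= f x) -> positive w ->
  (if w \in fin_set then f (fine (tte w)) else 0) =
  \sum_(0 <= n <oo) (\1_(still_busy a s k n) w * \1_[set v | stops n v] w)%:E *
     f (epoch s (k + n) w).
Proof.
move=> f0 pw; have t0 n : 0 <= (\1_(still_busy a s k n) w *
    \1_[set v | stops n v] w)%:E * f (epoch s (k + n) w).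
  by rewrite mule_ge0// lee_fin mulr_ge0.
have [[n Gn sn]|nex] := pselect (exists2 n, still_busy a s k n w & stops n w).
  have tE := tte_stops pw Gn sn.
  rewrite mem_set; last by rewrite /fin_set/= tE.
  rewrite (nneseriesD1 (n := n))// eseries0 => [|i _ /= ni].
    by rewrite adde0 tE !indicE !mem_set// mulr1 mul1e.
  have [Gi|Gi] := boolP (w \in still_busy a s k i); last first.
    by rewrite indicE (negbTE Gi) mul0r mul0e.
  have [si|si] := boolP (stops i w); last first.
    by rewrite [X in (_ * X)%R]indicE memNset ?mulr0 ?mul0e//=; exact/negP.
  move: Gi; rewrite inE => Gi; exfalso.
  move: ni; rewrite neq_lt => /orP[lt|lt].
    by have := Gn.1 i lt; rewrite leNgt -/(stops i w) si.
  by have := Gi.1 n lt; rewrite leNgt -/(stops n w) sn.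
rewrite memNset; last by move=> fw; apply: nex; exact: tte_fin.
rewrite eseries0// => i _ _.
have [Gi|Gi] := boolP (w \in still_busy a s k i); last first.
  by rewrite indicE (negbTE Gi) mul0r mul0e.
rewrite [X in (_ * X)%R]indicE memNset ?mulr0 ?mul0e//= => si.
by apply: nex; exists i => //; exact: set_mem.
Qed.

(** Laplace transform of the time to empty of the critical queue; the argument
    is parametrized so that the result is a plain power. *)
Lemma zeta_laplace (x : R) (nu : {measure set R -> \bar R}) :
  (0 < x < 1)%R ->
  (forall f : R -> \bar R, measurable_fun setT f -> (forall x, 0 <= f x) ->
     \int[nu]_x f x = \int[P]_(w in fin_set) f (fine (tte w))) ->
  \int[nu]_t (expR (- (lambda * x ^+ 2 / (1 - x)) * t))%:E = ((1 - x) ^+ k)%:E.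
Proof.
move=> /andP[x0 x1] nuf; set sigma := (lambda * x ^+ 2 / (1 - x))%R.
have x1' : (0 < 1 - x)%R by rewrite subr_gt0.
have sigma0 : (0 < sigma)%R by rewrite divr_gt0// mulr_gt0// exprn_gt0.
have beta0 : (0 < lambda * x)%R by rewrite mulr_gt0.
have beta1 : (lambda * x < lambda)%R by rewrite gtr_pMr.
have sigmaE : (sigma * (lambda - lambda * x) = (lambda * x) ^+ 2)%R.
  by rewrite /sigma; field; rewrite gt_eqF.
have mf : measurable_fun setT (fun t : R => (expR (- sigma * t))%:E).
  by apply/measurable_EFinP; apply: measurableT_comp => //; exact: measurable_funM.
have f0 t : 0 <= (expR (- sigma * t))%:E by rewrite lee_fin.
rewrite nuf//.
have := stopped_transform lambda_gt0 inputAS k beta0 beta1 sigma0 sigmaE.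
have -> : (lambda / (lambda + (sigma + lambda * x)) = 1 - x)%R.
  rewrite /sigma; field.
  by rewrite !gt_eqF//= -?mulrA ?mulr_gt0// ?addr_gt0 ?mulr_gt0.
move=> <-.
have mterm n : measurable_fun setT (fun w => (\1_(still_busy a s k n) w *
    expR (- sigma * epoch s (k + n) w) * \1_[set v | stops n v] w)%:E).
  apply/measurable_EFinP; apply: measurable_funM; first apply: measurable_funM.
  - by apply: measurable_indic; apply: measurable_still_busy => i _; [exact: mA|exact: mS].
  - apply: measurableT_comp => //; apply: measurable_funM => //.
    by apply: measurable_epoch => i _; exact: mS.
  - apply: measurable_indic; apply: measurable_lt_set; apply: measurable_epoch => i _;
      [exact: mS|exact: mA].
rewrite integral_mkcond.
transitivity (\int[P]_w \sum_(0 <= n <oo) (\1_(still_busy a s k n) w *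
    expR (- sigma * epoch s (k + n) w) * \1_[set v | stops n v] w)%:E).
  apply: ge0_ae_eq_integral => //.
  - apply/(measurable_restrictT _ _).1 => //.
    by apply: measurable_funTS; exact: (measurableT_comp mf m_fine_tte).
  - by apply: ge0_emeasurable_sum => // n w _ _; rewrite lee_fin !mulr_ge0.
  - by move=> w _; apply: erestrict_ge0.
  - by move=> w _; apply: nneseries_ge0 => n _ _; rewrite lee_fin !mulr_ge0.
  apply: negligibleS positive_ae => w /= /not_implyP[_] h pw; apply: h.
  rewrite patchE (integrand_series f0 pw); apply: eq_eseriesr => n _.
  by rewrite -EFinM mulrAC.
rewrite integral_nneseries//.
apply: eq_eseriesr => n _; apply: eq_integral => w _; congr (_ * _)%:E.
by apply: indic_congr; rewrite /= /stops epochS ltrBlDl.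
Qed.

End TimeToEmptyLaw.

(** * A maximum principle in the quadrant *)

Section MaximumPrinciple.
Variable R : realType.

Let barrier (l y : nat) : R := l%:R + y%:R + 2%:R - 2%:R ^- l.

Let barrier_gt0 l y : 0 < barrier l y.
Proof.
have : (2 : R) ^- l <= 1 by rewrite invf_le1 ?exprn_gt0// exprn_ege1// ler1n.
have : (0 : R) <= l%:R by []. have : (0 : R) <= y%:R by [].
rewrite /barrier; lra.
Qed.

Let barrier_strict l y :
  barrier l.+2 y.+1 + barrier l y.+1 + barrier l.+1 y.+2 + barrier l.+1 y
  < 4%:R * barrier l.+1 y.+1.
Proof.
have : (0 : R) < 2%:R ^- l.+2 by rewrite invr_gt0 exprn_gt0.
have e1 : (2 : R) ^- l.+1 = 2%:R * 2%:R ^- l.+2.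
  by rewrite [in RHS]exprS invfM mulrA mulfV ?mul1r// pnatr_eq0.
have e0 : (2 : R) ^- l = 2%:R * 2%:R ^- l.+1.
  by rewrite [in RHS]exprS invfM mulrA mulfV ?mul1r// pnatr_eq0.
rewrite /barrier e0 e1 -!natr1; lra.
Qed.

Let no_interior_max (e x a1 a2 a3 a4 b b1 b2 b3 b4 : R) : 0 < e ->
  b1 + b2 + b3 + b4 < 4%:R * b -> 4%:R * x <= a1 + a2 + a3 + a4 ->
  a1 - e * b1 <= x - e * b -> a2 - e * b2 <= x - e * b ->
  a3 - e * b3 <= x - e * b -> a4 - e * b4 <= x - e * b -> False.
Proof.
move=> e0 hb hx h1 h2 h3 h4.
have : e * (b1 + b2 + b3 + b4) < e * (4%:R * b) by rewrite ltr_pM2l.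
by rewrite !mulrDr; lra.
Qed.

(** A bounded function on the quadrant that is discretely subharmonic inside
    [D] and vanishes outside cannot be positive. In the unbounded quadrant the
    strictly superharmonic function [l + y + 2 - 2^-l], which grows at infinity,
    forces the maximum to be attained. *)
Lemma quadrant_maximum_principle (D : nat -> nat -> bool) (v : nat -> nat -> R)
    (B : R) :
  (forall l y, v l y <= B) ->
  (forall y, ~~ D 0%N y) -> (forall l, ~~ D l 0%N) ->
  (forall l y, ~~ D l y -> v l y = 0) ->
  (forall l y, D l.+1 y.+1 ->
     4%:R * v l.+1 y.+1 <=
     v l.+2 y.+1 + v l y.+1 + v l.+1 y.+2 + v l.+1 y) ->
  forall l y, v l y <= 0.
Proof.
move=> vB D0 D0' vout vsub l0 y0; rewrite leNgt; apply/negP => v0.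
have D00 : D l0 y0 by apply: contraLR v0 => /vout ->; rewrite ltxx.
pose eps := v l0 y0 / (2%:R * barrier l0 y0).
have eps0 : 0 < eps by rewrite divr_gt0// mulr_gt0.
have B0 : 0 < B by exact: lt_le_trans v0 (vB _ _).
pose N := (Num.truncn (B / eps)).+1.
have NB : B < eps * N%:R.
  rewrite -ltr_pdivrMl// mulrC; apply: truncnS_gt.
pose M := (maxn N (maxn l0 y0)).+1.
have l0M : (l0 < M)%N by rewrite /M ltnS !leq_max leqnn !orbT.
have y0M : (y0 < M)%N by rewrite /M ltnS !leq_max leqnn !orbT.
have NM : (N <= M)%N by rewrite /M ltnW// ltnS leq_maxl.
pose g l y : R := v l y - eps * barrier l y.
pose p0 : 'I_M * 'I_M := (Ordinal l0M, Ordinal y0M).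
pose Pr (p : 'I_M * 'I_M) := D p.1 p.2.
have Pp0 : Pr p0 by [].
pose F (p : 'I_M * 'I_M) := g p.1 p.2.
have g0 : 0 < F p0.
  rewrite /F /g /= /eps invfM mulrA -mulrA mulrC mulrA mulVf ?gt_eqF ?barrier_gt0//.
  by rewrite mul1r; move: v0; lra.
have [p Pp pmax] := @arg_maxP _ _ _ p0 Pr F Pp0.
have gp : 0 < F p by exact: lt_le_trans g0 (pmax _ Pp0).
have gmax l y : g l y <= F p.
  have [Dly|Dly] := boolP (D l y); last first.
    by rewrite /g vout// sub0r (le_trans _ (ltW gp))// oppr_le0 mulr_ge0// ltW.
  have [/andP[lM yM]|] := boolP ((l < M) && (y < M))%N.
    exact: (pmax (Ordinal lM, Ordinal yM)).
  rewrite negb_and -!leqNgt => h.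
  apply: (le_trans _ (ltW gp)); rewrite /g subr_le0 (le_trans (vB _ _))// ltW//.
  apply: (lt_le_trans NB); rewrite ler_wpM2l ?(ltW eps0)//.
  have : (2 : R) ^- l <= 1 by rewrite invf_le1 ?exprn_gt0// exprn_ege1// ler1n.
  have : N%:R <= (l + y)%:R :> R.
    rewrite ler_nat; apply: (leq_trans NM); case/orP: h => h.
      exact: leq_trans h (leq_addr _ _).
    exact: leq_trans h (leq_addl _ _).
  rewrite natrD /barrier; lra.
move: p Pp gp pmax gmax => [[[|l] lM] [[|y] yM]] Pp gp pmax gmax.
- by move: Pp; rewrite /Pr/= (negbTE (D0 _)).
- by move: Pp; rewrite /Pr/= (negbTE (D0 _)).
- by move: Pp; rewrite /Pr/= (negbTE (D0' _)).
have := vsub l y Pp; have := barrier_strict l y.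
have := gmax l.+2 y.+1; have := gmax l y.+1.
have := gmax l.+1 y.+2; have := gmax l.+1 y.
rewrite /F /g /= => h1 h2 h3 h4 hb hv.
exact: (no_interior_max eps0 hb hv h4 h3 h2 h1).
Qed.

End MaximumPrinciple.

(** * Harmonic measure of a half-line seen from near the diagonal *)

(** [u] stands for the harmonic measure of the negative half-line in the upper
    half-plane, the origin counting for one half. *)
Section HarmonicBound.
Variables (R : realType) (u : int -> nat -> R).
Hypotheses (u_ge0 : forall l y, 0 <= u l y) (u_le1 : forall l y, u l y <= 1).
Hypothesis u_harmonic : forall l y,
  4%:R * u l y.+1 = u (l + 1) y.+1 + u (l - 1) y.+1 + u l y.+2 + u l y.
Hypothesis u_sym : forall l y, u l y + u (- l) y = 1.
Hypothesis u_boundary : forall l : nat, u l.+1%:Z 0%N = 0.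

Let U (l y : nat) : R := u l%:Z y.

Let U_harmonic l y :
  4%:R * U l.+1 y.+1 = U l.+2 y.+1 + U l y.+1 + U l.+1 y.+2 + U l.+1 y.
Proof.
have e1 : l.+1%:Z + 1 = l.+2%:Z by rewrite -PoszD addn1.
have e2 : l.+1%:Z - 1 = l%:Z by rewrite -addn1 PoszD addrK.
by rewrite /U u_harmonic e1 e2.
Qed.

(** Seen from the vertical axis, the two half-lines are symmetric. *)
Let U0 y : U 0 y = 1 / 2%:R.
Proof. by have := u_sym 0 y; rewrite oppr0 /U; lra. Qed.

(** In the quadrant [U] is 1/2 on one side and 0 on the other; exchanging the
    sides gives the complement to 1/2, by the maximum principle. *)
Let U_transpose l y : (0 < l + y)%N -> U l y + U y l = 1 / 2%:R.
Proof.
move=> ly0.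
have half (c : R) : c = 1 \/ c = -1 -> c * (U l y + U y l - 1 / 2%:R) <= 0.
  move=> c1.
  pose D (l y : nat) := (0 < l)%N && (0 < y)%N.
  pose v (l y : nat) := if D l y then c * (U l y + U y l - 1 / 2%:R) else 0.
  have axis n : U n.+1 0 + U 0 n.+1 - 1 / 2%:R = 0.
    by rewrite U0 /U u_boundary; lra.
  have vE n m : (0 < n + m)%N -> v n m = c * (U n m + U m n - 1 / 2%:R).
    rewrite /v /D; case: n => [|n]; case: m => [|m] //= _.
      by rewrite [U 0 _ + _]addrC axis mulr0.
    by rewrite axis mulr0.
  rewrite -vE//; apply: (@quadrant_maximum_principle _ D v 2%:R) => //.
  - move=> n m; rewrite /v; case: ifP => _ //.
    have := u_ge0 n%:Z m; have := u_ge0 m%:Z n.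
    have := u_le1 n%:Z m; have := u_le1 m%:Z n.
    by rewrite /U; case: c1 => ->; lra.
  - by move=> n; rewrite /D ltnn andbF.
  - by move=> n m /negbTE; rewrite /v => ->.
  - move=> n m _; rewrite !vE ?addSn ?addnS//.
    have := U_harmonic n m; have := U_harmonic m n.
    by case: c1 => ->; lra.
have := half 1 (or_introl erefl); have := half (-1) (or_intror erefl); lra.
Qed.

Let U_diag y : (0 < y)%N -> U y y = 1 / 4%:R.
Proof. by move=> y0; have := @U_transpose y y; rewrite addn_gt0 y0 => /(_ isT); lra. Qed.

(* Above the diagonal, the difference to 1/4 is dominated on a box around the
   diagonal by an explicit discrete harmonic polynomial. *)
Let U_above l0 y0 : (0 < y0)%N -> (y0 < l0)%N -> (l0 - y0 < y0)%N ->
  `|U l0 y0 - 1 / 4%:R| <= 3%:R / 2%:R * (l0%:R - y0%:R) / y0%:R.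
Proof.
move=> y00 yl ly.
have Y0 : (0 : R) < y0%:R by rewrite ltr0n.
pose t (l y : nat) : R := (l%:R - y%:R) / y0%:R.
pose r (y : nat) : R := (y%:R - y0%:R) / y0%:R.
pose g l y : R := t l y + r y ^+ 2 + t l y * (1 - t l y) / 2%:R.
have g00 : g l0 y0 <= 3%:R / 2%:R * (l0%:R - y0%:R) / y0%:R.
  rewrite /g /r subrr mul0r expr0n addr0 -[leRHS]mulrA -/(t l0 y0).
  have : 0 <= t l0 y0 ^+ 2 by exact: sqr_ge0.
  lra.
have half (c : R) : c = 1 \/ c = -1 -> c * (U l0 y0 - 1 / 4%:R) <= g l0 y0.
  move=> c1.
  pose D (l y : nat) := [&& (0 < y)%N, (y < 2 * y0)%N, (y < l)%N & (l - y < y0)%N].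
  pose v (l y : nat) := if D l y then c * (U l y - 1 / 4%:R) - g l y else 0.
  have cU l y : c * (U l y - 1 / 4%:R) <= 1.
    have := u_ge0 l%:Z y; have := u_le1 l%:Z y.
    by rewrite /U; case: c1 => ->; lra.
  have tP (l y : nat) : (y <= l)%N -> (l - y <= y0)%N -> 0 <= t l y <= 1.
    move=> h1 h2; rewrite divr_ge0 ?subr_ge0 ?ler_nat//=.
    by rewrite ler_pdivrMr// mul1r -natrB// ler_nat.
  have g_ge0 l y : 0 <= t l y <= 1 -> 0 <= g l y.
    move=> /andP[h1 h2]; rewrite /g !addr_ge0 ?sqr_ge0// divr_ge0// mulr_ge0//.
    by rewrite subr_ge0.
  have nbr l y : (y <= 2 * y0)%N -> (y <= l)%N -> (l - y <= y0)%N -> (0 < l)%N ->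
      c * (U l y - 1 / 4%:R) - g l y <= v l y.
    move=> h1 h2 h3 h4; rewrite /v; case: ifPn => // nD.
    have tly := tP l y h2 h3; have gly := g_ge0 l y tly.
    have [yl0|yl0] := eqVneq y l.
      by move: gly; rewrite yl0 U_diag// subrr mulr0 sub0r oppr_le0.
    rewrite subr_le0 (le_trans (cU l y))//.
    have ylt : (y < l)%N by rewrite ltn_neqAle yl0.
    have r1 : r y ^+ 2 = 1 -> 1 <= g l y.
      move=> rE; move: tly => /andP[t1 t2]; rewrite /g rE.
      have : 0 <= t l y * (1 - t l y) by rewrite mulr_ge0// subr_ge0.
      lra.
    have [y_0|y_0] := eqVneq y 0%N.
      by apply: r1; rewrite y_0 /r sub0r mulNr divff ?gt_eqF// sqrrN expr1n.
    have [y_2|y_2] := eqVneq y (2 * y0)%N.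
      apply: r1; rewrite y_2 /r mulnC natrM mulr_natr mulr2n addrK.
      by rewrite divff ?gt_eqF// expr1n.
    have t1 : t l y = 1.
      rewrite /t -natrB//; suff -> : (l - y)%N = y0 by rewrite divff ?gt_eqF.
      move: nD; rewrite /D; lia.
    by rewrite /g t1 subrr mulr0 mul0r addr0 lerDl sqr_ge0.
  suff : v l0 y0 <= 0.
    by rewrite /v ifT ?subr_le0// /D; lia.
  apply: (@quadrant_maximum_principle _ D v 1) => //.
  - move=> l y; rewrite /v; case: ifPn => // /and4P[h1 h2 h3 h4].
    have := g_ge0 l y (tP l y (ltnW h3) (ltnW h4)); have := cU l y; lra.
  - by move=> y; rewrite /D ltn0 !andbF.
  - by move=> l y /negbTE; rewrite /v => ->.
  - move=> l y Dly; have [h1 h2 h3 h4] := and4P Dly.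
    have v0 : v l.+1 y.+1 = c * (U l.+1 y.+1 - 1 / 4%:R) - g l.+1 y.+1.
      by rewrite /v Dly.
    have n1 : c * (U l.+2 y.+1 - 1 / 4%:R) - g l.+2 y.+1 <= v l.+2 y.+1.
      by apply: nbr; lia.
    have n2 : c * (U l y.+1 - 1 / 4%:R) - g l y.+1 <= v l y.+1.
      by apply: nbr; lia.
    have n3 : c * (U l.+1 y.+2 - 1 / 4%:R) - g l.+1 y.+2 <= v l.+1 y.+2.
      by apply: nbr; lia.
    have n4 : c * (U l.+1 y - 1 / 4%:R) - g l.+1 y <= v l.+1 y.
      by apply: nbr; lia.
    have gh : g l.+2 y.+1 + g l y.+1 + g l.+1 y.+2 + g l.+1 y = 4%:R * g l.+1 y.+1.
      by rewrite /g /t /r -!natr1; field; rewrite gt_eqF.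
    have := U_harmonic l y; move: gh n1 n2 n3 n4; rewrite v0.
    by case: c1 => ->; lra.
apply: le_trans g00; rewrite ler_norml; apply/andP; split.
  by have := half (-1) (or_intror erefl); lra.
by have := half 1 (or_introl erefl); lra.
Qed.

(** On the diagonal the value is exactly 1/4; the comparison on a box extends
    this to a neighbourhood, and farther away the right-hand side exceeds 1. *)
Lemma harmonic_quarter (l : int) (y : nat) : (0 < y)%N ->
  `|u l y - 1 / 4%:R| <= 3%:R * `|l%:~R - y%:R| / y%:R.
Proof.
move=> y0.
have Y0 : (0 : R) < y%:R by rewrite ltr0n.
have triv : y%:R <= 3%:R * `|l%:~R - y%:R| :> R ->
    `|u l y - 1 / 4%:R| <= 3%:R * `|l%:~R - y%:R| / y%:R.
  move=> h; apply: (@le_trans _ _ 1); last by rewrite ler_pdivlMr// mul1r.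
  by rewrite ler_norml; have := u_ge0 l y; have := u_le1 l y; lra.
case: l triv => [l|l] triv; last first.
  apply: triv; rewrite NegzE mulrNz -opprD normrN ger0_norm ?addr_ge0//.
  rewrite -[(l.+1)%:~R]/(l.+1%:R : R); have : (0 : R) <= l.+1%:R by []. lra.
rewrite -[l%:~R]/(l%:R : R) in triv *; rewrite -/(U l y).
case: (ltngtP y l) => [yl|ly|<-].
- have yl' : (y%:R < l%:R :> R) by rewrite ltr_nat.
  have [h|h] := ltnP (l - y) y.
    apply: (le_trans (U_above y0 yl h)); rewrite ger0_norm ?subr_ge0 ?(ltW yl')//.
    rewrite ler_pM2r ?invr_gt0//; lra.
  apply: triv; rewrite ger0_norm ?subr_ge0 ?(ltW yl')//.
  have : y%:R <= (l - y)%:R :> R by rewrite ler_nat.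
  by rewrite natrB ?(ltnW yl)//; lra.
- have ly' : (l%:R < y%:R :> R) by rewrite ltr_nat.
  rewrite ltr0_norm ?subr_lt0// in triv *.
  have [h|h] := ltnP (2 * (y - l)) y; last first.
    apply: triv; have : y%:R <= (2 * (y - l))%:R :> R by rewrite ler_nat.
    rewrite natrM natrB ?(ltnW ly)//; lra.
  have l0 : (0 < l)%N by lia.
  have L0 : (0 : R) < l%:R by rewrite ltr0n.
  have := @U_transpose l y; rewrite addn_gt0 l0 => /(_ isT) tr.
  have -> : U l y - 1 / 4%:R = - (U y l - 1 / 4%:R) by lra.
  rewrite normrN; apply: (le_trans (U_above l0 ly _)); first by lia.
  have h2 : (y%:R < 2%:R * l%:R :> R) by rewrite -natrM ltr_nat; lia.
  have inv : l%:R^-1 <= 2%:R / y%:R :> R.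
    by rewrite ler_pdivlMr// mulrC ler_pdivrMr// ltW.
  have d0 : 0 <= y%:R - l%:R :> R by rewrite subr_ge0 ltW.
  have := ler_wpM2l d0 inv; lra.
- by rewrite U_diag// !subrr normr0 mulr0 mul0r.
Qed.

End HarmonicBound.

(** * Poisson calculus *)

Section PoissonCalculus.
Local Open Scope ereal_scope.
Variable R : realType.
Implicit Types (kappa : R) (j : nat).

Lemma exp_series_ereal (x : R) : (0 <= x)%R ->
  \sum_(0 <= j <oo) (x ^+ j / j`!%:R)%:E = (expR x)%:E.
Proof.
move=> x0; rewrite expRE -EFin_lim; last first.
  rewrite /pseries/=; under eq_fun do rewrite mulrC.
  exact: is_cvg_series_exp_coeff.
apply/congr_lim/funext => n/=; rewrite /pseries/= /series/= -sumEFin//.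
by under eq_bigr do rewrite mulrC.
Qed.

Lemma poisson_mass_ge0 kappa j : (0 <= poisson_mass kappa j)%R.
Proof. by rewrite fine_ge0. Qed.

Lemma poisson_mass_le0 kappa j : (kappa <= 0)%R ->
  poisson_mass kappa j = (j == 0%N)%:R.
Proof.
move=> k0; rewrite /poisson_mass /poisson_prob ltNge k0/=.
have [->|j0] := eqVneq j 0%N; first by rewrite indicE mem_set.
by rewrite indicE memNset//= => j0'; move: j0; rewrite -j0' eqxx.
Qed.

Lemma poisson_massE kappa j : (0 <= kappa)%R ->
  poisson_mass kappa j = (kappa ^+ j / j`!%:R * expR (- kappa))%R.
Proof.
rewrite le_eqVlt => /orP[/eqP <-|k0].
  rewrite poisson_mass_le0// oppr0 expR0 mulr1.
  by case: j => [|j]; rewrite ?expr0 ?fact0 ?divr1// expr0n/= mul0r.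
rewrite /poisson_mass /poisson_prob k0 esum_set1 ?lee_fin ?poisson_pmf_ge0//=.
by rewrite /poisson_pmf k0.
Qed.

Lemma poisson_gen (z kappa : R) : (0 <= z)%R -> (0 <= kappa)%R ->
  \sum_(0 <= j <oo) (z ^+ j * poisson_mass kappa j)%:E =
  (expR (- (1 - z) * kappa))%:E.
Proof.
move=> z0 k0.
transitivity ((expR (- kappa))%:E *
    \sum_(0 <= j <oo) ((z * kappa) ^+ j / j`!%:R)%:E).
  rewrite -nneseriesZl/=; last first.
    by move=> j _; rewrite lee_fin divr_ge0// exprn_ge0// mulr_ge0.
  apply: eq_eseriesr => j _; rewrite poisson_massE// -EFinM exprMn.
  by congr (_%:E); ring.
rewrite exp_series_ereal ?mulr_ge0// -EFinM -expRD.
by congr (expR _)%:E; ring.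
Qed.

Lemma poisson_mass_sum kappa : \sum_(0 <= j <oo) (poisson_mass kappa j)%:E = 1.
Proof.
have [k0|k0] := leP 0%R kappa.
  have := @poisson_gen 1%R kappa ler01 k0; rewrite subrr oppr0 mul0r expR0 => <-.
  by apply: eq_eseriesr => j _; rewrite expr1n mul1r.
rewrite nneseries_recl//; last by move=> j _; rewrite lee_fin poisson_mass_ge0.
rewrite poisson_mass_le0 ?ltW//= eseries0 ?adde0// => i i1 _.
by case: i i1 => // i _; rewrite poisson_mass_le0 ?ltW.
Qed.

Lemma poisson_mass_le1 kappa j : (poisson_mass kappa j <= 1)%R.
Proof.
rewrite -lee_fin -(poisson_mass_sum kappa).
rewrite (nneseriesD1 (n := j))//; last first.
  by move=> i _; rewrite lee_fin poisson_mass_ge0.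
by rewrite leeDl// nneseries_ge0// => i _ _; rewrite lee_fin poisson_mass_ge0.
Qed.

Lemma poisson_massS kappa j : (0 <= kappa)%R ->
  (j.+1%:R * poisson_mass kappa j.+1 = kappa * poisson_mass kappa j)%R.
Proof.
move=> k0; rewrite !poisson_massE// factS natrM exprS; field.
by rewrite pnatr_eq0 -lt0n fact_gt0/= addrC natr1 pnatr_eq0.
Qed.

Lemma nneseriesS (f : nat -> \bar R) : (forall j, 0 <= f j) ->
  \sum_(0 <= j <oo) f j = f 0%N + \sum_(0 <= j <oo) f j.+1.
Proof.
move=> fge; rewrite nneseries_recl//; congr (_ + _).
by rewrite -nneseries_addn//; apply: eq_eseriesr => j _; rewrite addn1.
Qed.

Lemma poisson_mean kappa : (0 <= kappa)%R ->
  \sum_(0 <= j <oo) (j%:R * poisson_mass kappa j)%:E = kappa%:E.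
Proof.
move=> k0; rewrite nneseriesS => [|j]; last first.
  by rewrite lee_fin mulr_ge0// poisson_mass_ge0.
rewrite mul0r add0e.
under eq_eseriesr do rewrite poisson_massS// EFinM.
rewrite nneseriesZl ?poisson_mass_sum ?mule1// => j _.
by rewrite lee_fin poisson_mass_ge0.
Qed.

Let poisson_factorial2 kappa : (0 <= kappa)%R ->
  \sum_(0 <= j <oo) (j%:R * (j%:R - 1) * poisson_mass kappa j)%:E =
  (kappa ^+ 2)%:E.
Proof.
move=> k0.
have ge0 j : 0 <= (j%:R * (j%:R - 1) * poisson_mass kappa j)%:E.
  rewrite lee_fin mulr_ge0 ?poisson_mass_ge0//.
  by case: j => [|j]; rewrite ?mul0r// mulr_ge0// subr_ge0 ler1n.
rewrite nneseriesS// mul0r mul0r add0e.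
rewrite [LHS](_ : _ = \sum_(0 <= j <oo) kappa%:E * (j%:R * poisson_mass kappa j)%:E).
  rewrite nneseriesZl ?poisson_mean// => j _.
  by rewrite lee_fin mulr_ge0// poisson_mass_ge0.
apply: eq_eseriesr => j _; rewrite -EFinM mulrAC poisson_massS//.
by rewrite -natr1 addrK; congr (_%:E); ring.
Qed.

Lemma poisson_variance kappa : (0 <= kappa)%R ->
  \sum_(0 <= j <oo) ((j%:R - kappa) ^+ 2 * poisson_mass kappa j)%:E = kappa%:E.
Proof.
move=> k0; set V := (X in X = _).
have Vge j : 0 <= ((j%:R - kappa) ^+ 2 * poisson_mass kappa j)%:E.
  by rewrite lee_fin mulr_ge0 ?sqr_ge0 ?poisson_mass_ge0.
have fge j : 0 <= (j%:R * (j%:R - 1) * poisson_mass kappa j)%:E.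
  rewrite lee_fin mulr_ge0 ?poisson_mass_ge0//.
  by case: j => [|j]; rewrite ?mul0r// mulr_ge0// subr_ge0 ler1n.
have mge j : 0 <= (j%:R * poisson_mass kappa j)%:E.
  by rewrite lee_fin mulr_ge0// poisson_mass_ge0.
have pge j : 0 <= (poisson_mass kappa j)%:E by rewrite lee_fin poisson_mass_ge0.
have k2 : (0 <= 2%:R * kappa)%R by rewrite mulr_ge0.
have : V + (2%:R * kappa)%:E * \sum_(0 <= j <oo) (j%:R * poisson_mass kappa j)%:E =
    \sum_(0 <= j <oo) (j%:R * (j%:R - 1) * poisson_mass kappa j)%:E +
    \sum_(0 <= j <oo) (j%:R * poisson_mass kappa j)%:E +
    (kappa ^+ 2)%:E * \sum_(0 <= j <oo) (poisson_mass kappa j)%:E.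
  rewrite -!nneseriesZl//.
  have mge' j : 0 <= (2%:R * kappa)%:E * (j%:R * poisson_mass kappa j)%:E.
    by rewrite mule_ge0.
  have pge' j : 0 <= (kappa ^+ 2)%:E * (poisson_mass kappa j)%:E.
    by rewrite mule_ge0// lee_fin sqr_ge0.
  rewrite -!nneseriesD//; last by move=> j _; rewrite adde_ge0.
  by apply: eq_eseriesr => j _; rewrite -!EFinM -!EFinD; congr (_%:E); ring.
rewrite poisson_mean// poisson_factorial2// poisson_mass_sum.
rewrite mule1 -EFinM -!EFinD => h.
have : V \is a fin_num.
  rewrite ge0_fin_numE ?nneseries_ge0//.
  rewrite (@le_lt_trans _ _ (V + (2%:R * kappa * kappa)%:E))//.
    by rewrite leeDl// lee_fin mulr_ge0.
  by rewrite h ltry.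
move=> /fineK VE; move: h; rewrite -VE -EFinD => -[h]; congr (_%:E); move: h; lra.
Qed.

Lemma poisson_convolution kappa kappa' j : (0 <= kappa)%R -> (0 <= kappa')%R ->
  poisson_mass (kappa + kappa') j =
  (\sum_(i < j.+1) poisson_mass kappa i * poisson_mass kappa' (j - i))%R.
Proof.
move=> k0 k0'; rewrite poisson_massE ?addr_ge0// addrC exprDn.
rewrite mulr_suml mulr_suml; apply: eq_bigr => i _.
rewrite !poisson_massE// opprD expRD.
have le_ij : (i <= j)%N by rewrite -ltnS.
have := bin_fact le_ij => /(congr1 (fun n => n%:R : R)); rewrite !natrM => e.
have n0 n : (n`!%:R != 0 :> R)%R by rewrite pnatr_eq0 -lt0n fact_gt0.
rewrite -mulr_natr -e; field.
by rewrite !n0/= pnatr_eq0 -lt0n bin_gt0.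
Qed.

(** Given their sum, two Poisson variables of the same mean are binomial. *)
Lemma poisson_thinning kappa b c : (0 <= kappa)%R ->
  (poisson_mass kappa b * poisson_mass kappa c =
   poisson_mass (2%:R * kappa) (b + c) * ('C(b + c, b)%:R / 2%:R ^+ (b + c)))%R.
Proof.
move=> k0; rewrite !poisson_massE ?mulr_ge0//.
have := bin_fact (leq_addr c b) => /(congr1 (fun n => n%:R : R)).
rewrite !natrM addKn => e.
have n0 n : (n`!%:R != 0 :> R)%R by rewrite pnatr_eq0 -lt0n fact_gt0.
rewrite -e exprMn (_ : - (2%:R * kappa) = - kappa - kappa)%R; last by ring.
rewrite expRD !exprD.
have C0 : ('C(b + c, b)%:R != 0 :> R)%R by rewrite pnatr_eq0 -lt0n bin_gt0 leq_addr.
have b2 : (2%:R ^+ b != 0 :> R)%R by rewrite expf_neq0.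
have c2 : (2%:R ^+ c != 0 :> R)%R by rewrite expf_neq0.
move: C0 b2 c2 (n0 b) (n0 c).
move: (expR _) ('C(_, _)%:R) (b`!%:R) (c`!%:R) (2%:R ^+ b)%R (2%:R ^+ c)%R.
move: (kappa ^+ b)%R (kappa ^+ c)%R => kb kc E C fb fc p2 q2 h1 h2 h3 h4 h5.
by field; rewrite h1 h2 h3 h4 h5.
Qed.

Lemma measurable_poisson_mass j : measurable_fun setT (fun kappa : R => poisson_mass kappa j).
Proof.
rewrite (_ : (fun kappa => _) = fun kappa =>
   if (0 <= kappa)%R then (kappa ^+ j / j`!%:R * expR (- kappa))%R else (j == 0%N)%:R).
  apply: measurable_fun_ifT => //.
    by apply: measurable_fun_ler.
  apply: measurable_funM.
    by apply: measurable_funM => //; exact: exprn_measurable.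
  by apply: measurableT_comp => //; exact: measurableT_comp.
apply/funext => kappa; case: ifPn => [|/negP]; first exact: poisson_massE.
by move/negP; rewrite -ltNge => /ltW; exact: poisson_mass_le0.
Qed.

Lemma poisson_chebyshev (kappa delta : R) (H : nat -> bool) :
  (0 <= kappa)%R -> (0 < delta)%R ->
  (forall j, H j -> delta <= `|j%:R - kappa|)%R ->
  \sum_(0 <= j <oo) ((H j)%:R * poisson_mass kappa j)%:E <=
  (kappa / delta ^+ 2)%:E.
Proof.
move=> k0 d0 Hd.
have d2 : (0 < delta ^+ 2)%R by rewrite exprn_gt0.
apply: (@le_trans _ _ (\sum_(0 <= j <oo)
    ((delta ^+ 2)^-1)%:E * ((j%:R - kappa) ^+ 2 * poisson_mass kappa j)%:E)).
  apply: lee_nneseries => j _.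
    by rewrite lee_fin mulr_ge0 ?poisson_mass_ge0.
  rewrite -EFinM lee_fin mulrA ler_wpM2r ?poisson_mass_ge0//.
  case: (boolP (H j)) => [/Hd h|_]; last by rewrite mulr_ge0 ?sqr_ge0 ?invr_ge0 ?ltW.
  by rewrite mulrC ler_pdivlMr// mul1r -[leRHS]ger0_norm ?sqr_ge0// normrX
    lerXn2r// nnegrE ltW.
rewrite nneseriesZl; last first.
  by move=> j _; rewrite lee_fin mulr_ge0 ?sqr_ge0 ?poisson_mass_ge0.
by rewrite poisson_variance// -EFinM mulrC.
Qed.

End PoissonCalculus.

(** * The probability that the critical queue empties before the walk crosses *)

Section PowerSeriesUniqueness.
Local Open Scope ereal_scope.
Variable R : realType.
Implicit Types a b : nat -> R.

Let gs a (z : R) : \bar R := \sum_(0 <= j <oo) (z ^+ j * a j)%:E.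

Let gs_bound a (z B : R) : (0 <= z)%R -> (z <= 2%:R^-1)%R ->
  (forall j, 0 <= a j <= B)%R -> gs a z <= (2%:R * B)%:E.
Proof.
move=> z0 z2 aB.
have B0 : (0 <= B)%R by have /andP[h1 h2] := aB 0%N; exact: le_trans h1 h2.
have B2 : (0 <= 2%:R * B)%R by rewrite mulr_ge0.
apply: le_trans (epsilon_trick0 xpredT B2); apply: lee_nneseries => j _.
  by rewrite lee_fin mulr_ge0 ?exprn_ge0//; have /andP[] := aB j.
have /andP[a0 a1] := aB j.
rewrite lee_fin natrX exprS invfM mulrACA mulfV ?pnatr_eq0// mul1r mulrC -exprVn.
by rewrite ler_pM ?exprn_ge0// lerXn2r// nnegrE invr_ge0.
Qed.

Let gs_recl a (z B : R) : (0 <= z)%R -> (forall j, 0 <= a j <= B)%R ->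
  gs a z = (a 0%N)%:E + z%:E * gs (fun j => a j.+1) z.
Proof.
move=> z0 aB.
have a0 j : (0 <= a j)%R by have /andP[] := aB j.
rewrite /gs nneseriesS => [|j]; last by rewrite lee_fin mulr_ge0 ?exprn_ge0.
rewrite expr0 mul1r; congr (_ + _).
rewrite -nneseriesZl => [|j _]; last by rewrite lee_fin mulr_ge0 ?exprn_ge0.
by apply: eq_eseriesr => j _; rewrite -EFinM exprS mulrA.
Qed.

Let gs_head a b B : (forall j, 0 <= a j <= B)%R -> (forall j, 0 <= b j <= B)%R ->
  (forall z : R, (0 < z)%R -> (z <= 2%:R^-1)%R -> gs a z = gs b z) ->
  (a 0%N <= b 0%N)%R.
Proof.
move=> aB bB ab; rewrite leNgt; apply/negP => ba.
have B0 : (0 <= B)%R by have /andP[h1 h2] := aB 0%N; exact: le_trans h1 h2.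
have d0 : (0 < a 0%N - b 0%N)%R by rewrite subr_gt0.
pose z := Num.min (2%:R^-1)%R ((a 0%N - b 0%N) / (2%:R * B + 1))%R.
have den : (0 < 2%:R * B + 1)%R by rewrite ltr_wpDl// mulr_ge0.
have z0 : (0 < z)%R by rewrite lt_min invr_gt0 ltr0n divr_gt0.
have z2 : (z <= 2%:R^-1)%R by rewrite ge_min lexx.
have zd : (z * (2%:R * B) < a 0%N - b 0%N)%R.
  apply: (@lt_le_trans _ _ (z * (2%:R * B + 1))%R); first by rewrite ltr_pM2l// ltrDl.
  by rewrite -ler_pdivlMr// ge_min lexx orbT.
have : (a 0%N)%:E <= gs b z.
  rewrite -(ab z z0 z2) (gs_recl (ltW z0) aB) leeDl// mule_ge0 ?lee_fin ?(ltW z0)//.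
  apply: nneseries_ge0 => j _ _; rewrite lee_fin mulr_ge0 ?exprn_ge0 ?(ltW z0)//.
  by have /andP[] := aB j.+1.
rewrite (gs_recl (ltW z0) bB).
move=> /(fun h => le_trans h (leeD2l _ (lee_wpmul2l _ (gs_bound (ltW z0) z2 (fun j => bB j.+1))))).
by rewrite -EFinM -EFinD lee_fin lee_fin => /(_ (ltW z0)); lra.
Qed.

(** The constant terms are the limits at 0; then divide by the variable and
    iterate. *)
Lemma power_series_unique n a b B :
  (forall j, 0 <= a j <= B)%R -> (forall j, 0 <= b j <= B)%R ->
  (forall z : R, (0 < z)%R -> (z <= 2%:R^-1)%R ->
    \sum_(0 <= j <oo) (z ^+ j * a j)%:E = \sum_(0 <= j <oo) (z ^+ j * b j)%:E) ->
  a n = b n.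
Proof.
elim: n a b => [|n IH] a b aB bB ab.
  apply/eqP; rewrite eq_le (gs_head aB bB ab)/=; apply: (gs_head bB aB) => z z0 z2.
  by rewrite /gs ab.
have e0 : a 0%N = b 0%N.
  apply/eqP; rewrite eq_le (gs_head aB bB ab)/=; apply: (gs_head bB aB) => z z0 z2.
  by rewrite /gs ab.
apply: (IH (fun j => a j.+1) (fun j => b j.+1)) => // z z0 z2.
have := ab z z0 z2; rewrite -/(gs a z) -/(gs b z).
rewrite (gs_recl (ltW z0) aB) (gs_recl (ltW z0) bB) e0.
have fin c : (forall j, 0 <= c j <= B)%R -> gs c z \is a fin_num.
  move=> cB; rewrite ge0_fin_numE; last first.
    apply: nneseries_ge0 => j _ _; rewrite lee_fin mulr_ge0 ?exprn_ge0 ?(ltW z0)//.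
    by have /andP[] := cB j.
  exact: le_lt_trans (gs_bound (ltW z0) z2 cB) (ltry _).
have fa := fin _ (fun j => aB j.+1); have fb := fin _ (fun j => bB j.+1).
rewrite -/(gs (fun j => a j.+1) z) -/(gs (fun j => b j.+1) z).
rewrite -(fineK fa) -(fineK fb) -!EFinM -!EFinD => -[] /addrI.
by move=> /(mulfI (lt0r_neq0 z0)) ->.
Qed.

End PowerSeriesUniqueness.

Section CornerProbability.
Local Open Scope ereal_scope.
Variables (R : realType) (lambda : R).
Hypothesis lambda_gt0 : (0 < lambda)%R.
Variable nu : nat -> {measure set R -> \bar R}.
Hypothesis nu_laplace : forall k (x : R), (0 < x < 1)%R ->
  \int[nu k]_t (expR (- (lambda * x ^+ 2 / (1 - x)) * t))%:E = ((1 - x) ^+ k)%:E.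
Hypothesis nu_neg : forall k, nu k [set t | (t < 0)%R] = 0.
Hypothesis nu_le1 : forall k, nu k setT <= 1.

Let pm2_measurable j : measurable_fun setT
  (fun t : R => (poisson_mass (2%:R * lambda * t) j)%:E).
Proof.
apply/measurable_EFinP.
have m : measurable_fun setT (fun t : R => 2%:R * lambda * t)%R.
  exact: measurable_funM.
exact: (measurableT_comp (@measurable_poisson_mass R j) m).
Qed.

Let pm2_ge0 j t : 0 <= (poisson_mass (2%:R * lambda * t) j)%:E.
Proof. by rewrite lee_fin poisson_mass_ge0. Qed.

(** Law of the number of jumps made, by the time [zeta k], by an independent
    walk that jumps at rate [2 lambda]. *)
Definition jump_mass (k j : nat) : R :=
  fine (\int[nu k]_t (poisson_mass (2%:R * lambda * t) j)%:E).

Lemma jump_massE k j : (jump_mass k j)%:E =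
  \int[nu k]_t (poisson_mass (2%:R * lambda * t) j)%:E.
Proof.
rewrite fineK// ge0_fin_numE; last by apply: integral_ge0.
apply: (@le_lt_trans _ _ (\int[nu k]_t (cst 1 t))).
  apply: ge0_le_integral => //.
  by move=> t _; rewrite lee_fin poisson_mass_le1.
by rewrite integral_cst// mul1e (le_lt_trans (nu_le1 k))// ltry.
Qed.

Lemma jump_mass_ge0 k j : (0 <= jump_mass k j)%R.
Proof. by rewrite -lee_fin jump_massE; apply: integral_ge0. Qed.

Lemma jump_mass_sum_le1 k : \sum_(0 <= j <oo) (jump_mass k j)%:E <= 1.
Proof.
under eq_eseriesr do rewrite jump_massE.
rewrite -integral_nneseries//.
apply: le_trans (nu_le1 k); rewrite -[leRHS]mul1e -integral_cst//.
by under eq_integral do rewrite poisson_mass_sum.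
Qed.

Lemma jump_mass_le1 k j : (jump_mass k j <= 1)%R.
Proof.
rewrite -lee_fin; apply: le_trans (jump_mass_sum_le1 k).
rewrite (nneseriesD1 (n := j))//; last by move=> i _; rewrite lee_fin jump_mass_ge0.
by rewrite leeDl// nneseries_ge0// => i _ _; rewrite lee_fin jump_mass_ge0.
Qed.

(** Generating function of [jump_mass k]: the [k]-th power of the small root
    [1 - x] of [rho ^ 2 - (4 - 2 * z) * rho + 1 = 0]. *)
Let jump_gen (z x : R) k : (0 < z < 1)%R -> (0 < x < 1)%R ->
  (x ^+ 2 = 2%:R * (1 - z) * (1 - x))%R ->
  \sum_(0 <= j <oo) (z ^+ j * jump_mass k j)%:E = ((1 - x) ^+ k)%:E.
Proof.
move=> /andP[z0 z1] x01 xz; have /andP[x0 x1] := x01.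
rewrite -(nu_laplace k x01).
transitivity (\sum_(0 <= j <oo) \int[nu k]_t
    (z ^+ j * poisson_mass (2%:R * lambda * t) j)%:E).
  apply: eq_eseriesr => j _; rewrite EFinM jump_massE -ge0_integralZl//.
  by rewrite lee_fin exprn_ge0// ltW.
rewrite -integral_nneseries//; last 2 first.
- move=> j; under eq_fun do rewrite EFinM.
  by apply: emeasurable_funM.
- by move=> j t _; rewrite lee_fin mulr_ge0 ?poisson_mass_ge0// exprn_ge0// ltW.
apply: ge0_ae_eq_integral => //.
- apply: ge0_emeasurable_sum => [j t _ _|j _].
    by rewrite lee_fin mulr_ge0 ?poisson_mass_ge0// exprn_ge0// ltW.
  under eq_fun do rewrite EFinM.
  by apply: emeasurable_funM.
- by apply/measurable_EFinP; apply: measurableT_comp => //; exact: measurable_funM.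
- move=> t _; apply: nneseries_ge0 => j _ _.
  by rewrite lee_fin mulr_ge0 ?poisson_mass_ge0// exprn_ge0// ltW.
exists [set t | (t < 0)%R]; split => //.
  by rewrite -[X in measurable X]set_itvE; exact: measurable_itv.
move=> t /= /not_implyP[_]; apply: contra_notP => /negP; rewrite -leNgt => t0.
rewrite poisson_gen ?(ltW z0)// ?mulr_ge0// ?ltW//.
congr (expR _)%:E; rewrite xz; field.
by rewrite gt_eqF// subr_gt0.
Qed.

(** So every [z] between 0 and 1 is covered by [jump_gen]. *)
Let small_root (z : R) : (0 < z < 1)%R -> exists2 x : R, (0 < x < 1)%R &
  (x ^+ 2 = 2%:R * (1 - z) * (1 - x))%R.
Proof.
move=> /andP[z0 z1]; pose w := (1 - z)%R.
have w0 : (0 < w)%R by rewrite subr_gt0.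
have d0 : (0 <= w ^+ 2 + 2%:R * w)%R by rewrite addr_ge0 ?sqr_ge0// mulr_ge0// ltW.
pose r := Num.sqrt (w ^+ 2 + 2%:R * w).
have rE : (r ^+ 2 = w ^+ 2 + 2%:R * w)%R by rewrite sqr_sqrtr.
have r0 : (0 <= r)%R by exact: sqrtr_ge0.
exists (r - w)%R; last first.
  by rewrite -/w sqrrB rE; ring.
apply/andP; split.
  rewrite subr_gt0 -(@ltr_pXn2r _ 2)// ?nnegrE ?(ltW w0)// rE ltrDl mulr_gt0//.
rewrite ltNge; apply/negP => h.
have h1 : (1 + w <= r)%R by rewrite -lerBrDr.
have w1 : (0 <= 1 + w)%R by rewrite addr_ge0// ltW.
have : ((1 + w) ^+ 2 <= r ^+ 2)%R by rewrite lerXn2r// nnegrE.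
by rewrite rE sqrrD expr1n mul1r -mulr_natl; lra.
Qed.

(** The quadratic equation of the small root, read on the coefficients: the
    first move of the planar walk is a jump of the walk with probability 1/2, a
    departure or an arrival with probability 1/4 each. *)
Let jump_rec k j : (4%:R * jump_mass k.+1 j =
  2%:R * (if j is i.+1 then jump_mass k.+1 i else 0) +
  jump_mass k.+2 j + jump_mass k j)%R.
Proof.
pose b i := (2%:R * (if i is i'.+1 then jump_mass k.+1 i' else 0) +
  jump_mass k.+2 i + jump_mass k i)%R.
have m0 := jump_mass_ge0; have m1 := jump_mass_le1.
apply: (@power_series_unique _ j (fun i => 4%:R * jump_mass k.+1 i)%R b 4%:R).
- by move=> i; rewrite mulr_ge0//= ler_piMr.
- move=> i; rewrite /b; have := m0 k.+2 i; have := m1 k.+2 i.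
  have := m0 k i; have := m1 k i.
  by case: i => [|i]; [|have := m0 k.+1 i; have := m1 k.+1 i]; lra.
move=> z z0 z2.
have z01 : (0 < z < 1)%R by rewrite z0 (le_lt_trans z2)// invf_lt1 ?ltr1n.
have [x x01 xE] := small_root z01.
have zge i : (0 <= z ^+ i)%R by rewrite exprn_ge0// ltW.
have g0 (c : nat -> R) i : (forall i, 0 <= c i)%R -> 0 <= (z ^+ i * c i)%:E.
  by move=> c0; rewrite lee_fin mulr_ge0.
have e1 : \sum_(0 <= i <oo) (z ^+ i * (4%:R * jump_mass k.+1 i))%:E =
    (4%:R * (1 - x) ^+ k.+1)%:E.
  rewrite EFinM -(jump_gen k.+1 z01 x01 xE) -nneseriesZl//; last by move=> i _; exact: g0.
  by apply: eq_eseriesr => i _; rewrite -EFinM; congr (_%:E); ring.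
have e2 : \sum_(0 <= i <oo) (z ^+ i * (2%:R *
      (if i is i'.+1 then jump_mass k.+1 i' else 0)))%:E =
    (2%:R * z * (1 - x) ^+ k.+1)%:E.
  rewrite nneseriesS; last first.
    by move=> i; rewrite lee_fin mulr_ge0// mulr_ge0//; case: i.
  rewrite mulr0 mulr0 add0e EFinM -(jump_gen k.+1 z01 x01 xE) -nneseriesZl//.
    by apply: eq_eseriesr => i _; rewrite -EFinM exprS; congr (_%:E); ring.
  by move=> i _; exact: g0.
rewrite e1 /b.
under [RHS]eq_eseriesr do rewrite !mulrDr !EFinD.
rewrite nneseriesD; last 2 first.
- move=> i _ _; rewrite adde_ge0 ?g0// lee_fin mulr_ge0// mulr_ge0//; by case: i.
- by move=> i _ _; exact: g0.
rewrite nneseriesD; last 2 first.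
- move=> i _ _; rewrite lee_fin mulr_ge0// mulr_ge0//; by case: i.
- by move=> i _ _; exact: g0.
rewrite e2 (jump_gen k.+2 z01 x01 xE) (jump_gen k z01 x01 xE) -!EFinD.
congr (_%:E); rewrite !exprS; have := xE; rewrite expr2 => xx.
have -> : (2%:R * z * ((1 - x) * (1 - x) ^+ k) = (2%:R * (1 - x) - x * x) * (1 - x) ^+ k)%R.
  by rewrite xx; ring.
by ring.
Qed.

Let jump_mass0 j : jump_mass 0 j = (j == 0%N)%:R.
Proof.
apply: (@power_series_unique _ j _ (fun i => (i == 0%N)%:R : R) 1%R).
- by move=> i; rewrite jump_mass_ge0 jump_mass_le1.
- by move=> i; rewrite ler0n lern1 leq_b1.
move=> z z0 z2.
have z01 : (0 < z < 1)%R by rewrite z0 (le_lt_trans z2)// invf_lt1 ?ltr1n.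
have [x x01 xE] := small_root z01.
rewrite (jump_gen 0 z01 x01 xE) expr0 nneseriesS => [|i]; last first.
  by rewrite lee_fin mulr_ge0// exprn_ge0// ltW.
by rewrite expr0 mul1r eseries0 ?adde0// => i _ _; rewrite mulr0.
Qed.

Let jump_mass_sum k : \sum_(0 <= j <oo) (jump_mass k j)%:E = 1.
Proof.
apply/eqP; rewrite eq_le jump_mass_sum_le1/=.
have fin : \sum_(0 <= j <oo) (jump_mass k j)%:E \is a fin_num.
  rewrite ge0_fin_numE ?(le_lt_trans (jump_mass_sum_le1 k)) ?ltry//.
  by apply: nneseries_ge0 => j _ _; rewrite lee_fin jump_mass_ge0.
rewrite -(fineK fin) lee_fin; set m := fine _.
have Bern (x : R) : (0 < x < 1)%R -> (1 - k%:R * x <= (1 - x) ^+ k)%R.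
  move=> /andP[x0 x1]; elim: (k) => [|n IH]; first by rewrite mul0r subr0 expr0.
  rewrite exprS -natr1; apply: (@le_trans _ _ ((1 - x) * (1 - n%:R * x))%R).
    have : (0 <= n%:R * x * x)%R by rewrite !mulr_ge0// ltW.
    lra.
  by rewrite ler_wpM2l// subr_ge0 ltW.
have xm (x : R) : (0 < x < 1)%R -> ((1 - x) ^+ k <= m)%R.
  move=> x01; have /andP[x0 x1] := x01.
  rewrite -lee_fin -(nu_laplace k x01) /m fineK//.
  apply: (@le_trans _ _ (nu k setT)); last first.
    under eq_eseriesr do rewrite jump_massE.
    rewrite -integral_nneseries//.
    under eq_integral do rewrite poisson_mass_sum.
    by rewrite integral_cst// mul1e.
  rewrite -[leRHS]mul1e -integral_cst//.
  have mE : measurable_fun setT (fun t : R => (expR (- (lambda * x ^+ 2 / (1 - x)) * t))%:E).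
    by apply/measurable_EFinP; apply: measurableT_comp => //; exact: measurable_funM.
  apply: ae_ge0_le_integral => //.
  exists [set t | (t < 0)%R]; split => //.
    by rewrite -[X in measurable X]set_itvE; exact: measurable_itv.
  move=> t /= /not_implyP[_]; apply: contra_notP => /negP; rewrite -leNgt => t0.
  have s0 : (0 <= lambda * x ^+ 2 / (1 - x))%R.
    by rewrite divr_ge0 ?subr_ge0 ?(ltW x1)// mulr_ge0 ?exprn_ge0// ltW.
  by rewrite lee_fin -[leRHS]expR0 ler_expR mulNr oppr_le0 mulr_ge0.
rewrite leNgt; apply/negP => m1.
pose x := ((1 - m) / (k.+2)%:R)%R.
have m0 : (0 <= m)%R.
  by rewrite fine_ge0// nneseries_ge0// => j _ _; rewrite lee_fin jump_mass_ge0.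
have x01 : (0 < x < 1)%R.
  rewrite divr_gt0 ?subr_gt0//= ltr_pdivrMr// mul1r.
  by rewrite (@le_lt_trans _ _ 1%R)// ?gerBl// ltr1n.
have := le_trans (Bern x x01) (xm x x01); apply/negP; rewrite -ltNge.
have : (k%:R * x < 1 - m)%R.
  by rewrite /x mulrA ltr_pdivrMr// mulrC ltr_pM2l ?subr_gt0// ltr_nat.
lra.
Qed.

(** [turn_prob j l]: probability that a simple random walk is, after [j] steps,
    to the right of [l], a tie counting for one half. *)
Fixpoint turn_prob (j : nat) (l : int) : R :=
  if j is i.+1 then ((turn_prob i (l + 1) + turn_prob i (l - 1)) / 2%:R)%R
  else if (l < 0)%R then 1%R else if (l == 0)%R then (2%:R^-1)%R else 0%R.

Lemma turn_prob_bound j l : (0 <= turn_prob j l <= 1)%R.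
Proof.
elim: j l => [|j IH] l /=; last by have := IH (l + 1)%R; have := IH (l - 1)%R; lra.
by case: ifP => _; [|case: ifP => _]; lra.
Qed.

Let turn_prob_sym j l : (turn_prob j l + turn_prob j (- l) = 1)%R.
Proof.
elim: j l => [|j IH] l /=.
  rewrite oppr_lt0 oppr_eq0; case: (ltrgtP l 0%R) => _; lra.
have := IH (l + 1)%R; have := IH (l - 1)%R; rewrite !opprD !opprK; lra.
Qed.

(** Probability that a simple walk started at [l] is negative, a tie counting for
    one half, after [i] extra steps and at the time [zeta k] at which an
    independent walk has come down from [k] to 0. *)
Definition corner_prob (i : nat) (l : int) (k : nat) : R :=
  fine (\sum_(0 <= j <oo) (turn_prob (i + j) l * jump_mass k j)%:E).

Let term_ge0 i l k j : 0 <= (turn_prob (i + j) l * jump_mass k j)%:E.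
Proof.
by rewrite lee_fin mulr_ge0 ?jump_mass_ge0//; have /andP[] := turn_prob_bound (i + j) l.
Qed.

Let corner_sum_le1 i l k :
  \sum_(0 <= j <oo) (turn_prob (i + j) l * jump_mass k j)%:E <= 1.
Proof.
apply: le_trans (jump_mass_sum_le1 k); apply: lee_nneseries => // j _.
by rewrite lee_fin ler_piMl ?jump_mass_ge0//; have /andP[] := turn_prob_bound (i + j) l.
Qed.

Lemma corner_probE i l k : (corner_prob i l k)%:E =
  \sum_(0 <= j <oo) (turn_prob (i + j) l * jump_mass k j)%:E.
Proof.
rewrite fineK// ge0_fin_numE ?nneseries_ge0//.
by rewrite (le_lt_trans (corner_sum_le1 i l k))// ltry.
Qed.

Lemma corner_prob_bound i l k : (0 <= corner_prob i l k <= 1)%R.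
Proof.
by rewrite -!lee_fin corner_probE corner_sum_le1 nneseries_ge0.
Qed.

(** Conditioning on the first of the extra steps. *)
Let corner_probS i l k : (2%:R * corner_prob i.+1 l k =
  corner_prob i (l + 1) k + corner_prob i (l - 1) k)%R.
Proof.
apply: EFin_inj; rewrite [RHS]EFinD [LHS]EFinM !corner_probE -nneseriesD// -nneseriesZl//.
by apply: eq_eseriesr => j _; rewrite -EFinM -EFinD addSn/=; congr (_%:E); field.
Qed.

Let corner_harmonic l k : (4%:R * corner_prob 0 l k.+1 =
  corner_prob 0 (l + 1) k.+1 + corner_prob 0 (l - 1) k.+1 +
  corner_prob 0 l k.+2 + corner_prob 0 l k)%R.
Proof.
apply: EFin_inj; rewrite [LHS]EFinM [RHS]EFinD [X in _ = X + _]EFinD.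
have -> : (corner_prob 0 (l + 1) k.+1 + corner_prob 0 (l - 1) k.+1)%:E =
    \sum_(0 <= j <oo) (turn_prob j l * (2%:R *
      (if j is i.+1 then jump_mass k.+1 i else 0)))%:E.
  rewrite -corner_probS EFinM corner_probE -nneseriesZl// [RHS]nneseriesS.
    rewrite mulr0 mulr0 add0e; apply: eq_eseriesr => j _.
    by rewrite -EFinM add1n mulrCA.
  move=> j; have /andP[h _] := turn_prob_bound j l.
  by rewrite lee_fin mulr_ge0// mulr_ge0//; case: j h => // j _; exact: jump_mass_ge0.
rewrite !corner_probE -nneseriesD//; last first.
  move=> j _; have /andP[h _] := turn_prob_bound j l.
  by rewrite lee_fin mulr_ge0// mulr_ge0//; case: j h => // j _; exact: jump_mass_ge0.
rewrite -nneseriesD//; last first.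
  move=> j _; have /andP[h _] := turn_prob_bound j l; rewrite adde_ge0//.
  by rewrite lee_fin mulr_ge0// mulr_ge0//; case: j h => // j _; exact: jump_mass_ge0.
rewrite -nneseriesZl//; apply: eq_eseriesr => j _; rewrite -EFinM -!EFinD add0n.
by rewrite mulrCA jump_rec -!mulrDr.
Qed.

Let corner_sym l k : (corner_prob 0 l k + corner_prob 0 (- l) k = 1)%R.
Proof.
apply: EFin_inj; rewrite EFinD !corner_probE -nneseriesD// -(jump_mass_sum k).
by apply: eq_eseriesr => j _; rewrite -EFinD -mulrDl turn_prob_sym mul1r.
Qed.

Let corner_boundary (l : nat) : corner_prob 0 l.+1%:Z 0 = 0%R.
Proof.
apply: EFin_inj; rewrite corner_probE eseries0// => j _ _.
by rewrite jump_mass0; case: j => [|j]; rewrite ?mulr0//= mul0r.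
Qed.

(** Without extra steps this is the bound for harmonic measure, and each extra
    step moves the starting point by one unit. *)
Lemma corner_prob_quarter i l k : (0 < k)%N ->
  (`|corner_prob i l k - 1 / 4%:R| <= 3%:R * (`|l%:~R - k%:R| + i%:R) / k%:R)%R.
Proof.
move=> k0; have K0 : (0 < k%:R :> R)%R by rewrite ltr0n.
elim: i l => [|i IH] l.
  rewrite addr0; apply: (@harmonic_quarter _ (corner_prob 0)) => //.
  - by move=> l' y; have /andP[] := corner_prob_bound 0 l' y.
  - by move=> l' y; have /andP[] := corner_prob_bound 0 l' y.
have step (e : int) : (`|e%:~R : R| <= 1)%R -> (`|corner_prob i (l + e) k - 1 / 4%:R| <=
    3%:R * (`|l%:~R - k%:R| + i.+1%:R) / k%:R)%R.
  move=> e1; apply: (le_trans (IH _)); rewrite ler_pM2r ?invr_gt0// ler_pM2l//.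
  have : (`|(l + e)%:~R - k%:R| <= `|l%:~R - k%:R| + `|e%:~R : R|)%R.
    by rewrite intrD addrAC ler_normD.
  by rewrite -natr1; move: e1; lra.
have h1 : (`|corner_prob i (l + 1) k - 1 / 4%:R| <=
    3%:R * (`|l%:~R - k%:R| + i.+1%:R) / k%:R)%R by apply: step; rewrite normr1.
have h2 : (`|corner_prob i (l - 1) k - 1 / 4%:R| <=
    3%:R * (`|l%:~R - k%:R| + i.+1%:R) / k%:R)%R by apply: step; rewrite normrN normr1.
have -> : (corner_prob i.+1 l k - 1 / 4%:R = ((corner_prob i (l + 1) k - 1 / 4%:R) +
    (corner_prob i (l - 1) k - 1 / 4%:R)) / 2%:R)%R.
  by have := corner_probS i l k; lra.
rewrite normrM normfV (@ger0_norm _ 2%:R)// ler_pdivrMr//.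
by apply: (le_trans (ler_normD _ _)); move: h1 h2; lra.
Qed.

End CornerProbability.

(** * Turning back after a service *)

Section Antidiagonal.
Local Open Scope ereal_scope.
Variable R : realType.

Lemma nneseries_cut (f : nat -> \bar R) n : (forall i, 0 <= f i) ->
  \sum_(0 <= i <oo) (if (i < n)%N then f i else 0) = \sum_(i < n) f i.
Proof.
move=> f0.
have g0 i : 0 <= (if (i < n)%N then f i else 0) by case: ifP.
rewrite (nneseries_split 0 n)//= add0n big_mkord.
rewrite [X in _ + X]eseries0 ?adde0; last by move=> i ni _; rewrite ltnNge ni.
by apply: eq_bigr => i _; rewrite ltn_ord.
Qed.

Lemma nneseries_antidiagonal (F : nat -> nat -> \bar R) :
  (forall b c, 0 <= F b c) ->
  \sum_(0 <= b <oo) \sum_(0 <= c <oo) F b c =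
  \sum_(0 <= j <oo) \sum_(b < j.+1) F b (j - b)%N.
Proof.
move=> F0.
have g0 j b : 0 <= (if (b < j.+1)%N then F b (j - b)%N else 0) by case: ifP.
transitivity (\sum_(0 <= j <oo) \sum_(0 <= b <oo)
    (if (b < j.+1)%N then F b (j - b)%N else 0)); last first.
  apply: eq_eseriesr => j _.
  by rewrite (@nneseries_cut (fun b => F b (j - b)%N) j.+1).
rewrite [RHS]nneseries_interchange//; apply: eq_eseriesr => b _.
rewrite [RHS](nneseries_split 0 b)//= add0n big_nat big1 ?add0e; last first.
  by move=> j /andP[_ jb]; rewrite ltnS leqNgt jb.
rewrite -[RHS]nneseries_addn//; apply: eq_eseriesr => c _.
by rewrite ltnS leq_addl addnK.
Qed.

End Antidiagonal.

Section TurnBack.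
Local Open Scope ereal_scope.
Variable R : realType.

(** Probability that the server goes back when it finds [b] customers behind
    and [f] ahead: the coin that resolves ties is fair. *)
Definition back_weight (b f : nat) : R :=
  if (f < b)%N then 1%R else if b == f then 2%:R^-1%R else 0%R.

Lemma back_weight_ge0 b f : (0 <= back_weight b f)%R.
Proof. by rewrite /back_weight; case: ifP => // _; case: ifP. Qed.

Lemma back_weightE b l c : back_weight b (l + c) =
  turn_prob R 0 (l%:Z + c%:Z - b%:Z)%R.
Proof.
rewrite /back_weight /= subr_lt0 subr_eq0 -PoszD ltz_nat eqz_nat.
by rewrite eq_sym.
Qed.

(** The mean of [g] after [j] steps of a simple walk, up to the factor
    [2 ^ j]. *)
Let binomial_walk (g : int -> R) (j : nat) (l : int) : R :=
  (\sum_(b < j.+1) 'C(j, b)%:R * g (l + (j - b)%N%:Z - b%:Z))%R.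

Let binomial_walkS g j l : (binomial_walk g j.+1 l =
  binomial_walk g j (l + 1) + binomial_walk g j (l - 1))%R.
Proof.
have S1 n : (n.+1%:Z = n%:Z + 1)%R by rewrite -addn1 PoszD.
rewrite /binomial_walk big_ord_recl /= bin0 subn0 subr0.
under eq_bigr => b _ do rewrite /bump /= add1n binS natrD mulrDl.
rewrite big_split /= addrA; congr (_ + _)%R; last first.
  by apply: eq_bigr => b _; rewrite subSS; congr (_ * g _)%R; rewrite S1; ring.
rewrite big_ord_recr /= bin_small// mul0r addr0 [RHS]big_ord_recl /= bin0 subn0.
congr (_ * g _ + _)%R; first by rewrite S1 subr0; ring.
apply: eq_bigr => b _; rewrite /bump /= add1n; congr (_ * g _)%R.
have -> : (j.+1 - b.+1 = (j - b.+1).+1)%N by have := ltn_ord b; lia.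
by rewrite S1; ring.
Qed.

(** The law of the walk after [j] steps is binomial. *)
Lemma turn_prob_binomial j (l : int) : turn_prob R j l =
  (\sum_(b < j.+1) 'C(j, b)%:R / 2%:R ^+ j *
     turn_prob R 0 (l + (j - b)%N%:Z - b%:Z))%R.
Proof.
rewrite (eq_bigr (fun b : 'I_j.+1 => (2%:R ^+ j)^-1 * ('C(j, b)%:R *
   turn_prob R 0 (l + (j - b)%N%:Z - b%:Z)))%R); last first.
  by move=> b _; rewrite mulrA [('C(_, _)%:R / _)%R]mulrC.
rewrite -mulr_sumr -/(binomial_walk (turn_prob R 0) j l).
elim: j l => [|j IH] l.
  rewrite /binomial_walk big_ord_recl big_ord0 bin0 expr0 invr1 !mul1r addr0.
  by rewrite subn0 addr0 subr0.
rewrite binomial_walkS [LHS]/= -/(turn_prob R j (l + 1)) -/(turn_prob R j (l - 1)).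
by rewrite !IH exprS invfM; ring.
Qed.

(** Two Poisson counts of the same mean [kappa], the second one ahead by [l]:
    their difference is a simple walk with Poisson many steps. *)
Lemma poisson_race (kappa : R) (l : nat) : (0 <= kappa)%R ->
  \sum_(0 <= b <oo) \sum_(0 <= c <oo) (back_weight b (l + c) *
     (poisson_mass kappa b * poisson_mass kappa c))%:E =
  \sum_(0 <= j <oo) (poisson_mass (2%:R * kappa) j * turn_prob R j l%:Z)%:E.
Proof.
move=> k0; rewrite nneseries_antidiagonal; last first.
  by move=> b c; rewrite lee_fin !mulr_ge0 ?back_weight_ge0 ?poisson_mass_ge0.
apply: eq_eseriesr => j _; rewrite sumEFin; congr (_%:E).
rewrite turn_prob_binomial mulr_sumr; apply: eq_bigr => b _.
have bj : (b <= j)%N by rewrite -ltnS.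
rewrite poisson_thinning// back_weightE.
rewrite subnKC// [LHS]mulrC -[LHS]mulrA.
congr (_ * _)%R.
Qed.

Variable lambda : R.
Hypothesis lambda_gt0 : (0 < lambda)%R.
Variable zeta : nat -> set R -> \bar R.
Variable nu : nat -> {measure set R -> \bar R}.
Hypothesis nuE : forall k B, measurable B -> nu k B = zeta k B.
Hypothesis nu_neg : forall k, nu k [set t | (t < 0)%R] = 0.
Hypothesis nu_le1 : forall k, nu k setT <= 1.

(** [service_law] as a measure, so that it can be integrated against: a mixture
    of the laws of the times to empty, shifted by the walking time. *)
Lemma service_measure_exists (y : nat) : exists sigma : {measure set R -> \bar R},
  [/\ forall B, measurable B -> sigma B = service_law lambda zeta y B,
      sigma setT <= 1 &
      forall f : R -> \bar R, measurable_fun setT f -> (forall t, 0 <= f t) ->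
        \int[sigma]_t f t = \sum_(0 <= j <oo) (poisson_mass lambda j)%:E *
           \int[nu (y + j)%N]_t f (1 + t)%R].
Proof.
have shift (j : nat) : {m : {measure set R -> \bar R} |
    (m : set R -> \bar R) = pushforward (nu (y + j)%N) (fun t => 1 + t)%R}.
  apply: cid; apply: image_measure_exists.
  by apply: measurable_funD.
pose c j : {nonneg R} := NngNum (poisson_mass_ge0 lambda j).
pose m_ j : {measure set R -> \bar R} := mscale (c j) (sval (shift j)).
have mE j B : m_ j B = (poisson_mass lambda j)%:E * nu (y + j)%N [set t | B (1 + t)%R].
  rewrite /m_ -[LHS]/((c j)%:num%:E * sval (shift j) B).
  by rewrite (congr1 (fun m => m B) (svalP (shift j))).
have preim B : measurable B -> measurable [set t : R | B (1 + t)%R].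
  move=> mB; have := @measurable_funD _ _ R setT (cst 1%R) id.
  by move=> /(_ (measurable_cst _) (@measurable_id _ _ _)) /(_ measurableT B mB); rewrite setTI.
exists (mseries m_ 0); split.
- move=> B mB; rewrite /mseries /service_law; apply: eq_eseriesr => j _.
  by rewrite -[LHS]/(m_ j B) mE nuE//; exact: preim.
- rewrite /mseries -(poisson_mass_sum lambda); apply: lee_nneseries => // j _.
  rewrite -[leLHS]/(m_ j setT) mE -[leRHS]mule1 lee_wpmul2l ?lee_fin ?poisson_mass_ge0//.
- move=> f mf f0; rewrite ge0_integral_measure_series//.
  apply: eq_eseriesr => j _; rewrite ge0_integral_mscale//=; congr (_ * _).
  rewrite (svalP (shift j)) ge0_integral_pushforward ?preimage_setT//.
  exact: measurable_funD.
Qed.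

(** Probability of turning back when the queue being served has [y] customers
    and the one ahead has [l]. *)
Definition turn_back (l y : nat) : \bar R :=
  \sum_(0 <= j <oo) (poisson_mass lambda j)%:E *
    \sum_(0 <= i <oo) (poisson_mass (2%:R * lambda) i *
       corner_prob lambda nu i l%:Z (y + j)%N)%:E.

(** The walking time, of length one, and the service time are consecutive, so
    the jumps made during the walk come as [i] extra steps. *)
Lemma service_race (y l : nat) (sigma : {measure set R -> \bar R}) :
  (forall f : R -> \bar R, measurable_fun setT f -> (forall t, 0 <= f t) ->
     \int[sigma]_t f t = \sum_(0 <= j <oo) (poisson_mass lambda j)%:E *
           \int[nu (y + j)%N]_t f (1 + t)%R) ->
  \int[sigma]_t \sum_(0 <= j <oo)
     (poisson_mass (2%:R * (lambda * t)) j * turn_prob R j l%:Z)%:E =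
  turn_back l y.
Proof.
move=> sigmaE.
have tp0 j : (0 <= turn_prob R j l%:Z)%R by have /andP[] := turn_prob_bound R j l%:Z.
have mpm (a : R) (j : nat) : measurable_fun setT (fun t : R => poisson_mass (a * t) j).
  have m : measurable_fun setT (fun t : R => a * t)%R by exact: measurable_funM.
  exact: (measurableT_comp (@measurable_poisson_mass R j) m).
have mterm j : measurable_fun setT (fun t : R =>
    (poisson_mass (2%:R * (lambda * t)) j * turn_prob R j l%:Z)%:E).
  apply/measurable_EFinP; apply: measurable_funM => //.
  by under eq_fun do rewrite mulrA; exact: mpm.
rewrite sigmaE; last 2 first.
- by apply: ge0_emeasurable_sum => // j t _ _; rewrite lee_fin mulr_ge0 ?poisson_mass_ge0.
- by move=> t; apply: nneseries_ge0 => j _ _; rewrite lee_fin mulr_ge0 ?poisson_mass_ge0.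
apply: eq_eseriesr => j _; congr (_ * _).
pose F (i i' : nat) (t : R) : \bar R := (poisson_mass (2%:R * lambda) i)%:E *
  ((turn_prob R (i + i') l%:Z)%:E * (poisson_mass (2%:R * lambda * t) i')%:E).
have F0 i i' t : 0 <= F i i' t.
  by rewrite !mule_ge0 ?lee_fin ?poisson_mass_ge0.
have mF i i' : measurable_fun setT (F i i').
  by apply: emeasurable_funM => //; apply: emeasurable_funM => //; apply/measurable_EFinP.
transitivity (\int[nu (y + j)%N]_t \sum_(0 <= i <oo) \sum_(0 <= i' <oo) F i i' t).
  apply: ge0_ae_eq_integral => //.
  - apply: ge0_emeasurable_sum => [i t _ _|i _].
      by rewrite lee_fin mulr_ge0 ?poisson_mass_ge0.
    apply/measurable_EFinP; apply: measurable_funM => //.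
    have m : measurable_fun setT (fun t : R => 2%:R * (lambda * (1 + t)))%R.
      by apply: measurable_funM => //; apply: measurable_funM => //; exact: measurable_funD.
    exact: (measurableT_comp (@measurable_poisson_mass R i) m).
  - apply: ge0_emeasurable_sum => [i t _ _|i _]; first by apply: nneseries_ge0.
    exact: ge0_emeasurable_sum.
  - by move=> t _; apply: nneseries_ge0 => i _ _; rewrite lee_fin mulr_ge0 ?poisson_mass_ge0.
  - by move=> t _; do 2 apply: nneseries_ge0 => ? _ _.
  exists [set t | (t < 0)%R]; split => //.
    by rewrite -[X in measurable X]set_itvE; exact: measurable_itv.
  move=> t /= /not_implyP[_]; apply: contra_notP => /negP; rewrite -leNgt => t0.
  rewrite [RHS]nneseries_antidiagonal//; apply: eq_eseriesr => i _.
  rewrite (_ : 2%:R * (lambda * (1 + t)) = 2%:R * lambda + 2%:R * lambda * t)%R; last by ring.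
  rewrite poisson_convolution ?mulr_ge0 ?(ltW lambda_gt0)// mulr_suml -sumEFin.
  apply: eq_bigr => b _; have bi : (b <= i)%N by rewrite -ltnS.
  by rewrite /F subnKC// -!EFinM; congr (_%:E); ring.
rewrite integral_nneseries//; last 2 first.
- by move=> i; apply: ge0_emeasurable_sum.
- by move=> i t _; apply: nneseries_ge0.
apply: eq_eseriesr => i _.
rewrite integral_nneseries// EFinM corner_probE//.
rewrite -nneseriesZl; last first.
  by move=> i' _; rewrite lee_fin mulr_ge0 ?jump_mass_ge0.
apply: eq_eseriesr => i' _; rewrite ge0_integralZl//; last 3 first.
- by apply: emeasurable_funM => //; apply/measurable_EFinP.
- by move=> t _; rewrite mule_ge0 ?lee_fin ?poisson_mass_ge0.
- by rewrite lee_fin poisson_mass_ge0.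
congr (_ * _); rewrite ge0_integralZl//; last 3 first.
- exact/measurable_EFinP.
- by move=> t _; rewrite lee_fin poisson_mass_ge0.
- by rewrite lee_fin.
by rewrite EFinM jump_massE.
Qed.

Hypothesis nu_laplace : forall k (x : R), (0 < x < 1)%R ->
  \int[nu k]_t (expR (- (lambda * x ^+ 2 / (1 - x)) * t))%:E = ((1 - x) ^+ k)%:E.

Let poisson_affine (kappa a c : R) : (0 <= kappa)%R -> (0 <= a)%R -> (0 <= c)%R ->
  \sum_(0 <= j <oo) (poisson_mass kappa j)%:E * (a + c * j%:R)%:E = (a + c * kappa)%:E.
Proof.
move=> k0 a0 c0.
transitivity (\sum_(0 <= j <oo) (a%:E * (poisson_mass kappa j)%:E +
    c%:E * (j%:R * poisson_mass kappa j)%:E)).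
  by apply: eq_eseriesr => j _; rewrite -!EFinM -EFinD; congr (_%:E); ring.
rewrite nneseriesD; last 2 first.
- by move=> j _ _; rewrite mule_ge0 ?lee_fin ?poisson_mass_ge0.
- by move=> j _ _; rewrite mule_ge0 ?lee_fin ?mulr_ge0 ?poisson_mass_ge0.
rewrite !nneseriesZl; last 2 first.
- by move=> j _; rewrite lee_fin mulr_ge0 ?poisson_mass_ge0.
- by move=> j _; rewrite lee_fin poisson_mass_ge0.
by rewrite poisson_mass_sum poisson_mean// mule1 -EFinM -EFinD.
Qed.

Let turn_dev (l y i j : nat) : R :=
  (3%:R * (`|l%:R - y%:R| + j%:R + i%:R) / y%:R)%R.

Let corner_dev (l y i j : nat) : (0 < y)%N ->
  (`|corner_prob lambda nu i l%:Z (y + j)%N - 1 / 4%:R| <= turn_dev l y i j)%R.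
Proof.
move=> y0; have Y0 : (0 < y%:R :> R)%R by rewrite ltr0n.
apply: le_trans (corner_prob_quarter lambda_gt0 nu_laplace nu_neg nu_le1 _ _ _) _.
  by rewrite addn_gt0 y0.
have n1 : (`|(l%:Z)%:~R - (y + j)%:R| <= `|l%:R - y%:R| + j%:R :> R)%R.
  rewrite natrD opprD addrA -[(l%:Z)%:~R]/(l%:R : R).
  by rewrite (le_trans (ler_normB _ _))// normr_nat.
have t0 : (0 <= `|(l%:Z)%:~R - (y + j)%:R| + i%:R :> R)%R by rewrite addr_ge0.
apply: (@le_trans _ _ (3%:R * (`|(l%:Z)%:~R - (y + j)%:R| + i%:R) / y%:R)%R).
  rewrite ler_wpM2l ?mulr_ge0// lef_pV2 ?posrE ?ltr0n ?addn_gt0 ?y0//.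
  by rewrite ler_nat leq_addr.
by rewrite /turn_dev ler_pM2r ?invr_gt0// ler_pM2l// lerD2r.
Qed.

Let sum_dev (l y : nat) (a : R) : (0 < y)%N -> (0 <= a)%R ->
  \sum_(0 <= j <oo) (poisson_mass lambda j)%:E *
    \sum_(0 <= i <oo) (poisson_mass (2%:R * lambda) i)%:E *
       (a + turn_dev l y i j)%:E =
  (a + 3%:R * (`|l%:R - y%:R| + 3%:R * lambda) / y%:R)%:E.
Proof.
move=> y0 a0; have Y0 : (0 < y%:R :> R)%R by rewrite ltr0n.
have l0 := ltW lambda_gt0.
have c0 : (0 <= 3%:R / y%:R :> R)%R by rewrite divr_ge0.
transitivity (\sum_(0 <= j <oo) (poisson_mass lambda j)%:E *
   ((a + 3%:R / y%:R * (`|l%:R - y%:R| + 2%:R * lambda)) + 3%:R / y%:R * j%:R)%:E).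
  apply: eq_eseriesr => j _; congr (_ * _).
  have a1 : (0 <= a + 3%:R / y%:R * (`|l%:R - y%:R| + j%:R))%R.
    by rewrite addr_ge0// mulr_ge0// addr_ge0.
  have k2 : (0 <= 2%:R * lambda)%R by rewrite mulr_ge0.
  have := poisson_affine k2 a1 c0.
  rewrite (_ : a + 3%:R / y%:R * (`|l%:R - y%:R| + j%:R) + 3%:R / y%:R * (2%:R * lambda) =
    a + 3%:R / y%:R * (`|l%:R - y%:R| + 2%:R * lambda) + 3%:R / y%:R * j%:R)%R; last by ring.
  move=> <-; apply: eq_eseriesr => i _; congr (_ * _%:E); rewrite /turn_dev; ring.
rewrite poisson_affine//; last by rewrite addr_ge0// mulr_ge0// addr_ge0// mulr_ge0.
by congr (_%:E); ring.
Qed.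

(** The walking time and the arrivals during it only shift the starting point of
    the race, by [3 * lambda] units on average. *)
Lemma turn_back_quarter (l y : nat) : (0 < y)%N ->
  turn_back l y <= (1 / 4%:R + 3%:R * (`|l%:R - y%:R| + 3%:R * lambda) / y%:R)%:E /\
  (1 / 4%:R)%:E <= turn_back l y +
    (3%:R * (`|l%:R - y%:R| + 3%:R * lambda) / y%:R)%:E.
Proof.
move=> y0; have l0 := ltW lambda_gt0.
have cp0 i j : (0 <= corner_prob lambda nu i l%:Z (y + j)%N)%R.
  by have /andP[] := corner_prob_bound lambda nu_le1 i l%:Z (y + j)%N.
have td0 i j : (0 <= turn_dev l y i j)%R.
  by rewrite divr_ge0// mulr_ge0// !addr_ge0.
split.
  rewrite -(sum_dev l y0 (divr_ge0 ler01 (ler0n _ _))) /turn_back.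
  apply: lee_nneseries => j _.
    rewrite mule_ge0 ?lee_fin ?poisson_mass_ge0//.
    by apply: nneseries_ge0 => i _ _; rewrite lee_fin mulr_ge0 ?poisson_mass_ge0.
  rewrite lee_wpmul2l ?lee_fin ?poisson_mass_ge0//; apply: lee_nneseries => i _.
    by rewrite lee_fin mulr_ge0 ?poisson_mass_ge0.
  rewrite -EFinM lee_fin ler_wpM2l ?poisson_mass_ge0//.
  by have := corner_dev l i j y0; rewrite ler_norml => /andP[_]; lra.
have := sum_dev l y0 (lexx 0%R); rewrite add0r => <-.
rewrite /turn_back -nneseriesD; last 2 first.
- move=> j _ _; rewrite mule_ge0 ?lee_fin ?poisson_mass_ge0//.
  by apply: nneseries_ge0 => i _ _; rewrite lee_fin mulr_ge0 ?poisson_mass_ge0.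
- move=> j _ _; rewrite mule_ge0 ?lee_fin ?poisson_mass_ge0//.
  by apply: nneseries_ge0 => i _ _; rewrite -EFinM lee_fin mulr_ge0 ?poisson_mass_ge0 ?add0r.
have := poisson_affine l0 (divr_ge0 ler01 (ler0n R 4)) (lexx 0%R).
rewrite mul0r addr0 => <-; apply: lee_nneseries => j _.
  by rewrite mul0r addr0 -EFinM lee_fin mulr_ge0 ?poisson_mass_ge0.
rewrite -muleDr//; last first.
  by apply: ge0_adde_def; rewrite inE; apply: nneseries_ge0 => i _ _;
    rewrite -?EFinM lee_fin mulr_ge0 ?poisson_mass_ge0 ?add0r.
rewrite lee_wpmul2l ?lee_fin ?poisson_mass_ge0// mul0r addr0.
rewrite -nneseriesD; last 2 first.
- by move=> i _ _; rewrite lee_fin mulr_ge0 ?poisson_mass_ge0.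
- by move=> i _ _; rewrite -EFinM lee_fin mulr_ge0 ?poisson_mass_ge0 ?add0r.
have k2 : (0 <= 2%:R * lambda)%R by rewrite mulr_ge0.
have := poisson_affine k2 (divr_ge0 ler01 (ler0n R 4)) (lexx 0%R).
rewrite mul0r addr0 => <-; apply: lee_nneseries => i _.
  by rewrite mul0r addr0 -EFinM lee_fin mulr_ge0 ?poisson_mass_ge0.
rewrite mul0r addr0 -!EFinM -EFinD lee_fin -mulrDr ler_wpM2l ?poisson_mass_ge0//.
by have := corner_dev l i j y0; rewrite ler_norml => /andP[]; lra.
Qed.

End TurnBack.

(** * Countably valued random variables *)

Section DiscreteMeasurability.
Context (Om : pointedType).
Implicit Types (G : set (set Om)).

(** All subsets of the range are allowed, so that composition on the left with an
    arbitrary function preserves the property. *)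
Definition discrete_measurable G (V : Type) (f : Om -> V) :=
  forall B : set V, <<s G >> (f @^-1` B).

Lemma sigmaT G : <<s G >> setT.
Proof. exact: (@measurableT _ (g_sigma_algebraType G)). Qed.

Lemma sigmaI G A B : <<s G >> A -> <<s G >> B -> <<s G >> (A `&` B).
Proof. exact: (@measurableI _ (g_sigma_algebraType G)). Qed.

Lemma sigmaC G A : <<s G >> A -> <<s G >> (~` A).
Proof. exact: (@measurableC _ (g_sigma_algebraType G)). Qed.

Lemma sigma_bigcup G (V : countType) (F : V -> set Om) :
  (forall v, <<s G >> (F v)) -> <<s G >> (\bigcup_v F v).
Proof.
exact: (@countable_bigcupT_measurable _ (g_sigma_algebraType G) V F (countableP _)).
Qed.

Lemma discrete_measurable_points G (V : countType) (f : Om -> V) :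
  (forall v, <<s G >> (f @^-1` [set v])) -> discrete_measurable G f.
Proof.
move=> mf B.
rewrite (_ : f @^-1` B = \bigcup_v (f @^-1` [set v] `&` [set _ | B v])).
  apply: sigma_bigcup => v; apply: sigmaI => //.
  have [Bv|nBv] := pselect (B v).
    by rewrite (_ : [set _ | _] = setT); [exact: sigmaT|apply/seteqP; split].
  rewrite (_ : [set _ | _] = ~` setT); first by apply: sigmaC; exact: sigmaT.
  by rewrite setCT; apply/seteqP; split.
by apply/seteqP; split => [w Bw|w [v _] [/= <-]//]; exists (f w).
Qed.

Lemma discrete_measurable_comp G (V W : Type) (h : V -> W) (f : Om -> V) :
  discrete_measurable G f -> discrete_measurable G (fun w => h (f w)).
Proof. by move=> mf B; exact: (mf (h @^-1` B)). Qed.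

(** Used for the queues around the random position of the server. *)
Lemma discrete_measurable_eval G (V : countType) (W : Type) (f : Om -> V)
    (g : V -> Om -> W) : discrete_measurable G f ->
  (forall v, discrete_measurable G (g v)) ->
  discrete_measurable G (fun w => g (f w) w).
Proof.
move=> mf mg B.
rewrite (_ : _ @^-1` _ = \bigcup_v (f @^-1` [set v] `&` g v @^-1` B)).
  by apply: sigma_bigcup => v; apply: sigmaI; [exact: mf|exact: mg].
by apply/seteqP; split => [w Bw|w [v _] [/= <-]//]; exists (f w).
Qed.

Lemma discrete_measurable_pair G (V W : countType) (f : Om -> V) (g : Om -> W) :
  discrete_measurable G f -> discrete_measurable G g ->
  discrete_measurable G (fun w => (f w, g w)).
Proof.
move=> mf mg; apply: (discrete_measurable_eval (g := fun v w => (v, g w)) mf) => v.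
exact: (discrete_measurable_comp (pair v) mg).
Qed.

End DiscreteMeasurability.

Section CountableSums.
Context (d : measure_display) (Om : measurableType d) (R : realType).
Variable P : probability Om R.

Lemma sigma_sub_measurable (G : set (set Om)) :
  G `<=` measurable -> <<s G >> `<=` measurable.
Proof. exact: smallest_sub (sigma_algebra_measurable _). Qed.

Definition nth_count (i : nat) : option nat := if i is j.+1 then Some j else None.

Definition count_rank (v : option nat) : nat := if v is Some j then j.+1 else 0%N.

Lemma count_rankK v : nth_count (count_rank v) = v.
Proof. by case: v. Qed.

Lemma nth_countK i : count_rank (nth_count i) = i.
Proof. by case: i. Qed.

Lemma measure_split_nat (D : set Om) (f : Om -> nat) : measurable D ->
  (forall i, measurable (f @^-1` [set i])) ->
  P D = (\sum_(0 <= i <oo) P (D `&` f @^-1` [set i]))%E.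
Proof.
move=> mD mf.
rewrite {1}(_ : D = \bigcup_i (D `&` f @^-1` [set i])); last first.
  by apply/seteqP; split => [w Dw|w [i _] []//]; exists (f w).
rewrite measure_bigcup => [|i _|].
- by apply: eq_eseriesl => i; rewrite in_setT.
- exact: measurableI.
- by move=> i j _ _ [w [[_ /= <-] [_ /= <-]]].
Qed.

Lemma ae_countable (V : countType) (A : V -> set Om) :
  (forall v, {ae P, forall w, A v w}) -> {ae P, forall w, forall v, A v w}.
Proof.
move=> aeA; pose N v := ~` A v.
have : P.-negligible (\bigcup_n (if unpickle n is Some v then N v else set0)).
  apply: negligible_bigcup => n; case: unpickle => [v|]; first exact: aeA.
  exact: negligible_set0.
apply: negligibleS => w /= /existsNP[v nA].
by exists (pickle v) => //; rewrite pickleK.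
Qed.

Lemma negligible_of_measure0 (N : set Om) : measurable N -> P N = 0%E ->
  {ae P, forall w, ~ N w}.
Proof.
by move=> mN PN; exists N; split => // w /= /contrapT.
Qed.

End CountableSums.

(** * One step of the greedy server *)

Section ServerBasics.
Context (R : realType) (lambda : R) (zeta : nat -> set R -> \bar R).
Hypothesis lambda_gt0 : 0 < lambda.
Context (d : measure_display) (Om : measurableType d) (P : probability Om R).
Variables (Q : nat -> int -> Om -> option nat) (X : nat -> Om -> int).
Variables (T : nat -> Om -> R) (xi : nat -> Om -> int).
Hypothesis server : greedy_server Q X T xi P lambda zeta.

Let past := past_events Q X T xi.
Let time_events m := past m.+1 `|`
  [set E | exists2 B, measurable B & E = T m.+1 @^-1` B].

Let past_mono m m' : (m <= m')%N -> past m `<=` past m'.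
Proof. by move=> mm A [i /= im Ai]; exists i => //=; exact: leq_trans mm. Qed.

Lemma history_sub_time m : history Q X T xi m `<=` history_with_time Q X T xi m.
Proof. by apply: sub_sigma_algebra2 => A; left. Qed.

Lemma time_sub_tie m :
  history_with_time Q X T xi m `<=` history_before_tie Q X T xi m.+1.
Proof.
apply: sub_sigma_algebra2 => A [pA|TA]; first by left.
by right; right.
Qed.

Lemma tie_sub_history m :
  history_before_tie Q X T xi m `<=` history Q X T xi m.
Proof.
apply: sub_sigma_algebra2 => A [|sA]; first exact: past_mono.
by exists m => //=; left.
Qed.

Lemma history_measurable m : history Q X T xi m `<=` measurable.
Proof.
apply: sigma_sub_measurable => A [i _]; exact: (gs_measurable server).
Qed.

Lemma tie_measurable m : history_before_tie Q X T xi m `<=` measurable.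
Proof. exact: subset_trans (@tie_sub_history m) (@history_measurable m). Qed.

Lemma time_measurable m : history_with_time Q X T xi m `<=` measurable.
Proof. exact: subset_trans (@time_sub_tie m) (@tie_measurable m.+1). Qed.

Lemma discrete_Q m i k : (i <= m)%N -> discrete_measurable (past m.+1) (Q i k).
Proof.
move=> im; apply: discrete_measurable_points => v; apply: sub_sigma_algebra.
by exists i => //=; left; left; left; exists k, v.
Qed.

Lemma discrete_X m i : (i <= m)%N -> discrete_measurable (past m.+1) (X i).
Proof.
move=> im; apply: discrete_measurable_points => v; apply: sub_sigma_algebra.
by exists i => //=; left; left; right; exists v.
Qed.

Lemma discrete_xi m i : (i <= m)%N -> discrete_measurable (past m.+1) (xi i).
Proof.
move=> im; apply: discrete_measurable_points => v; apply: sub_sigma_algebra.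
by exists i => //=; right; exists v.
Qed.

Lemma discrete_eta m i : (i <= m)%N ->
  discrete_measurable (past m.+1) (eta Q X xi i.+1).
Proof.
move=> im; rewrite /eta /=.
have mQ c : discrete_measurable (past m.+1) (fun w => Q i (X i w + c) w).
  apply: (discrete_measurable_eval (g := fun x w => Q i (x + c) w)) => [|x].
    exact: discrete_X.
  exact: discrete_Q.
have := discrete_measurable_pair (discrete_measurable_pair (mQ 1) (mQ (-1)))
  (discrete_xi im).
apply: (discrete_measurable_comp (fun z =>
   let r := queue_count z.1.1 in let l := queue_count z.1.2 in
   if (l < r)%N then 1 else if (r < l)%N then -1 else z.2)).
Qed.

Lemma discrete_X1 m i : (i <= m)%N -> discrete_measurable (past m.+1) (X i.+1).
Proof.
move=> im; rewrite (_ : X i.+1 = (fun w => (fun z => z.1 + z.2)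
   (X i w, eta Q X xi i.+1 w))); last first.
  by apply/funext => w; exact: (gs_X server).
apply: (discrete_measurable_comp (fun z : int * int => z.1 + z.2)
  (f := fun w => (X i w, eta Q X xi i.+1 w))).
apply: discrete_measurable_pair.
  exact: discrete_X.
exact: discrete_eta.
Qed.

Lemma history_T m i B : (i <= m)%N -> measurable B ->
  history Q X T xi m (T i @^-1` B).
Proof.
by move=> im mB; apply: sub_sigma_algebra; exists i => //=; left; right; exists B.
Qed.

Lemma time_T m i B : (i <= m.+1)%N -> measurable B ->
  history_with_time Q X T xi m (T i @^-1` B).
Proof.
rewrite leq_eqVlt => /orP[/eqP ->|im] mB; last first.
  by apply: history_sub_time; exact: history_T.
by apply: sub_sigma_algebra; right; exists B.
Qed.

Lemma time_tau m i B : (i <= m.+1)%N -> measurable B ->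
  history_with_time Q X T xi m (tau T i @^-1` B).
Proof.
move=> im mB.
have mT j : (j <= m.+1)%N ->
    measurable_fun [set: g_sigma_algebraType (time_events m)] (T j).
  by move=> jm _ C mC; rewrite setTI; exact: time_T.
have : measurable_fun [set: g_sigma_algebraType (time_events m)] (tau T i).
  by apply: measurable_funB; apply: mT => //; case: i im => // i /ltnW.
by move=> /(_ measurableT B mB); rewrite setTI.
Qed.

Lemma history_tau m i B : (i <= m)%N -> measurable B ->
  history Q X T xi m (tau T i @^-1` B).
Proof.
move=> im mB.
have mT j : (j <= m)%N ->
    measurable_fun [set: g_sigma_algebraType (past m.+1)] (T j).
  by move=> jm _ C mC; rewrite setTI; exact: history_T.
have : measurable_fun [set: g_sigma_algebraType (past m.+1)] (tau T i).
  by apply: measurable_funB; apply: mT => //; case: i im => // i /ltnW.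
by move=> /(_ measurableT B mB); rewrite setTI.
Qed.

Lemma measurable_tau i : measurable_fun setT (tau T i).
Proof.
by move=> _ B mB; rewrite setTI; apply: (@history_measurable i); exact: history_tau.
Qed.

Lemma measurable_T i : measurable_fun setT (T i).
Proof.
by move=> _ B mB; rewrite setTI; apply: (@history_measurable i); exact: history_T.
Qed.

Let site m (k : int) (v : option nat) (w : Om) : R :=
  site_mass lambda (Q m k w) (X m.+1 w) (tau T m.+1 w) (T m.+1 w) k v.

Lemma site_mass_ge0 u x t T' k v : 0 <= site_mass lambda u x t T' k v.
Proof.
rewrite /site_mass; case: eqP => // _; case: u v => [a|] [b|] //.
  by case: ifP => // _; exact: poisson_mass_ge0.
by case: ifP => // _; exact: poisson_mass_ge0.
Qed.

Lemma site_law m k v C : history_with_time Q X T xi m C ->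
  P (C `&` Q m.+1 k @^-1` [set v]) = (\int[P]_(w in C) (site m k v w)%:E)%E.
Proof.
move=> mC; have [_ _ /(_ C mC)] := @gs_Q _ _ _ _ _ _ _ _ _ _ server m [:: k] (fun=> v) isT.
rewrite setIC => e; transitivity (P (C `&` [set w | forall k', k' \in [:: k] -> Q m.+1 k' w = v])).
  congr (P (_ `&` _)); apply/seteqP; split => w /=.
    by move=> Qv k'; rewrite inE => /eqP ->.
  by apply; rewrite inE.
by rewrite -e; apply: eq_integral => w _; rewrite big_seq1.
Qed.

Lemma measurable_site m k v : measurable_fun setT (fun w => (site m k v w)%:E).
Proof.
have [_ /measurable_int mi _] := @gs_Q _ _ _ _ _ _ _ _ _ _ server m [:: k] (fun=> v) isT.
move: mi; apply: eq_measurable_fun => w _ /=.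
by rewrite big_seq1.
Qed.

(** Events about the new content of one site are bounded by summing the known
    conditional law over its values; [Bad] may depend on the past and on the
    service time. *)
Lemma site_bound m k (C : set Om) (Bad : option nat -> set Om) (delta : R) :
  history_with_time Q X T xi m C ->
  (forall v, history_with_time Q X T xi m (Bad v)) ->
  (forall w, C w -> (\sum_(0 <= i <oo) (\1_(Bad (nth_count i)) w *
      site m k (nth_count i) w)%:E <= delta%:E)%E) ->
  (P (C `&` [set w | Bad (Q m.+1 k w) w]) <= delta%:E * P C)%E.
Proof.
move=> mC mB H; have mC' := time_measurable mC.
have mB' v := time_measurable (mB v).
have mQ v : measurable (Q m.+1 k @^-1` [set v]).
  by apply: (@history_measurable m.+1); exact: discrete_Q.
have mBad : measurable [set w | Bad (Q m.+1 k w) w].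
  rewrite (_ : [set w | _] = \bigcup_v (Q m.+1 k @^-1` [set v] `&` Bad v)).
    by apply: countable_bigcupT_measurable => // v; exact: measurableI.
  by apply/seteqP; split => [w Bw|w [v _] [/= <-]//]; exists (Q m.+1 k w).
rewrite (@measure_split_nat _ _ _ _ _ (count_rank \o Q m.+1 k)); last 2 first.
- exact: measurableI.
- move=> i; rewrite (_ : _ @^-1` _ = Q m.+1 k @^-1` [set nth_count i])//.
  by apply/seteqP; split => w /=; [move=> <-; rewrite count_rankK|move=> ->; rewrite nth_countK].
have g0 i w : (0 <= (\1_(Bad (nth_count i)) w * site m k (nth_count i) w)%:E)%E.
  by rewrite lee_fin mulr_ge0 ?site_mass_ge0// indicE.
have mg i : measurable_fun C (fun w => (\1_(Bad (nth_count i)) w * site m k (nth_count i) w)%:E).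
  apply: (measurable_funS measurableT) => //.
  under eq_fun do rewrite EFinM.
  apply: emeasurable_funM; last exact: measurable_site.
  by apply/measurable_EFinP; exact: measurable_indic.
rewrite [leLHS](_ : _ = \int[P]_(w in C) \sum_(0 <= i <oo)
    (\1_(Bad (nth_count i)) w * site m k (nth_count i) w)%:E)%E; last first.
  rewrite integral_nneseries//; apply: eq_eseriesr => i _.
  transitivity (P (C `&` Bad (nth_count i) `&` Q m.+1 k @^-1` [set nth_count i])).
    congr (P _); apply/seteqP; split => w /=.
      by move=> [[Cw Bw] e]; rewrite -e count_rankK.
    by move=> [[Cw Bw] e]; rewrite e nth_countK.
  rewrite site_law; last exact: (sigmaI mC (mB _)).
  rewrite integral_mkcondr; apply: eq_integral => w _.
  rewrite patchE indicE; case: ifPn => _; rewrite ?mul1r// mul0r//.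
apply: (@le_trans _ _ (\int[P]_(w in C) (cst delta%:E w))%E); last first.
  by rewrite integral_cst.
apply: ge0_le_integral => //.
- by move=> w _; apply: nneseries_ge0.
- exact: ge0_emeasurable_sum.
Qed.


Lemma site_never m k (bad : option nat -> int -> option nat -> Prop) :
  (forall u x v t s, bad u x v -> site_mass lambda u x t s k v = 0) ->
  {ae P, forall w, ~ bad (Q m k w) (X m.+1 w) (Q m.+1 k w)}.
Proof.
move=> bad0.
pose Bad v := [set w | bad (Q m k w) (X m.+1 w) v].
have mp : discrete_measurable (past m.+1) (fun w => (Q m k w, X m.+1 w)).
  by apply: discrete_measurable_pair; [exact: discrete_Q|exact: discrete_X1].
have mB v : history_with_time Q X T xi m (Bad v).
  apply: history_sub_time; exact: (mp [set z | bad z.1 z.2 v]).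
have mp1 : discrete_measurable (past m.+2)
    (fun w => (Q m k w, X m.+1 w, Q m.+1 k w)).
  apply: discrete_measurable_pair; last exact: discrete_Q.
  by apply: discrete_measurable_pair; [exact: discrete_Q|exact: discrete_X].
have mBad : measurable [set w | Bad (Q m.+1 k w) w].
  apply: (@history_measurable m.+1).
  exact: (mp1 [set z | bad z.1.1 z.1.2 z.2]).
apply: (negligible_of_measure0 mBad); apply/eqP.
rewrite eq_le measure_ge0 andbT -[X in P X]setTI.
rewrite -[leRHS](mul0e (P setT)).
apply: site_bound => //; first exact: sigmaT.
move=> w _; rewrite eseries0// => i _ _; rewrite indicE.
case: (boolP (w \in Bad (nth_count i))) => [|_]; last by rewrite mul0r.
by rewrite inE => /bad0; rewrite /site => ->; rewrite mulr0.
Qed.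

Lemma tie_law m C s : history_before_tie Q X T xi m C -> s = 1 \/ s = -1 ->
  P (C `&` xi m @^-1` [set s]) = ((1 / 2%:R)%:E * P C)%E.
Proof.
move=> mC s1; have [_ _ /(_ C mC)] := gs_xi server m s1.
rewrite setIC => <-; rewrite integral_cst//; exact: tie_measurable mC.
Qed.

Lemma tie_sign m : {ae P, forall w, xi m w = 1 \/ xi m w = -1}.
Proof.
have mx s : measurable (xi m @^-1` [set s]).
  by apply: (@history_measurable m); exact: discrete_xi.
have h s : s = 1 \/ s = -1 -> P (xi m @^-1` [set s]) = (1 / 2%:R)%:E.
  move=> s1; rewrite -[X in P X]setTI (tie_law _ s1); last exact: sigmaT.
  by rewrite probability_setT mule1.
exists (~` (xi m @^-1` [set 1] `|` xi m @^-1` [set -1])); split.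
- exact/measurableC/measurableU.
- have m12 : measurable (xi m @^-1` [set 1] `|` xi m @^-1` [set -1]).
    exact: measurableU.
  rewrite probability_setC// measureU//; last first.
    by apply/seteqP; split => // w /= [->].
  rewrite [X in (_ - (X + _))%E]h; last by left.
  rewrite [X in (_ - (_ + X))%E]h; last by right.
  rewrite -EFinD.
  have -> : 1 / 2%:R + 1 / 2%:R = 1 :> R by lra.
  by rewrite subrr.
- by move=> w /= H [|] e; apply: H; [left|right].
Qed.

(** Properties that hold almost surely because the conditional laws put no mass
    outside them. *)
Record regular_path (w : Om) : Prop := RegularPath {
  rp_tie : forall m, xi m w = 1 \/ xi m w = -1;
  rp_empty : forall m, Q m (X m w) w = Some 0%N;
  rp_grow : forall m k a, k != X m.+1 w -> Q m k w = Some a ->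
    exists2 b, (a <= b)%N & Q m.+1 k w = Some b;
  rp_neighbour : forall m k, `|k - X m.+1 w| = 1 -> Q m.+1 k w != None;
  rp_tau : forall m, 1 <= tau T m.+1 w
}.

Hypothesis zeta_neg : forall k, zeta k [set t | t < 0] = 0%E.

Lemma ae_regular_path : {ae P, forall w, regular_path w}.
Proof.
have h1 : {ae P, forall w m, xi m w = 1 \/ xi m w = -1}.
  by apply: ae_countable => m; exact: tie_sign.
have h2 : {ae P, forall w, forall mk : nat * int,
    ~ (mk.2 = X mk.1.+1 w /\ Q mk.1.+1 mk.2 w != Some 0%N)}.
  apply: ae_countable => -[m k] /=.
  apply: (@site_never m k (fun u x v => k = x /\ v != Some 0%N)).
  by move=> u x v t s [-> /negbTE v0]; rewrite /site_mass eqxx v0.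
have h3 : {ae P, forall w, forall mk : nat * int,
    ~ (mk.2 != X mk.1.+1 w /\
       match Q mk.1 mk.2 w, Q mk.1.+1 mk.2 w with
       | Some a, Some b => (b < a)%N | Some _, None => true
       | _, _ => false end)}.
  apply: ae_countable => -[m k] /=.
  apply: (@site_never m k (fun u x v => k != x /\
       match u, v with
       | Some a, Some b => (b < a)%N | Some _, None => true
       | _, _ => false end)).
  move=> u x v t s [/negbTE kx]; rewrite /site_mass kx.
  by case: u v => [a|] [b|]// ba; rewrite leqNgt ba.
have h4 : {ae P, forall w, forall mk : nat * int,
    ~ (`|mk.2 - X mk.1.+1 w| = 1 /\
       Q mk.1 mk.2 w = None /\ Q mk.1.+1 mk.2 w = None)}.
  apply: ae_countable => -[m k] /=.
  apply: (@site_never m k (fun u x v => `|k - x| = 1 /\ u = None /\ v = None)).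
  move=> u x v t s [kx [-> ->]]; rewrite /site_mass kx eqxx/=.
  by case: eqP kx => // ->; rewrite subrr.
have h5 : {ae P, forall w, forall m, 1 <= tau T m.+1 w}.
  apply: ae_countable => m.
  have mB : measurable [set t : R | t < 1].
    by rewrite -[X in measurable X]set_itvE; exact: measurable_itv.
  have [_ _ HH] := gs_tau server m mB.
  have hT : history Q X T xi m setT by exact: sigmaT.
  have := HH setT hT; rewrite setIT => e.
  have : P (tau T m.+1 @^-1` [set t | t < 1]) = 0%E.
    rewrite -e; apply: integral0_eq => w _.
    rewrite /service_law eseries0// => j _ _.
    rewrite (_ : [set t | _] = [set t | t < 0]) ?zeta_neg ?mule0//.
    by apply/seteqP; split => t /=; lra.
  move=> /negligible_of_measure0 H.
  have : {ae P, forall w, ~ (tau T m.+1 @^-1` [set t | t < 1]) w}.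
    by apply: H; rewrite -[X in measurable X]setTI; exact: measurable_tau.
  by apply: filterS => w /= /negP; rewrite -leNgt.
move: h5; apply: filter_app; move: h4; apply: filter_app; move: h3.
apply: filter_app; move: h2; apply: filter_app; move: h1.
apply: filterS => w h1 h2 h3 h4 h5.
have grow m k a : k != X m.+1 w -> Q m k w = Some a ->
    exists2 b, (a <= b)%N & Q m.+1 k w = Some b.
  move=> kx Qa; have := h3 (m, k); rewrite /= kx Qa.
  case: (Q m.+1 k w) => [b|] H; last by case: H.
  by exists b => //; rewrite leqNgt; apply/negP => ab; apply: H.
split => //.
- case=> [|m].
    by rewrite (gs_X0 server) (gs_Q0 server).
  have := h2 (m, X m.+1 w) => /= /not_andP[//|/negP]; rewrite negbK.
  by move/eqP.
- move=> m k kx; case E : (Q m k w) => [a|].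
    have [|b _ ->//] := grow m k a _ E.
    by apply: contra_eq_neq kx => ->; rewrite subrr.
  apply/eqP => E'; exact: (h4 (m, k)).
Qed.

End ServerBasics.

(** * Service times of the greedy server *)

Section Atoms.
Local Open Scope ereal_scope.
Context (d : measure_display) (Om : measurableType d) (R : realType).
Variable P : probability Om R.

Lemma integral_split_nat (f : Om -> nat) (D : set Om) (g : Om -> \bar R) :
  measurable D -> (forall i, measurable (f @^-1` [set i])) ->
  measurable_fun D g -> (forall w, 0 <= g w) ->
  \int[P]_(w in D) g w =
  \sum_(0 <= i <oo) \int[P]_(w in D `&` f @^-1` [set i]) g w.
Proof.
move=> mD mf mg g0.
have DE : D = \bigcup_i (D `&` f @^-1` [set i]).
  by apply/seteqP; split => [w Dw|w [i _] []//]; exists (f w).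
rewrite {1}DE ge0_integral_bigcup//.
- by move=> i; exact: measurableI.
- by rewrite -DE.
- by move=> i j _ _ [w [[_ /= <-] [_ /= <-]]].
Qed.

Lemma le_integral_atoms (V : countType) (f : Om -> V) (g h : Om -> \bar R) :
  (forall v, measurable (f @^-1` [set v])) ->
  measurable_fun setT g -> (forall w, 0 <= g w) ->
  measurable_fun setT h -> (forall w, 0 <= h w) ->
  (forall v, \int[P]_(w in f @^-1` [set v]) g w <=
             \int[P]_(w in f @^-1` [set v]) h w) ->
  \int[P]_w g w <= \int[P]_w h w.
Proof.
move=> mf mg g0 mh h0 H; pose F := pickle \o f.
have mF i : measurable (F @^-1` [set i]).
  have [[v vi]|ni] := pselect (exists v : V, pickle v = i).
    rewrite (_ : _ @^-1` _ = f @^-1` [set v])//; apply/seteqP; split => w /=.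
      by rewrite -vi => /(pcan_inj pickleK).
    by rewrite /F /= => ->.
  rewrite (_ : _ @^-1` _ = set0)//; apply/seteqP; split => w //= Fi.
  by apply: ni; exists (f w).
rewrite (integral_split_nat measurableT mF)// [leRHS](integral_split_nat measurableT mF)//.
apply: lee_nneseries => [i _ _|i _]; first exact: integral_ge0.
rewrite setTI; have [[v vi]|ni] := pselect (exists v : V, pickle v = i).
  rewrite (_ : _ @^-1` _ = f @^-1` [set v])//; apply/seteqP; split => w /=.
    by rewrite -vi => /(pcan_inj pickleK).
  by rewrite /F /= => ->.
rewrite (_ : _ @^-1` _ = set0) ?integral_set0//.
apply/seteqP; split => w //= Fi.
by apply: ni; exists (f w).
Qed.

End Atoms.

Section ServiceTimes.
Local Open Scope ereal_scope.
Context (R : realType) (lambda : R) (zeta : nat -> set R -> \bar R).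
Hypothesis lambda_gt0 : (0 < lambda)%R.
Context (d : measure_display) (Om : measurableType d) (P : probability Om R).
Variables (Q : nat -> int -> Om -> option nat) (X : nat -> Om -> int).
Variables (T : nat -> Om -> R) (xi : nat -> Om -> int).
Hypothesis server : greedy_server Q X T xi P lambda zeta.
Variable sigma : nat -> {measure set R -> \bar R}.
Hypothesis sigmaE : forall y B, measurable B ->
  sigma y B = service_law lambda zeta y B.
Hypothesis sigma_le1 : forall y, sigma y setT <= 1.

Definition chosen m (w : Om) : nat := queue_count (Q m (X m.+1 w) w).

Let past := past_events Q X T xi.

Lemma discrete_chosen m i : (i <= m)%N ->
  discrete_measurable (past m.+1) (chosen i).
Proof.
move=> im; apply: discrete_measurable_comp.
apply: (discrete_measurable_eval (g := fun k w => Q i k w)) => [|k].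
  exact: (discrete_X1 server).
exact: discrete_Q.
Qed.

(** Given the past, the service time depends on the length of the chosen queue
    only. *)
Lemma service_time_law m y C B : history Q X T xi m C ->
  C `<=` chosen m @^-1` [set y] -> measurable B ->
  P (C `&` tau T m.+1 @^-1` B) = P C * sigma y B.
Proof.
move=> mC Cy mB; have [_ _ /(_ C mC)] := gs_tau server m mB.
rewrite setIC => <-.
have fin : sigma y B \is a fin_num.
  rewrite ge0_fin_numE// (le_lt_trans _ (ltry 1))//.
  by rewrite (le_trans _ (sigma_le1 y))// le_measure// inE.
transitivity (\int[P]_(w in C) (cst (sigma y B)) w).
  apply: eq_integral => w; rewrite inE => /Cy /= yE.
  by rewrite -/(chosen m w) yE -sigmaE// fineK.
by rewrite integral_cst 1?muleC//; exact: (history_measurable server mC).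
Qed.

Lemma service_freezing m y C (F : g_sigma_algebraType (past m.+1) * R -> \bar R) :
  history Q X T xi m C -> C `<=` chosen m @^-1` [set y] ->
  measurable_fun setT F -> (forall z, 0 <= F z) ->
  \int[P]_(w in C) F (w, tau T m.+1 w) =
  \int[P]_(w in C) \int[sigma y]_t F (w, t).
Proof.
move=> mC Cy mF F0.
have mC' := history_measurable server mC.
apply: (@freezing _ _ _ P _ (@history_measurable _ _ _ _ _ _ _ _ _ _ server m)
  C mC' _ _ (tau T m.+1) (measurable_tau server m.+1)) => //.
  by apply: le_lt_trans (sigma_le1 y) (ltry 1).
move=> D B mD mB; apply: service_time_law => //.
  exact: (sigmaI mC mD).
by move=> w [/Cy].
Qed.

Hypothesis sigma_laplace : forall y (x : R), (0 < x < 1)%R ->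
  \int[sigma y]_t (expR (- (lambda * x ^+ 2 / (1 - x)) * t))%:E <=
  ((1 - x) ^+ y * expR (- (lambda * x)))%:E.

Let rate (x : R) : R := (lambda * x ^+ 2 / (1 - x))%R.

Let mexp (a : R) i : measurable_fun setT (fun w => (expR (- a * tau T i w))%:E).
Proof.
apply/measurable_EFinP; apply: (measurableT_comp (@measurable_expR R)).
by apply: measurable_funM => //; exact: (measurable_tau server).
Qed.

Lemma service_time_transform m y C (x : R) : (0 < x < 1)%R ->
  history Q X T xi m C -> C `<=` chosen m @^-1` [set y] ->
  \int[P]_(w in C) (expR (- rate x * tau T m.+1 w))%:E <=
  ((1 - x) ^+ y * expR (- (lambda * x)))%:E * P C.
Proof.
move=> x01 mC Cy; have mC' := history_measurable server mC.
pose F (z : g_sigma_algebraType (past m.+1) * R) : \bar R := (expR (- rate x * z.2))%:E.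
have mF : measurable_fun setT F.
  apply/measurable_EFinP; apply: (measurableT_comp (@measurable_expR R)).
  by apply: measurable_funM => //; exact: measurable_snd.
have F0 z : 0 <= F z by rewrite lee_fin expR_ge0.
rewrite -[leLHS]/(\int[P]_(w in C) F (w, tau T m.+1 w)) (service_freezing mC Cy)//.
rewrite [leLHS](_ : _ = \int[P]_(w in C)
  (cst (\int[sigma y]_t (expR (- rate x * t))%:E) w))//.
by rewrite integral_cst// lee_wpmul2r//; exact: sigma_laplace.
Qed.

(** A queue found empty by a departing server receives Poisson arrivals. *)
Lemma site_transform m k C (r : R) : (0 <= r)%R ->
  history_with_time Q X T xi m C ->
  (forall w, C w -> [/\ Q m k w = Some 0%N, k != X m.+1 w & (0 <= tau T m.+1 w)%R]) ->
  \int[P]_(w in C) (r ^+ queue_count (Q m.+1 k w))%:E =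
  \int[P]_(w in C) (expR (- ((1 - r) * lambda) * tau T m.+1 w))%:E.
Proof.
move=> r0 mC HC; have mC' := time_measurable server mC.
have mQ v : measurable (Q m.+1 k @^-1` [set v]).
  by apply: (history_measurable server (m := m.+1)); exact: discrete_Q.
have mrank i : measurable ((count_rank \o Q m.+1 k) @^-1` [set i]).
  rewrite (_ : _ @^-1` _ = Q m.+1 k @^-1` [set nth_count i])//.
  by apply/seteqP; split => w /=; [move=> <-; rewrite count_rankK|move=> ->; rewrite nth_countK].
have mr : measurable_fun setT (fun w => (r ^+ queue_count (Q m.+1 k w))%:E).
  apply/measurable_EFinP => _ B mB; rewrite setTI.
  apply: (history_measurable server (m := m.+1)).
  apply: (discrete_measurable_comp (fun v => r ^+ queue_count v)%R).
  exact: discrete_Q.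
rewrite (integral_split_nat P mC' mrank); last 2 first.
- exact: measurable_funS mr.
- by move=> w; rewrite lee_fin exprn_ge0.
pose g i w : \bar R := (r ^+ queue_count (nth_count i))%:E *
  (site_mass lambda (Q m k w) (X m.+1 w) (tau T m.+1 w) (T m.+1 w) k (nth_count i))%:E.
have g0 i w : 0 <= g i w by rewrite mule_ge0 ?lee_fin ?exprn_ge0 ?site_mass_ge0.
have mg i : measurable_fun C (g i).
  apply: emeasurable_funM => //.
  exact: measurable_funS (measurable_site server m k (nth_count i)).
transitivity (\int[P]_(w in C) \sum_(0 <= i <oo) g i w).
  rewrite integral_nneseries//; apply: eq_eseriesr => i _.
  rewrite ge0_integralZl//; last 3 first.
  - exact: measurable_funS (measurable_site server m k (nth_count i)).
  - by move=> w _; rewrite lee_fin site_mass_ge0.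
  - by rewrite lee_fin exprn_ge0.
  rewrite -(site_law server)//.
  rewrite (_ : _ @^-1` _ = Q m.+1 k @^-1` [set nth_count i]); last first.
    by apply/seteqP; split => w /=; [move=> <-; rewrite count_rankK|move=> ->; rewrite nth_countK].
  rewrite (eq_integral (cst (r ^+ queue_count (nth_count i))%:E)).
    by rewrite integral_cst//; exact: measurableI.
  by move=> w; rewrite inE => -[_ /= ->].
apply: eq_integral => w; rewrite inE => /HC[Qk kX t0].
rewrite nneseriesS// {1}/g /site_mass (negbTE kX) Qk mule0 add0e.
rewrite mulNr -mulrA -mulNr -(poisson_gen r0 (mulr_ge0 (ltW lambda_gt0) t0)).
by apply: eq_eseriesr => j _; rewrite /g /site_mass (negbTE kX) Qk/= subn0 EFinM.
Qed.

Hypothesis ae_regular : {ae P, forall w, regular_path Q X T xi w}.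

Let tau_ge0 m : {ae P, forall w, (0 <= tau T m.+1 w)%R}.
Proof.
by move: ae_regular; apply: filterS => w /rp_tau /(_ m); exact: le_trans.
Qed.

Lemma eta_sign m w : regular_path Q X T xi w ->
  (eta Q X xi m.+1 w = 1 \/ eta Q X xi m.+1 w = -1)%R.
Proof.
move=> reg; rewrite /eta /greedy_move /=.
by do 2 (case: ifP => _; [by left + by right|]); exact: (rp_tie reg).
Qed.

Lemma behind_transform m (x : R) : (0 <= x <= 1)%R ->
  \int[P]_w ((1 - x) ^+ queue_count (Q m.+1 (X m w) w))%:E <=
  \int[P]_w (expR (- (lambda * x) * tau T m.+1 w))%:E.
Proof.
move=> /andP[x0 x1]; have r0 : (0 <= 1 - x)%R by rewrite subr_ge0.
have mX v : measurable (X m @^-1` [set v]).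
  by apply: (history_measurable server (m := m)); exact: discrete_X.
have mr : measurable_fun setT
    (fun w => ((1 - x) ^+ queue_count (Q m.+1 (X m w) w))%:E).
  apply/measurable_EFinP => _ B mB; rewrite setTI.
  apply: (history_measurable server (m := m.+1)).
  apply: (discrete_measurable_comp (fun v => (1 - x) ^+ queue_count v)%R).
  apply: (discrete_measurable_eval (g := fun k w => Q m.+1 k w)).
    exact: discrete_X.
  by move=> k; exact: discrete_Q.
apply: (@le_integral_atoms _ _ _ P _ (X m)) => //.
- by move=> w; rewrite lee_fin exprn_ge0.
move=> k.
pose C := X m @^-1` [set k] `&` ((fun w => (Q m k w, X m.+1 w)) @^-1`
  [set z | z.1 = Some 0%N /\ k != z.2] `&` tau T m.+1 @^-1` `[0%R, +oo[%classic).
have mC : history_with_time Q X T xi m C.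
  apply: sigmaI; first by apply: history_sub_time; exact: discrete_X.
  apply: sigmaI; last by apply: time_tau => //; exact: measurable_itv.
  apply: history_sub_time; apply: discrete_measurable_pair; first exact: discrete_Q.
  exact: (discrete_X1 server).
have mC' := time_measurable server mC.
have AC : X m @^-1` [set k] `&` C = C by apply/setIidr => w [].
have aeC : {ae P, forall w, (X m @^-1` [set k]) w -> C w}.
  move: ae_regular; apply: filterS => w reg Xk; split => //.
  split; last by rewrite /= in_itv/= andbT (le_trans ler01)// (rp_tau reg).
  split => /=; first by rewrite -Xk (rp_empty reg).
  rewrite -Xk (gs_X server) -subr_eq0 opprD addrA subrr add0r oppr_eq0.
  by case: (eta_sign m reg) => ->.
apply: (@le_trans _ _ (\int[P]_(w in C)
    ((1 - x) ^+ queue_count (Q m.+1 k w))%:E)).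
  rewrite -AC integral_mkcondr; apply: ae_ge0_le_integral => //.
  - by move=> w _; rewrite lee_fin exprn_ge0.
  - exact: measurable_funS mr.
  - by move=> w _; apply: erestrict_ge0 => z _; rewrite lee_fin exprn_ge0.
  - apply/(measurable_restrict _ mC' (mX k)); rewrite AC.
    apply: (eq_measurable_fun (fun w => ((1 - x) ^+ queue_count (Q m.+1 (X m w) w))%:E)).
      by move=> w; rewrite inE => -[-> _].
    exact: measurable_funS mr.
  - move: aeC; apply: filterS => w XC Xk.
    by rewrite patchE (mem_set (XC Xk)) (Xk : X m w = k).
rewrite (site_transform r0 mC); last first.
  move=> w [Xk [[/= Qk kX] tw]]; split => //.
  by move: tw; rewrite /= in_itv/= andbT.
rewrite subKr; under eq_integral do rewrite [(x * _)%R]mulrC.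
apply: ge0_subset_integral => //.
- exact: measurable_funS (mexp _ _).
- by move=> w [].
Qed.


Lemma chosen_ge m w k : regular_path Q X T xi w -> (`|k - X m w| = 1)%R ->
  (queue_count (Q m k w) <= chosen m w)%N.
Proof.
move=> reg kX; rewrite /chosen (gs_X server) /eta /greedy_move /=.
have [e|e] : (k = X m w + 1 \/ k = X m w - 1)%R.
- have /eqP : (`|k - X m w| = `|1|)%R by rewrite kX normr1.
  by rewrite eqr_norm2 => /orP[] /eqP /(canRL (subrK _)) ->; [left|right]; rewrite addrC.
- rewrite e; case: ltnP => // H; case: ltnP => [/ltnW//|H'].
  by case: (rp_tie reg m) => -> //.
- rewrite e; case: ltnP => [/ltnW//|H]; case: ltnP => // H'.
  by case: (rp_tie reg m) => -> //.
Qed.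

(** Laplace transform of the [m]-th service time, at the scale on which it
    satisfies a closed recursion. *)
Let growth m (y : R) : \bar R :=
  \int[P]_w (expR (- (lambda * (y / 2%:R)) * tau T m w))%:E.

Let growth_step m (y : R) : (0 < y <= 1)%R ->
  growth m.+2 (y ^+ 2) <= (expR (- (lambda * (y / 2%:R))))%:E * growth m.+1 y.
Proof.
(* With this [x] the rate is at most [lambda * y ^ 2 / 2], whereas the queue left
   behind contributes [lambda * y / 2]. *)
move=> /andP[y0 y1]; set x := (y / 2%:R)%R.
have x01 : (0 < x < 1)%R by rewrite /x; apply/andP; split; lra.
have [x0 x1] := andP x01.
have e0 : (0 <= (expR (- (lambda * x)) : R)%:E) by rewrite lee_fin expR_ge0.
have mc : measurable_fun setT (fun w => ((1 - x) ^+ chosen m.+1 w)%:E).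
  apply/measurable_EFinP => _ B mB; rewrite setTI.
  apply: (history_measurable server (m := m.+1)).
  by apply: (discrete_measurable_comp (fun v => (1 - x) ^+ v)%R); exact: discrete_chosen.
have mb : measurable_fun setT
    (fun w => ((1 - x) ^+ queue_count (Q m.+1 (X m w) w))%:E).
  apply/measurable_EFinP => _ B mB; rewrite setTI.
  apply: (history_measurable server (m := m.+1)).
  apply: (discrete_measurable_comp (fun v => (1 - x) ^+ queue_count v)%R).
  apply: (discrete_measurable_eval (g := fun k w => Q m.+1 k w)).
    exact: discrete_X.
  by move=> k; exact: discrete_Q.
have c0 w : 0 <= ((1 - x) ^+ chosen m.+1 w)%:E.
  by rewrite lee_fin exprn_ge0// subr_ge0 ltW.
have b0 w : 0 <= ((1 - x) ^+ queue_count (Q m.+1 (X m w) w))%:E.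
  by rewrite lee_fin exprn_ge0// subr_ge0 ltW.
apply: (@le_trans _ _ (\int[P]_w (expR (- rate x * tau T m.+2 w))%:E)).
  apply: ae_ge0_le_integral => //.
  - move: (tau_ge0 m.+1); apply: filterS => w t0 _.
    rewrite lee_fin ler_expR !mulNr lerN2 ler_wpM2r// /rate -mulrA.
    rewrite ler_pM2l// ler_pdivrMr ?subr_gt0// /x.
    nra.
apply: (@le_trans _ _ (\int[P]_w ((expR (- (lambda * x)))%:E * ((1 - x) ^+ chosen m.+1 w)%:E))).
  apply: (@le_integral_atoms _ _ _ P _ (chosen m.+1)) => //.
  - by move=> v; apply: (history_measurable server (m := m.+1)); exact: discrete_chosen.
  - exact: emeasurable_funM.
  - by move=> w; rewrite mule_ge0.
  move=> v; have mv : history Q X T xi m.+1 (chosen m.+1 @^-1` [set v]).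
    exact: discrete_chosen.
  apply: (le_trans (service_time_transform x01 mv (@subset_refl _ _))).
  rewrite [leRHS](_ : _ = \int[P]_(w in chosen m.+1 @^-1` [set v])
    cst (((1 - x) ^+ v * expR (- (lambda * x)))%:E) w).
    by rewrite integral_cst//; exact: (history_measurable server mv).
  by apply: eq_integral => w; rewrite inE => /= ->; rewrite -EFinM mulrC.
rewrite ge0_integralZl//; rewrite lee_wpmul2l//.
apply: le_trans (behind_transform m _); last by rewrite !ltW.
apply: ae_ge0_le_integral => //.
move: ae_regular; apply: filterS => w reg _; rewrite lee_fin.
apply: ler_wiXn2l; rewrite ?subr_ge0 ?(ltW x1)//; first by rewrite gerBl ltW.
apply: chosen_ge => //; rewrite (gs_X server) opprD addrA subrr sub0r normrN.
by case: (eta_sign m reg) => ->; rewrite ?normrN normr1.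
Qed.

Let growth_anti m (y y' : R) : (y <= y')%R -> growth m.+1 y' <= growth m.+1 y.
Proof.
move=> yy; apply: ae_ge0_le_integral => //.
- move: (tau_ge0 m); apply: filterS => w t0 _.
  rewrite lee_fin ler_expR !mulNr lerN2 ler_wpM2r//.
  by rewrite ler_wpM2l ?(ltW lambda_gt0)// ler_wpM2r.
Qed.

Let growth_half m : growth m.+1 2%:R^-1 <= (expR (- (lambda / 4%:R)) ^+ m)%:E.
Proof.
elim: m => [|m IH].
  rewrite expr0; apply: (@le_trans _ _ (\int[P]_w (cst 1%:E w))); last first.
    by rewrite integral_cst// mul1e probability_le1.
  apply: ae_ge0_le_integral => //.
  - move: (tau_ge0 0); apply: filterS => w t0 _.
    rewrite lee_fin -expR0 ler_expR mulNr oppr_le0 mulr_ge0// mulr_ge0 ?(ltW lambda_gt0)//.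
apply: le_trans (growth_anti _ (_ : (2%:R^-1 ^+ 2 <= 2%:R^-1)%R)) _; first by lra.
apply: (le_trans (growth_step _ _)); first by lra.
rewrite exprS EFinM (_ : lambda * (2%:R^-1 / 2%:R) = lambda / 4%:R)%R; last by lra.
by rewrite lee_wpmul2l// lee_fin expR_ge0.
Qed.

Let growth_square m i :
  growth (m + i).+1 (2%:R^-1 ^+ (2 ^ i)) <= (expR (- (lambda / 4%:R)) ^+ m)%:E.
Proof.
elim: i => [|i IH]; first by rewrite addn0 expr1 growth_half.
rewrite expnSr exprM addnS.
have h0 : (0 < (2%:R^-1 : R) ^+ (2 ^ i))%R by rewrite exprn_gt0.
have h1 : ((2%:R^-1 : R) ^+ (2 ^ i) <= 1)%R by rewrite exprn_ile1//; lra.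
apply: (le_trans (growth_step _ _)); first by rewrite h0.
apply: le_trans IH; rewrite -[leRHS]mul1e lee_wpmul2r//.
  by apply: integral_ge0 => w _; rewrite lee_fin expR_ge0.
by rewrite lee_fin -expR0 ler_expR oppr_le0 mulr_ge0 ?(ltW lambda_gt0)// divr_ge0// ltW.
Qed.

(** At [1 / 2] the recursion gains a constant factor at each of [m] steps; [i]
    further steps square the argument [i] times; then Markov's inequality. *)
Lemma service_growth m i :
  P [set w | (tau T (m + i).+1 w < 2%:R ^+ (2 ^ i))%R] <=
  (expR (lambda / 2%:R) * expR (- (lambda / 4%:R)) ^+ m)%:E.
Proof.
set c : R := (2%:R ^+ (2 ^ i))%R; set A := [set w | _].
have c0 : (0 < c)%R by rewrite exprn_gt0.
have mA : measurable A.
  have := measurable_tau server (m + i).+1 measurableT (@measurable_itv _ `]-oo, c[).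
  rewrite setTI; congr measurable; apply/seteqP; split => w /=; by rewrite in_itv.
rewrite EFinM; apply: le_trans (lee_wpmul2l _ (growth_square m i)); last first.
  by rewrite lee_fin expR_ge0.
rewrite -(setIT A) -integral_indic// -ge0_integralZl//.
apply: ge0_le_integral => //.
- by apply/measurable_EFinP; exact: measurable_indic.
- by apply: emeasurable_funM => //; exact: mexp.
move=> w _; rewrite indicE; case: (boolP (w \in A)) => [|_]; last first.
  by rewrite mule_ge0 ?lee_fin ?expR_ge0.
rewrite inE /A /= => tc; rewrite -EFinM lee_fin -expRD.
apply: le_trans (expR_ge1Dx _); rewrite lerDl.
rewrite exprVn -/c mulNr subr_ge0 mulrA mulrAC.
rewrite ler_pM2r; last lra.
rewrite -mulrA ler_piMr ?(ltW lambda_gt0)// mulrC.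
by rewrite ler_pdivrMr// mul1r ltW.
Qed.

Lemma measurable_hasty m (c u : R) : measurable
  [set w | (u <= (chosen m w)%:R)%R /\ (tau T m.+1 w < c * (chosen m w)%:R)%R].
Proof.
set A := [set w | _].
have mch v : measurable (chosen m @^-1` [set v]).
  by apply: (history_measurable server (m := m)); exact: discrete_chosen.
rewrite (_ : A = \bigcup_v (chosen m @^-1` [set v] `&`
   [set w | (u <= v%:R)%R /\ (tau T m.+1 w < c * v%:R)%R])); last first.
  apply/seteqP; split => [w Aw|w [v _] [/= <-]//]; by exists (chosen m w).
apply: bigcupT_measurable => v; apply: measurableI => //.
have [uv|uv] := leP u v%:R.
  have := measurable_tau server m.+1 measurableT (@measurable_itv _ `]-oo, (c * v%:R)%R[).
  rewrite setTI; congr measurable; apply/seteqP; split => w /=; rewrite in_itv//=.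
  by move=> [].
by rewrite (_ : [set w | _] = set0)//; apply/seteqP; split => // w /= [].
Qed.

(** A service time is rarely much shorter than the chosen queue: in the Laplace
    transform [x] enters linearly through the queue length but only
    quadratically through the rate, so that a small [x] wins. *)
Lemma hasty_service m (x c u : R) : (0 < x <= 2%:R^-1)%R -> (0 <= c)%R ->
  (2%:R * lambda * x * c <= 2%:R^-1)%R ->
  P [set w | (u <= (chosen m w)%:R)%R /\ (tau T m.+1 w < c * (chosen m w)%:R)%R] <=
  (expR (- (x * u / 2%:R)))%:E.
Proof.
move=> /andP[x0 xh] c0 xc; set A := [set w | _].
have x01 : (0 < x < 1)%R by apply/andP; split; lra.
have rx : (rate x * c <= x / 2%:R)%R.
  have : (rate x <= 2%:R * lambda * x ^+ 2)%R.
    rewrite /rate ler_pdivrMr ?subr_gt0//; last lra.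
    have : (0 <= lambda * x ^+ 2)%R by rewrite mulr_ge0 ?exprn_ge0// ltW.
    nra.
  move=> /(ler_wpM2r c0) /le_trans; apply.
  have := ler_wpM2l (ltW x0) xc; lra.
have mch v : history Q X T xi m (chosen m @^-1` [set v]) by exact: discrete_chosen.
have mch' v := history_measurable server (mch v).
have mA : measurable A by exact: measurable_hasty.
rewrite -(setIT A) -integral_indic//.
apply: (@le_trans _ _ (\int[P]_w (cst (expR (- (x * u / 2%:R)))%:E w))); last first.
  by rewrite integral_cst// -[leRHS]mule1 lee_wpmul2l ?lee_fin ?expR_ge0 ?probability_le1.
apply: (@le_integral_atoms _ _ _ P _ (chosen m)) => //.
- by apply/measurable_EFinP; exact: measurable_indic.
- by move=> w; rewrite lee_fin expR_ge0.
move=> v; rewrite integral_cst//.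
have [uv|uv] := leP u v%:R; last first.
  rewrite integral0_eq ?mule_ge0 ?lee_fin ?expR_ge0// => w /= vE.
  by rewrite indicE memNset// /A /= vE => -[]; rewrite leNgt uv.
apply: (@le_trans _ _ ((expR (rate x * (c * v%:R)))%:E *
    \int[P]_(w in chosen m @^-1` [set v]) (expR (- rate x * tau T m.+1 w))%:E)).
  rewrite -ge0_integralZl//; last exact: measurable_funS (mexp _ _).
  apply: ge0_le_integral => //.
  - by apply/measurable_EFinP; apply: (measurable_funS measurableT) => //; exact: measurable_indic.
  - by apply: emeasurable_funM => //; exact: measurable_funS (mexp _ _).
  move=> w /= vE; rewrite indicE; case: (boolP (w \in A)) => [|_]; last first.
    by rewrite mule_ge0 ?lee_fin ?expR_ge0.
  rewrite inE /A /= vE => -[_ tc]; rewrite -EFinM lee_fin -expRD.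
  apply: le_trans (expR_ge1Dx _); rewrite lerDl.
  rewrite mulNr -mulrBr mulr_ge0 ?subr_ge0 ?(ltW tc)//.
  by rewrite /rate divr_ge0 ?mulr_ge0 ?exprn_ge0 ?(ltW lambda_gt0) ?(ltW x0)//; lra.
apply: le_trans (lee_wpmul2l _ (service_time_transform x01 (mch v) (@subset_refl _ _))) _.
  by rewrite lee_fin expR_ge0.
rewrite muleA lee_wpmul2r// -EFinM lee_fin.
have p1 : ((1 - x) ^+ v <= expR (- x * v%:R))%R.
  rewrite expRM_natr lerXn2r// ?nnegrE ?expR_ge0//; first lra.
  by have := expR_ge1Dx (- x); lra.
apply: (@le_trans _ _ (expR (rate x * (c * v%:R)) * (expR (- x * v%:R) * 1))%R).
  rewrite ler_wpM2l ?expR_ge0// ler_pM ?expR_ge0 ?exprn_ge0//; first lra.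
  by rewrite -expR0 ler_expR oppr_le0 mulr_ge0 ?(ltW lambda_gt0) ?(ltW x0).
rewrite mulr1 -expRD ler_expR.
have v0 : (0 <= v%:R :> R)%R by [].
have := ler_wpM2r v0 rx; have := ler_wpM2l (ltW x0) uv.
nra.
Qed.

End ServiceTimes.

(** * The conditional probability of a turn *)

Section TurningEvent.
Local Open Scope ereal_scope.
Context (R : realType) (lambda : R) (zeta : nat -> set R -> \bar R).
Hypothesis lambda_gt0 : (0 < lambda)%R.
Context (d : measure_display) (Om : measurableType d) (P : probability Om R).
Variables (Q : nat -> int -> Om -> option nat) (X : nat -> Om -> int).
Variables (T : nat -> Om -> R) (xi : nat -> Om -> int).
Hypothesis server : greedy_server Q X T xi P lambda zeta.
Variable sigma : nat -> {measure set R -> \bar R}.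
Hypothesis sigmaE : forall y B, measurable B ->
  sigma y B = service_law lambda zeta y B.
Hypothesis sigma_le1 : forall y, sigma y setT <= 1.
Hypothesis sigma_neg : forall y, sigma y [set t | (t < 0)%R] = 0.

Let past := past_events Q X T xi.

(** Law, given the state at the previous departure, of the number [i] of
    customers waiting ahead when the service starts: the known length, or a
    Poisson number if the queue ahead was not inspected yet. *)
Definition ahead_mass (o : option nat) (t : R) (i : nat) : R :=
  if o is Some l then (i == l)%:R else poisson_mass (lambda * t) i.

Lemma ahead_mass_ge0 o t i : (0 <= ahead_mass o t i)%R.
Proof. by case: o => [l|] //=; exact: poisson_mass_ge0. Qed.

(** Law of the number of customers ahead when a service of duration [t] ends. *)
Let ahead_after (o : option nat) (T0 t : R) (f : nat) : R :=
  match o with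
  | Some l => if (l <= f)%N then poisson_mass (lambda * t) (f - l) else 0%R
  | None => poisson_mass (lambda * (T0 + t)) f
  end.

Let ahead_after_ge0 o T0 t f : (0 <= ahead_after o T0 t f)%R.
Proof.
case: o => [l|] /=; last exact: poisson_mass_ge0.
by case: ifP => // _; exact: poisson_mass_ge0.
Qed.

Let ahead_afterE o T0 t f : (0 <= T0)%R -> (0 <= t)%R -> ahead_after o T0 t f =
  (\sum_(i < f.+1) ahead_mass o T0 i * poisson_mass (lambda * t) (f - i))%R.
Proof.
move=> T00 t0; case: o => [l|] /=; last first.
  by rewrite mulrDr poisson_convolution ?mulr_ge0 ?(ltW lambda_gt0).
case: ifPn => [lf|]; last first.
  rewrite -ltnNge => fl; rewrite big1// => i _.
  by rewrite (ltn_eqF (leq_trans (ltn_ord i) fl)) mul0r.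
rewrite (bigD1 (Ordinal (lf : (l < f.+1)%N)))//= eqxx mul1r big1 ?addr0// => i il.
by rewrite (_ : (i == l :> nat) = false) ?mul0r//; exact/negbTE.
Qed.

Let turn_mass (o : option nat) (T0 t : R) (b f : nat) : R :=
  (back_weight R b f * (poisson_mass (lambda * t) b * ahead_after o T0 t f))%R.

Let turn_mass_ge0 o T0 t b f : (0 <= turn_mass o T0 t b f)%R.
Proof. by rewrite !mulr_ge0 ?back_weight_ge0 ?poisson_mass_ge0. Qed.

(** The final race is that of two queues that both start from zero, the second
    one being ahead by the number [i] of customers present initially. *)
Let turn_mass_sum o T0 t : (0 <= T0)%R -> (0 <= t)%R ->
  \sum_(0 <= b <oo) \sum_(0 <= f <oo) (turn_mass o T0 t b f)%:E =
  \sum_(0 <= i <oo) (ahead_mass o T0 i)%:E *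
    \sum_(0 <= j <oo) (poisson_mass (2%:R * (lambda * t)) j * turn_prob R j i%:Z)%:E.
Proof.
move=> T00 t0; have k0 : (0 <= lambda * t)%R by rewrite mulr_ge0 ?(ltW lambda_gt0).
pose h b i c : \bar R := (ahead_mass o T0 i)%:E * (back_weight R b (i + c) *
  (poisson_mass (lambda * t) b * poisson_mass (lambda * t) c))%:E.
have h0 b i c : 0 <= h b i c.
  by rewrite mule_ge0 ?lee_fin ?ahead_mass_ge0 ?mulr_ge0 ?back_weight_ge0 ?poisson_mass_ge0.
transitivity (\sum_(0 <= b <oo) \sum_(0 <= i <oo) \sum_(0 <= c <oo) h b i c).
  apply: eq_eseriesr => b _; rewrite nneseries_antidiagonal//.
  apply: eq_eseriesr => f _; rewrite /turn_mass ahead_afterE// !mulr_sumr -sumEFin.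
  apply: eq_bigr => i _; rewrite /h subnKC; last by rewrite -ltnS.
  by rewrite -EFinM; congr (_%:E); ring.
rewrite nneseries_interchange; last by move=> b i; apply: nneseries_ge0.
apply: eq_eseriesr => i _; rewrite -poisson_race// -nneseriesZl; last first.
  by move=> b _; apply: nneseries_ge0 => c _ _; rewrite lee_fin !mulr_ge0 ?back_weight_ge0 ?poisson_mass_ge0.
apply: eq_eseriesr => b _; rewrite -nneseriesZl// => c _.
by rewrite lee_fin !mulr_ge0 ?back_weight_ge0 ?poisson_mass_ge0.
Qed.

Lemma two_site_law m (k1 k2 : int) (v1 v2 : option nat) C : k1 != k2 ->
  history_with_time Q X T xi m C ->
  P (C `&` (Q m.+1 k1 @^-1` [set v1] `&` Q m.+1 k2 @^-1` [set v2])) =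
  \int[P]_(w in C)
    (site_mass lambda (Q m k1 w) (X m.+1 w) (tau T m.+1 w) (T m.+1 w) k1 v1 *
     site_mass lambda (Q m k2 w) (X m.+1 w) (tau T m.+1 w) (T m.+1 w) k2 v2)%:E.
Proof.
move=> kk mC; pose v k := if k == k1 then v1 else v2.
have u : uniq [:: k1; k2] by rewrite /= inE kk.
have [_ _ /(_ C mC)] := @gs_Q _ _ _ _ _ _ _ _ _ _ server m [:: k1; k2] v u.
rewrite setIC => e; transitivity (P (C `&` [set w | forall k, k \in [:: k1; k2] -> Q m.+1 k w = v k])).
  congr (P (_ `&` _)); apply/seteqP; split => w /=.
    move=> [e1 e2] k; rewrite !inE => /orP[] /eqP ->; rewrite /v ?eqxx//.
    by rewrite eq_sym (negbTE kk).
  move=> H; split; first by rewrite H ?inE ?eqxx// /v eqxx.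
  by rewrite H ?inE ?eqxx ?orbT// /v eq_sym (negbTE kk).
rewrite -e; apply: eq_integral => w _.
by rewrite big_cons big_seq1 /v eqxx eq_sym (negbTE kk).
Qed.

(** Given the past, the conditional probability of the next turn is a function of
    these data and of [T m] only. *)
Definition situation m (x s : int) (y : nat) (o : option nat) : set Om :=
  [set w | [/\ X m w = x, eta Q X xi m.+1 w = s, Q m x w = Some 0%N,
      Q m (x + s)%R w = Some y & Q m (x + s + s)%R w = o]].

Definition turns m : set Om := [set w | eta Q X xi m.+1 w != eta Q X xi m w].

Let eta_next m x s y o w (v1 v2 : option nat) : s = 1%R \/ s = (-1)%R ->
  situation m x s y o w -> Q m.+1 x w = v1 -> Q m.+1 (x + s + s)%R w = v2 ->
  turns m.+1 w = (if (queue_count v2 < queue_count v1)%N then true else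
   if (queue_count v1 < queue_count v2)%N then false else xi m.+1 w != s).
Proof.
move=> s1 [Xm es _ _ _] e1 e2; rewrite /turns /= es /eta /greedy_move /=.
rewrite (gs_X server) es Xm.
case: s1 => sE; rewrite sE in e1 e2 *.
  rewrite e2 (_ : x + 1 - 1 = x)%R ?addrK// e1.
  by case: ltngtP.
rewrite e2 (_ : x + -1 + 1 = x)%R ?subrK// e1.
by case: ltngtP.
Qed.

Variable tb : nat -> nat -> \bar R.
Hypothesis tb_ge0 : forall i y, 0 <= tb i y.
Hypothesis sigma_race : forall y i, \int[sigma y]_t \sum_(0 <= j <oo)
     (poisson_mass (2%:R * (lambda * t)) j * turn_prob R j i%:Z)%:E = tb i y.

(** Given the two queues, only a tie leaves the decision to the coin. *)
Let turn_split m x s y o C (v1 v2 : option nat) : s = 1%R \/ s = (-1)%R ->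
  history Q X T xi m C -> C `<=` situation m x s y o ->
  P (C `&` turns m.+1 `&`
     (Q m.+1 x @^-1` [set v1] `&` Q m.+1 (x + s + s)%R @^-1` [set v2])) =
  (back_weight R (queue_count v1) (queue_count v2))%:E *
  P (C `&` (Q m.+1 x @^-1` [set v1] `&` Q m.+1 (x + s + s)%R @^-1` [set v2])).
Proof.
move=> s1 mC Cs; set D := C `&` (_ `&` _).
have mD : history_before_tie Q X T xi m.+1 D.
  have gen k v : history_before_tie Q X T xi m.+1 (Q m.+1 k @^-1` [set v]).
    by apply: sub_sigma_algebra; right; left; left; exists k, v.
  apply: sigmaI; last by apply: sigmaI; exact: gen.
  by apply: time_sub_tie; exact: history_sub_time.
have mD' := tie_measurable server mD.
have -> : C `&` turns m.+1 `&`
     (Q m.+1 x @^-1` [set v1] `&` Q m.+1 (x + s + s)%R @^-1` [set v2]) =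
   D `&` [set w | if (queue_count v2 < queue_count v1)%N then true else
   if (queue_count v1 < queue_count v2)%N then false else xi m.+1 w != s].
  apply/seteqP; split => w /=.
    by move=> [[Cw]]; rewrite /D /= => tw [e1 e2]; rewrite -(eta_next s1 (Cs _ Cw) e1 e2).
  rewrite /D /= => -[[Cw [e1 e2]]]; rewrite -(eta_next s1 (Cs _ Cw) e1 e2) => tw.
  by [].
rewrite /back_weight; case: ltngtP => _.
- have -> : D `&` [set w | true] = D by apply/seteqP; split => [w []|w].
  by rewrite mul1e.
- have -> : D `&` [set w | false] = set0 by apply/seteqP; split => // w [].
  by rewrite measure0 mul0e.
have mx : measurable (xi m.+1 @^-1` [set s]).
  by apply: (history_measurable server (m := m.+1)); exact: discrete_xi.
have half := tie_law server mD s1.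
have : P D = P (D `&` xi m.+1 @^-1` [set s]) + P (D `&` [set w | xi m.+1 w != s]).
  rewrite -measureU//.
  - congr (P _); apply/seteqP; split => w /=.
      by move=> Dw; case: (eqVneq (xi m.+1 w) s) => ?; [left|right].
    by move=> [] [].
  - exact: measurableI.
  - apply: measurableI => //; rewrite (_ : [set w | _] = ~` (xi m.+1 @^-1` [set s])).
      exact: measurableC.
    by apply/seteqP; split => w /= /eqP.
  - by apply/seteqP; split => // w /= [[_ ->] [_ /eqP]].
rewrite half; have Dfin : P D \is a fin_num by exact: fin_num_measure.
rewrite -(fineK Dfin); set p := fine _; rewrite -EFinM => /esym/eqP.
rewrite eq_sym addeC -sube_eq//; last by rewrite fin_num_adde_defl.
by move=> /eqP <-; rewrite -EFinB -EFinM; congr (_%:E); lra.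
Qed.

(** The probability of a turn in a given situation: the queue behind is refilled
    from zero and the queue ahead from its present length during the same
    service, whose duration depends on the past only through [y]. *)
Lemma turn_law m x s y o C : s = 1%R \/ s = (-1)%R ->
  history Q X T xi m C -> C `<=` situation m x s y o ->
  P (C `&` turns m.+1) =
  \int[P]_(w in C) \sum_(0 <= i <oo) (ahead_mass o (T m w) i)%:E * tb i y.
Proof.
move=> s1 mC Cs; have mC' := history_measurable server mC.
have mT1 : history_with_time Q X T xi m C by exact: history_sub_time.
pose k2 : int := (x + s + s)%R.
have xk : x != k2.
  by rewrite /k2 -subr_eq0 !opprD !addrA subrr add0r; case: s1 => ->.
have mQ k v : measurable (Q m.+1 k @^-1` [set v]).
  by apply: (history_measurable server (m := m.+1)); exact: discrete_Q.
have rankE k i : (count_rank \o Q m.+1 k) @^-1` [set i] = Q m.+1 k @^-1` [set nth_count i].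
  by apply/seteqP; split => w /=; [move=> <-; rewrite count_rankK|move=> ->; rewrite nth_countK].
have mturn : measurable (turns m.+1).
  apply: (history_measurable server (m := m.+1)).
  have mp : discrete_measurable (past m.+2)
      (fun w => (eta Q X xi m.+2 w, eta Q X xi m.+1 w)).
    by apply: discrete_measurable_pair; exact: (discrete_eta).
  exact: (mp [set z | z.1 != z.2]).
pose site k v w := site_mass lambda (Q m k w) (X m.+1 w) (tau T m.+1 w) (T m.+1 w) k v.
pose G i j w : \bar R := (back_weight R (queue_count (nth_count i)) (queue_count (nth_count j)))%:E
  * (site x (nth_count i) w * site k2 (nth_count j) w)%:E.
have G0 i j w : 0 <= G i j w.
  by rewrite mule_ge0 ?lee_fin ?back_weight_ge0 ?mulr_ge0 ?site_mass_ge0.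
have msite k v : measurable_fun C (fun w => (site k v w)%:E).
  exact: measurable_funS (measurable_site server m k v).
have mG i j : measurable_fun C (G i j).
  apply: emeasurable_funM => //.
  by under eq_fun do rewrite EFinM; exact: emeasurable_funM.
have step1 : P (C `&` turns m.+1) =
    \int[P]_(w in C) \sum_(0 <= i <oo) \sum_(0 <= j <oo) G i j w.
  rewrite (@measure_split_nat _ _ _ P _ (count_rank \o Q m.+1 x)); last 2 first.
  - exact: measurableI.
  - by move=> i; rewrite rankE.
  rewrite integral_nneseries//; last 2 first.
  - by move=> i; exact: ge0_emeasurable_sum.
  - by move=> i w _; exact: nneseries_ge0.
  apply: eq_eseriesr => i _.
  rewrite (@measure_split_nat _ _ _ P _ (count_rank \o Q m.+1 k2)); last 2 first.
  - by apply: measurableI; [exact: measurableI|rewrite rankE].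
  - by move=> j; rewrite rankE.
  rewrite integral_nneseries//; apply: eq_eseriesr => j _.
  rewrite !rankE -setIA (turn_split _ _ s1 mC Cs) two_site_law//.
  rewrite ge0_integralZl//.
  - by under eq_fun do rewrite EFinM; exact: emeasurable_funM.
  - by move=> w _; rewrite lee_fin mulr_ge0 ?site_mass_ge0.
  - by rewrite lee_fin back_weight_ge0.
pose F (z : g_sigma_algebraType (past m.+1) * R) : \bar R :=
  \sum_(0 <= b <oo) \sum_(0 <= f <oo) (turn_mass o (T m z.1) z.2 b f)%:E.
have step2 : P (C `&` turns m.+1) = \int[P]_(w in C) F (w, tau T m.+1 w).
  rewrite step1; apply: eq_integral => w; rewrite inE => /Cs[Xm es Q0 Qy Qo].
  have X1 : X m.+1 w = (x + s)%R by rewrite (gs_X server) Xm es.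
  have T1 : T m.+1 w = (T m w + tau T m.+1 w)%R by rewrite /tau /= addrC subrK.
  have xX : (x == x + s)%R = false.
    by rewrite -subr_eq0 opprD addrA subrr add0r; case: s1 => ->.
  have kX : (k2 == x + s)%R = false.
    by rewrite /k2 -subr_eq0 [(_ + s - _)%R]addrC addrA addNr add0r; case: s1 => ->.
  have site1 v : site x v w =
      if v is Some b then poisson_mass (lambda * tau T m.+1 w) b else 0%R.
    by rewrite /site /site_mass X1 xX Q0; case: v => // b; rewrite /= subn0.
  have site2 v : site k2 v w =
      if v is Some f then ahead_after o (T m w) (tau T m.+1 w) f else 0%R.
    rewrite /site /site_mass X1 kX Qo T1.
    have -> : (`|k2 - (x + s)| == 1)%R.
      by rewrite /k2 [(_ + s - _)%R]addrC addrA addNr add0r; case: s1 => ->.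
    by case: o {Cs Qo F} => [l|]; case: v.
  rewrite nneseriesS; last by move=> i; exact: nneseries_ge0.
  rewrite eseries0 ?add0e; last first.
    by move=> j _ _; rewrite /G site1 mul0r mule0.
  apply: eq_eseriesr => b _; rewrite nneseriesS//.
  rewrite {1}/G site2 mulr0 mule0 add0e; apply: eq_eseriesr => f _.
  by rewrite /G site1 site2 -EFinM.
have mpm k : measurable_fun setT (fun z : g_sigma_algebraType (past m.+1) * R =>
    poisson_mass (lambda * z.2) k).
  apply: (measurableT_comp (@measurable_poisson_mass R k)).
  by apply: measurable_funM => //; exact: measurable_snd.
have mTm : measurable_fun setT (fun z : g_sigma_algebraType (past m.+1) * R => T m z.1).
  have h : measurable_fun [set: g_sigma_algebraType (past m.+1)] (T m).
    by move=> _ B mB; rewrite setTI; exact: history_T.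
  exact: measurableT_comp h _.
have mpT k : measurable_fun setT (fun z : g_sigma_algebraType (past m.+1) * R =>
    poisson_mass (lambda * (T m z.1 + z.2)) k).
  apply: (measurableT_comp (@measurable_poisson_mass R k)).
  by apply: measurable_funM => //; apply: measurable_funD => //; exact: measurable_snd.
have mF : measurable_fun setT F.
  apply: ge0_emeasurable_sum => [b z _ _|b _].
    by apply: nneseries_ge0 => f _ _; rewrite lee_fin.
  apply: ge0_emeasurable_sum => [f z _ _|f _]; first by rewrite lee_fin.
  apply/measurable_EFinP; apply: measurable_funM => //; apply: measurable_funM => //.
  rewrite /ahead_after; case: o {Cs F step2} => [l|]//.
  by case: (leqP l f) => _; [exact: mpm|exact: measurable_cst].
have F0 z : 0 <= F z by do 2 (apply: nneseries_ge0 => ? _ _); rewrite lee_fin.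
have Cy : C `<=` chosen Q X m @^-1` [set y].
  by move=> w /Cs[Xm es _ Qy _]; rewrite /= /chosen (gs_X server) Xm es Qy.
rewrite step2 (service_freezing server sigmaE sigma_le1 mC Cy mF F0).
apply: eq_integral => w _; rewrite /F /=.
have mtp i : measurable_fun setT (fun t : R => \sum_(0 <= j <oo)
     (poisson_mass (2%:R * (lambda * t)) j * turn_prob R j i%:Z)%:E).
  apply: ge0_emeasurable_sum => [j t _ _|j _].
    by rewrite lee_fin mulr_ge0 ?poisson_mass_ge0//; have /andP[] := turn_prob_bound R j i%:Z.
  apply/measurable_EFinP; apply: measurable_funM => //.
  apply: (measurableT_comp (@measurable_poisson_mass R j)).
  by apply: measurable_funM => //; exact: measurable_funM.
have tp0 i t : 0 <= \sum_(0 <= j <oo)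
     (poisson_mass (2%:R * (lambda * t)) j * turn_prob R j i%:Z)%:E.
  apply: nneseries_ge0 => j _ _.
  by rewrite lee_fin mulr_ge0 ?poisson_mass_ge0//; have /andP[] := turn_prob_bound R j i%:Z.
transitivity (\int[sigma y]_t \sum_(0 <= i <oo) (ahead_mass o (T m w) i)%:E *
    \sum_(0 <= j <oo) (poisson_mass (2%:R * (lambda * t)) j * turn_prob R j i%:Z)%:E).
  apply: ge0_ae_eq_integral.
  - exact: measurableT.
  - have mpair : measurable_fun setT
        (fun t : R => ((w : g_sigma_algebraType (past m.+1)), t)).
      exact: measurable_pair1.
    exact: (measurableT_comp mF mpair).
  - apply: ge0_emeasurable_sum => [i t _ _|i _].
      by rewrite mule_ge0 ?lee_fin ?ahead_mass_ge0.
    exact: emeasurable_funM.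
  - by move=> t _; exact: (F0 (w, t)).
  - by move=> t _; apply: nneseries_ge0 => i _ _; rewrite mule_ge0 ?lee_fin ?ahead_mass_ge0.
  exists [set t | (t < 0)%R]; split => //.
    by rewrite -[X in measurable X]set_itvE; exact: measurable_itv.
  move=> t /= /not_implyP[_]; apply: contra_notP => /negP; rewrite -leNgt => t0.
  by apply: turn_mass_sum => //; exact: (gs_T_ge0 server).
rewrite integral_nneseries//; last 2 first.
- by move=> i; exact: emeasurable_funM.
- by move=> i t _; rewrite mule_ge0 ?lee_fin ?ahead_mass_ge0.
apply: eq_eseriesr => i _; rewrite ge0_integralZl ?sigma_race//.
by rewrite lee_fin ahead_mass_ge0.
Qed.

End TurningEvent.

(** * From averages to almost sure bounds, and the error made at a turn *)

Section ConditionalBounds.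
Local Open Scope ereal_scope.
Context (d : measure_display) (Om : measurableType d) (R : realType).
Variables (P : probability Om R) (G : set (set Om)).
Hypothesis sG : <<s G >> `<=` measurable.

(** Otherwise [Y] would exceed [c + k.+1%:R^-1], for some [k], on an event of
    positive probability contained in [E], where its average is too large. *)
Let ae_le_of_averages (Y : Om -> R) (E : set Om) (c : R) :
  (forall B, measurable B -> <<s G >> (Y @^-1` B)) ->
  P.-integrable setT (EFin \o Y) -> <<s G >> E ->
  (forall C, <<s G >> C -> C `<=` E -> \int[P]_(w in C) (Y w)%:E <= c%:E * P C) ->
  {ae P, forall w, E w -> (Y w <= c)%R}.
Proof.
move=> mY iY mE H.
have : {ae P, forall w, forall k : nat, ~ (E w /\ (c + k.+1%:R^-1 < Y w)%R)}.
  apply: ae_countable => k; pose C := E `&` Y @^-1` `](c + k.+1%:R^-1)%R, +oo[%classic.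
  have mC : <<s G >> C by apply: sigmaI => //; apply: mY; exact: measurable_itv.
  have mC' := sG mC.
  have PC : P C = 0.
    have Cfin : P C \is a fin_num by exact: fin_num_measure.
    have CE : C `<=` E by move=> w [].
    have H2 : (c + k.+1%:R^-1)%:E * P C <= \int[P]_(w in C) (Y w)%:E.
      rewrite -integral_cst//; apply: le_integral => //.
      - exact: finite_measure_integrable_cst.
      - exact: integrableS iY.
      - by move=> w; rewrite inE => -[_] /=; rewrite in_itv/= andbT lee_fin => /ltW.
    have := le_trans H2 (H C mC CE); rewrite -(fineK Cfin) -!EFinM lee_fin mulrDl gerDl.
    rewrite pmulr_rle0 ?invr_gt0// => p0; congr (_%:E); apply/eqP.
    by rewrite eq_le p0 fine_ge0.
  have := negligible_of_measure0 mC' PC; apply: filterS => w nC [Ew cY].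
  by apply: nC; split => //=; rewrite in_itv/= andbT.
apply: filterS => w H1 Ew; rewrite leNgt; apply/negP => /ltr_add_invr[k ck].
exact: (H1 k).
Qed.

Variables (A : set Om) (Y : Om -> R).
Hypothesis Y_version : is_cond_prob P <<s G >> A Y.

Lemma cond_prob_le (E : set Om) (c : R) : <<s G >> E ->
  (forall C, <<s G >> C -> C `<=` E -> P (A `&` C) <= c%:E * P C) ->
  {ae P, forall w, E w -> (Y w <= c)%R}.
Proof.
move=> mE H; have [mY iY YE] := Y_version.
by apply: ae_le_of_averages => // C mC CE; rewrite YE//; exact: H.
Qed.

Lemma cond_prob_ge (E : set Om) (c : R) : <<s G >> E ->
  (forall C, <<s G >> C -> C `<=` E -> c%:E * P C <= P (A `&` C)) ->
  {ae P, forall w, E w -> (c <= Y w)%R}.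
Proof.
move=> mE H; have [mY iY YE] := Y_version.
have : {ae P, forall w, E w -> (- Y w <= - c)%R}.
  apply: (ae_le_of_averages (Y := fun w => - Y w)%R) => //.
  - move=> B mB.
    have -> : (fun w => - Y w)%R @^-1` B = Y @^-1` (-%R @^-1` B) by [].
    by apply: mY; rewrite -[_ @^-1` _]setTI; exact: oppr_measurable.
  - exact: (integrableN iY).
  - move=> C mC CE.
    have iYC : P.-integrable C (EFin \o Y) by apply: integrableS iY => //; exact: sG.
    have -> : \int[P]_(w in C) (- Y w)%:E = - \int[P]_(w in C) (EFin \o Y) w.
      by rewrite -(integralN (integrable_add_def (sG mC) iYC)).
    rewrite -[\int[P]_(w in C) _]/(\int[P]_(w in C) (Y w)%:E).
    by rewrite YE// EFinN mulNe leeN2; exact: H.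
by apply: filterS => w H1 Ew; rewrite -lerN2; exact: H1.
Qed.

End ConditionalBounds.

Section TurnEstimate.
Local Open Scope ereal_scope.
Context (R : realType) (lambda : R).
Hypothesis lambda_gt0 : (0 < lambda)%R.

(** Bound for the mean distance between the queue being served, of length [y],
    and the queue ahead. *)
Definition mean_gap (delta : R) (o : option nat) (y : nat) (t : R) : R :=
  if o is Some l then `|l%:R - y%:R|%R
  else (`|lambda * t - y%:R| + delta + lambda * t / delta)%R.

Definition turn_error (delta : R) (o : option nat) (y : nat) (t : R) : R :=
  (3%:R * (mean_gap delta o y t + 3%:R * lambda) / y%:R)%R.

Lemma ahead_mass_sum o t : \sum_(0 <= i <oo) (ahead_mass lambda o t i)%:E = 1.
Proof.
case: o => [l|] /=; last exact: poisson_mass_sum.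
rewrite (@nneseriesD1 _ _ l)//=.
by rewrite eqxx eseries0 ?adde0// => i _ /= /negbTE ->.
Qed.

(** For a queue not inspected yet, [|i - y|] is at most the sum of
    [|lambda * t - y|] and of [|i - lambda * t|]; the latter is split by the
    inequality [|z| <= delta + z ^ 2 / delta] to bring in the variance. *)
Lemma ahead_mass_gap delta o y t : (0 <= t)%R -> (0 < delta)%R ->
  \sum_(0 <= i <oo) (ahead_mass lambda o t i * `|i%:R - y%:R|)%:E <=
  (mean_gap delta o y t)%:E.
Proof.
move=> t0 d0; case: o => [l|] /=.
  rewrite (@nneseriesD1 _ _ l)//=.
  by rewrite eqxx mul1r eseries0 ?adde0// => i _ /= /negbTE ->; rewrite mul0r.
set k := (lambda * t)%R; have k0 : (0 <= k)%R by rewrite mulr_ge0// ltW.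
apply: (@le_trans _ _ (\sum_(0 <= i <oo) ((`|k - y%:R| + delta)%:E * (poisson_mass k i)%:E +
   (delta^-1)%:E * ((i%:R - k) ^+ 2 * poisson_mass k i)%:E))).
  apply: lee_nneseries => [i _ _|i _]; first by rewrite lee_fin mulr_ge0 ?poisson_mass_ge0.
  rewrite -!EFinM -EFinD lee_fin mulrA -mulrDl mulrC ler_wpM2r ?poisson_mass_ge0//.
  have -> : (i%:R - y%:R = (k - y%:R) + (i%:R - k) :> R)%R by ring.
  rewrite -[leRHS]addrA; apply: le_trans (ler_normD _ _) _; rewrite lerD2l.
  set z := (i%:R - k)%R; rewrite -(ler_pM2l d0) mulrDr mulrA divff ?gt_eqF// mul1r.
  rewrite -real_normK ?num_real//; have := normr_ge0 z; move: `|z|%R => u u0.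
  nra.
rewrite nneseriesD; last 2 first.
- by move=> i _ _; rewrite mule_ge0 ?lee_fin ?poisson_mass_ge0// addr_ge0// ltW.
- by move=> i _ _; rewrite mule_ge0 ?lee_fin ?invr_ge0 ?(ltW d0)// mulr_ge0 ?sqr_ge0 ?poisson_mass_ge0.
rewrite !nneseriesZl; last 2 first.
- by move=> i _; rewrite lee_fin mulr_ge0 ?sqr_ge0 ?poisson_mass_ge0.
- by move=> i _; rewrite lee_fin poisson_mass_ge0.
by rewrite poisson_mass_sum poisson_variance// mule1 -EFinM -EFinD lee_fin [(_^-1 * _)%R]mulrC.
Qed.

Variable tb : nat -> nat -> \bar R.
Hypothesis tb_ge0 : forall i y, 0 <= tb i y.
Hypothesis tb_quarter : forall l y, (0 < y)%N ->
  tb l y <= (1 / 4%:R + 3%:R * (`|l%:R - y%:R| + 3%:R * lambda) / y%:R)%:E /\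
  (1 / 4%:R)%:E <= tb l y + (3%:R * (`|l%:R - y%:R| + 3%:R * lambda) / y%:R)%:E.

Let affine_mean delta o y t (a : R) : (0 <= t)%R -> (0 < delta)%R -> (0 < y)%N ->
  (0 <= a)%R ->
  \sum_(0 <= i <oo) (ahead_mass lambda o t i)%:E *
     (a + 3%:R * (`|i%:R - y%:R| + 3%:R * lambda) / y%:R)%:E <=
  (a + turn_error delta o y t)%:E.
Proof.
move=> t0 d0 y0 a0; have Y0 : (0 < y%:R :> R)%R by rewrite ltr0n.
have l0 := ltW lambda_gt0.
have am0 := ahead_mass_ge0 lambda o t.
have c0 : (0 <= 3%:R / y%:R :> R)%R by rewrite divr_ge0.
have b0 : (0 <= a + 3%:R * (3%:R * lambda) / y%:R)%R.
  by rewrite addr_ge0// divr_ge0// !mulr_ge0.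
rewrite (eq_eseriesr (g := fun i => (a + 3%:R * (3%:R * lambda) / y%:R)%:E * (ahead_mass lambda o t i)%:E +
   (3%:R / y%:R)%:E * (ahead_mass lambda o t i * `|i%:R - y%:R|)%:E)); last first.
  by move=> i _; rewrite -!EFinM -EFinD; congr (_%:E); ring.
rewrite nneseriesD; last 2 first.
- by move=> i _ _; rewrite mule_ge0 ?lee_fin.
- by move=> i _ _; rewrite mule_ge0 ?lee_fin// mulr_ge0.
rewrite !nneseriesZl; last 2 first.
- by move=> i _; rewrite lee_fin mulr_ge0.
- by move=> i _; rewrite lee_fin.
rewrite ahead_mass_sum mule1.
have -> : (a + turn_error delta o y t)%:E =
   (a + 3%:R * (3%:R * lambda) / y%:R)%:E + (3%:R / y%:R)%:E * (mean_gap delta o y t)%:E.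
  by rewrite -EFinM -EFinD /turn_error; congr (_%:E); ring.
by rewrite leeD2l// lee_wpmul2l ?lee_fin//; exact: ahead_mass_gap.
Qed.

Lemma turn_mean_quarter delta o y t : (0 <= t)%R -> (0 < delta)%R -> (0 < y)%N ->
  \sum_(0 <= i <oo) (ahead_mass lambda o t i)%:E * tb i y <=
    (1 / 4%:R + turn_error delta o y t)%:E /\
  (1 / 4%:R)%:E <= \sum_(0 <= i <oo) (ahead_mass lambda o t i)%:E * tb i y +
    (turn_error delta o y t)%:E.
Proof.
move=> t0 d0 y0; have am0 := ahead_mass_ge0 lambda o t.
have l0 := ltW lambda_gt0.
split.
  apply: le_trans (affine_mean o t0 d0 y0 _); last by rewrite divr_ge0.
  apply: lee_nneseries => [i _ _|i _]; first by rewrite mule_ge0 ?lee_fin.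
  by rewrite lee_wpmul2l ?lee_fin//; have [] := tb_quarter i y0.
have := affine_mean o t0 d0 y0 (lexx 0%R); rewrite add0r => H.
apply: le_trans (leeD2l _ H).
have e0 i : (0 <= 0 + 3%:R * (`|i%:R - y%:R| + 3%:R * lambda) / y%:R :> R)%R.
  by rewrite add0r divr_ge0// mulr_ge0// addr_ge0// mulr_ge0.
rewrite -nneseriesD; last 2 first.
- by move=> i _ _; rewrite mule_ge0 ?lee_fin.
- by move=> i _ _; rewrite mule_ge0 ?lee_fin.
have -> : (1 / 4%:R)%:E = \sum_(0 <= i <oo) (1 / 4%:R)%:E * (ahead_mass lambda o t i)%:E.
  by rewrite nneseriesZl ?ahead_mass_sum ?mule1// => i _; rewrite lee_fin.
apply: lee_nneseries => [i _ _|i _]; first by rewrite mule_ge0 ?lee_fin ?divr_ge0.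
rewrite -ge0_muleDr ?lee_fin// muleC lee_wpmul2l ?lee_fin//.
by rewrite add0r; have [] := tb_quarter i y0.
Qed.

End TurnEstimate.

(** * Almost sure estimate of the conditional probability of a turn *)

Section TurnProbability.
Local Open Scope ereal_scope.
Context (R : realType) (lambda : R) (zeta : nat -> set R -> \bar R).
Hypothesis lambda_gt0 : (0 < lambda)%R.
Context (d : measure_display) (Om : measurableType d) (P : probability Om R).
Variables (Q : nat -> int -> Om -> option nat) (X : nat -> Om -> int).
Variables (T : nat -> Om -> R) (xi : nat -> Om -> int).
Hypothesis server : greedy_server Q X T xi P lambda zeta.
Variable sigma : nat -> {measure set R -> \bar R}.
Hypothesis sigmaE : forall y B, measurable B ->
  sigma y B = service_law lambda zeta y B.
Hypothesis sigma_le1 : forall y, sigma y setT <= 1.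
Hypothesis sigma_neg : forall y, sigma y [set t | (t < 0)%R] = 0.
Variable tb : nat -> nat -> \bar R.
Hypothesis tb_ge0 : forall i y, 0 <= tb i y.
Hypothesis sigma_race : forall y i, \int[sigma y]_t \sum_(0 <= j <oo)
     (poisson_mass (2%:R * (lambda * t)) j * turn_prob R j i%:Z)%:E = tb i y.
Hypothesis tb_quarter : forall l y, (0 < y)%N ->
  tb l y <= (1 / 4%:R + 3%:R * (`|l%:R - y%:R| + 3%:R * lambda) / y%:R)%:E /\
  (1 / 4%:R)%:E <= tb l y + (3%:R * (`|l%:R - y%:R| + 3%:R * lambda) / y%:R)%:E.

Let past := past_events Q X T xi.

Lemma history_situation m x s y o :
  history Q X T xi m (situation Q X xi m x s y o).
Proof.
have mX : discrete_measurable (past m.+1) (X m) by exact: discrete_X.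
have me : discrete_measurable (past m.+1) (eta Q X xi m.+1) by exact: discrete_eta.
have mQ k : discrete_measurable (past m.+1) (Q m k) by exact: discrete_Q.
have mp := discrete_measurable_pair (discrete_measurable_pair
  (discrete_measurable_pair (discrete_measurable_pair mX me) (mQ x))
  (mQ (x + s)%R)) (mQ (x + s + s)%R).
have := mp [set (x, s, Some 0%N, Some y, o)].
congr (history Q X T xi m _); apply/seteqP; split => w /=.
  by case=> e1 e2 e3 e4 e5; split.
by case=> -> -> -> -> ->.
Qed.

Lemma measurable_turn_error delta o y :
  measurable_fun setT (turn_error lambda delta o y).
Proof.
rewrite /turn_error /mean_gap; case: o => [l|]; first exact: measurable_cst.
apply: measurable_funM; last exact: measurable_cst.
apply: measurable_funM; first exact: measurable_cst.
apply: measurable_funD; last exact: measurable_cst.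
have ml : measurable_fun setT (fun t : R => lambda * t)%R by exact: measurable_funM.
apply: measurable_funD; last exact: measurable_funM.
apply: measurable_funD; last exact: measurable_cst.
by apply: measurableT_comp => //; exact: measurable_funB.
Qed.

(** On each of the countably many situations, [q] is compared with its averages
    over all events of the past contained in the situation. *)
Lemma cond_turn_situation m (q : Om -> R) delta eps x s y o : (0 < delta)%R ->
  s = 1%R \/ s = (-1)%R -> (0 < y)%N ->
  is_cond_prob P (history Q X T xi m) (turns Q X xi m.+1) q ->
  {ae P, forall w, situation Q X xi m x s y o w ->
    (turn_error lambda delta o y (T m w) <= eps)%R -> (`|q w - 1 / 4%:R| <= eps)%R}.
Proof.
move=> d0 s1 y0 qv.
pose E := situation Q X xi m x s y o `&`
  T m @^-1` (turn_error lambda delta o y @^-1` `]-oo, eps]%classic).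
have mE : history Q X T xi m E.
  apply: sigmaI; first exact: history_situation.
  apply: history_T => //; rewrite -[_ @^-1` _]setTI.
  by apply: measurable_turn_error => //; exact: measurable_itv.
have sub := history_measurable server (m := m).
have key C : history Q X T xi m C -> C `<=` E ->
    P (turns Q X xi m.+1 `&` C) <= (1 / 4%:R + eps)%:E * P C /\
    (1 / 4%:R)%:E * P C <= P (turns Q X xi m.+1 `&` C) + eps%:E * P C.
  move=> mC CE; have mC' := sub _ mC.
  have Cs : C `<=` situation Q X xi m x s y o by move=> w /CE[].
  rewrite setIC (turn_law lambda_gt0 server sigmaE sigma_le1 sigma_neg sigma_race s1 mC Cs).
  pose h w := \sum_(0 <= i <oo) (ahead_mass lambda o (T m w) i)%:E * tb i y.
  have h0 w : 0 <= h w.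
    by apply: nneseries_ge0 => i _ _; rewrite mule_ge0 ?lee_fin ?ahead_mass_ge0.
  have mh : measurable_fun C h.
    apply: (measurable_funS measurableT) => //.
    apply: ge0_emeasurable_sum => [i w _ _|i _].
      by rewrite mule_ge0 ?lee_fin ?ahead_mass_ge0.
    apply: emeasurable_funM => //; apply/measurable_EFinP.
    case: (o) => [l|] //=; apply: (measurableT_comp (@measurable_poisson_mass R i)).
    by apply: measurable_funM => //; exact: (measurable_T server).
  have bound w : C w -> h w <= (1 / 4%:R + eps)%:E /\ (1 / 4%:R)%:E <= h w + eps%:E.
    move=> /CE[_] /=; rewrite in_itv/= => e1.
    have [H1 H2] := turn_mean_quarter lambda_gt0 tb_ge0 tb_quarter o
      (gs_T_ge0 server m w) d0 y0.
    split; first by apply: le_trans H1 _; rewrite lee_fin lerD2l.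
    by apply: le_trans H2 _; rewrite leeD2l// lee_fin.
  have [-> |C0] := eqVneq C set0.
    by rewrite integral_set0 measure0 !mule0 adde0.
  have eps0 : (0 <= eps)%R.
    have /set0P[w /CE[_] /=] := C0; rewrite in_itv/=; apply: le_trans.
    rewrite /turn_error divr_ge0// mulr_ge0// addr_ge0//; last by rewrite mulr_ge0// ltW.
    rewrite /mean_gap; case: (o) => // .
    have lT : (0 <= lambda * T m w)%R by rewrite mulr_ge0 ?(ltW lambda_gt0)// (gs_T_ge0 server).
    by rewrite !addr_ge0// ?divr_ge0// ltW.
  split.
    rewrite -integral_cst//; apply: ge0_le_integral => //.
    - by move=> w _; exact: (h0 w).
    - by move=> w Cw; have [] := bound w Cw.
  rewrite -!integral_cst// -ge0_integralD//.
  - apply: ge0_le_integral => //.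
    + by move=> w _; rewrite lee_fin.
    + exact: emeasurable_funD.
    + by move=> w Cw; have [] := bound w Cw.
  - by move=> w _; exact: (h0 w).
have up : {ae P, forall w, E w -> (q w <= 1 / 4%:R + eps)%R}.
  apply: (cond_prob_le sub qv mE) => C mC CE; exact: (key C mC CE).1.
have lo : {ae P, forall w, E w -> (1 / 4%:R - eps <= q w)%R}.
  apply: (cond_prob_ge sub qv mE) => C mC CE.
  have := (key C mC CE).2; have Cfin : P C \is a fin_num.
    by apply: fin_num_measure; exact: sub.
  rewrite -(fineK Cfin) -!EFinM -leeBlDr// -EFinB mulrBl; exact.
move: up lo; apply: filterS2 => w u l sw te.
have Ew : E w by split => //=; rewrite in_itv.
by have := u Ew; have := l Ew; rewrite ler_norml; lra.
Qed.

(** A regular path is at each departure in one of countably many situations. *)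
Lemma cond_turn_quarter m (q : Om -> R) delta eps : (0 < delta)%R -> (0 < m)%N ->
  is_cond_prob P (history Q X T xi m) (turns Q X xi m.+1) q ->
  {ae P, forall w, regular_path Q X T xi w -> (0 < chosen Q X m w)%N ->
    (turn_error lambda delta
       (Q m (X m.+1 w + eta Q X xi m.+1 w)%R w) (chosen Q X m w) (T m w) <= eps)%R ->
    (`|q w - 1 / 4%:R| <= eps)%R}.
Proof.
move=> d0 m0 qv.
have : {ae P, forall w, forall v : int * bool * nat * option nat,
    let s : int := (if v.1.1.2 then 1 else -1)%R in (0 < v.1.2)%N ->
    situation Q X xi m v.1.1.1 s v.1.2 v.2 w ->
    (turn_error lambda delta v.2 v.1.2 (T m w) <= eps)%R -> (`|q w - 1 / 4%:R| <= eps)%R}.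
  apply: ae_countable => -[[[x b] y] o] /=.
  case: (posnP y) => [->|y0]; first by apply: aeW => w.
  have s1 : (if b then 1 else -1 : int)%R = 1%R \/ (if b then 1 else -1 : int)%R = (-1)%R.
    by case: b; [left|right].
  by have := cond_turn_situation eps x o d0 s1 y0 qv; apply: filterS => w H _.
apply: filterS => w H reg y0 te.
have es := eta_sign m reg; have X1 := gs_X server m w.
pose b := (eta Q X xi m.+1 w == 1)%R.
have bE : (if b then 1 else -1)%R = eta Q X xi m.+1 w.
  by rewrite /b; case: es => ->.
apply: (H (X m w, b, chosen Q X m w, Q m (X m.+1 w + eta Q X xi m.+1 w)%R w)) => //=.
rewrite bE; split => //.
- exact: (rp_empty reg).
- rewrite /chosen X1; case: m m0 {H qv te y0 b bE X1} es => // m _ es.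
  have := rp_neighbour reg (m := m) (k := (X m.+1 w + eta Q X xi m.+2 w)%R).
  rewrite addrC addKr => /(_ _); case: (Q m.+1 _ w) => // H.
  have /H/eqP : `|eta Q X xi m.+2 w|%R = 1%R by case: es => ->; rewrite ?normrN normr1.
  by [].
- by rewrite X1.
Qed.

End TurnProbability.

(** * Deviations of the arrivals *)

Section Deviations.
Local Open Scope ereal_scope.
Context (R : realType) (lambda : R) (zeta : nat -> set R -> \bar R).
Hypothesis lambda_gt0 : (0 < lambda)%R.
Context (d : measure_display) (Om : measurableType d) (P : probability Om R).
Variables (Q : nat -> int -> Om -> option nat) (X : nat -> Om -> int).
Variables (T : nat -> Om -> R) (xi : nat -> Om -> int).
Hypothesis server : greedy_server Q X T xi P lambda zeta.

Let past := past_events Q X T xi.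

(** Service lengths, at least [theta], during which a number of arrivals equal
    to [c] would be off its mean by a factor [delta] of the length. *)
Let window (delta theta c : R) : set R :=
  [set t | (theta <= t)%R /\ (delta * t <= `|c - lambda * t|)%R].

Let measurable_window delta theta c : measurable (window delta theta c).
Proof.
rewrite (_ : window _ _ _ = `[theta, +oo[%classic `&`
  ((fun t => delta * t - `|c - lambda * t|)%R @^-1` `]-oo, 0%R]%classic)); last first.
  by apply/seteqP; split => t /=; rewrite !in_itv/= andbT subr_le0.
apply: measurableI; first exact: measurable_itv.
rewrite -[X in measurable X]setTI.
have ml (a : R) : measurable_fun setT (fun t : R => a * t)%R.
  by exact: measurable_funM.
have mn : measurable_fun setT (fun t : R => `|c - lambda * t|)%R.
  apply: measurableT_comp => //; apply: measurable_funB => //.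
have := measurable_funB (ml delta) mn.
by apply => //; exact: measurable_itv.
Qed.

Let arrivals_off (delta theta : R) (u v : option nat) (k x : int) (t T' : R) : Prop :=
  match u, v with
  | Some a, Some b => k != x /\ window delta theta (b%:R - a%:R) t
  | None, Some b => k != x /\ window delta theta b%:R T'
  | _, None => False
  end.

(** The arrivals at the site [k] during the [j.+1]-st service deviate from their
    mean; for a site inspected for the first time, all arrivals are counted. *)
Definition deviation j k (delta theta : R) : set Om :=
  [set w | arrivals_off delta theta (Q j k w) (Q j.+1 k w) k
             (X j.+1 w) (tau T j.+1 w) (T j.+1 w)].

Let window_sum (delta theta t : R) : (0 < delta)%R -> (0 < theta)%R ->
  \sum_(0 <= c <oo) (\1_(window delta theta c%:R) t * poisson_mass (lambda * t) c)%:E <=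
  (lambda / (delta ^+ 2 * theta))%:E.
Proof.
move=> d0 th0; have c0 : (0 <= lambda / (delta ^+ 2 * theta))%R.
  by rewrite divr_ge0 ?mulr_ge0 ?sqr_ge0 ?ltW.
have [tt|tt] := leP theta t; last first.
  rewrite eseries0 ?lee_fin// => c _ _; rewrite indicE memNset ?mul0r//.
  by case; rewrite leNgt tt.
have t0 : (0 < t)%R by exact: lt_le_trans tt.
apply: (@le_trans _ _ ((lambda * t) / (delta * t) ^+ 2)%:E); last first.
  rewrite lee_fin [X in (X <= _)%R](_ : _ = lambda / (delta ^+ 2 * t))%R; last first.
    by field; rewrite !gt_eqF.
  rewrite ler_wpM2l ?(ltW lambda_gt0)// lef_pV2 ?posrE ?mulr_gt0 ?exprn_gt0//.
  by rewrite ler_pM2l ?exprn_gt0.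
apply: le_trans (poisson_chebyshev (H := fun c => (delta * t <= `|c%:R - lambda * t|)%R) _ _ _); last first.
- by [].
- by rewrite mulr_gt0.
- by rewrite mulr_ge0// ltW.
apply: lee_nneseries => [c _ _|c _]; first by rewrite lee_fin mulr_ge0 ?poisson_mass_ge0// indicE.
rewrite lee_fin ler_wpM2r ?poisson_mass_ge0// indicE ler_nat.
by case: (boolP (t \in _)) => //; rewrite inE => -[_ ->].
Qed.

Let measurable_off j k delta theta v :
  history_with_time Q X T xi j [set w | arrivals_off delta theta (Q j k w) v k
             (X j.+1 w) (tau T j.+1 w) (T j.+1 w)].
Proof.
have mp : discrete_measurable (past j.+1) (fun w => (Q j k w, X j.+1 w)).
  by apply: discrete_measurable_pair; [exact: discrete_Q|exact: (discrete_X1 server)].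
case: v => [b|]; last first.
  have := history_sub_time (mp set0); congr history_with_time.
  by apply/seteqP; split => w //=; rewrite /arrivals_off; case: (Q j k w).
rewrite (_ : [set w | _] = \bigcup_u
   (((fun w => (Q j k w, X j.+1 w)) @^-1` [set z | z.1 = u /\ k != z.2]) `&`
    (if u is Some a then tau T j.+1 @^-1` window delta theta (b%:R - a%:R)
     else T j.+1 @^-1` window delta theta b%:R))).
  apply: sigma_bigcup => u; apply: sigmaI.
    by apply: history_sub_time; exact: mp.
  case: u => [a|]; first by apply: time_tau => //; exact: measurable_window.
  by apply: time_T => //; exact: measurable_window.
apply/seteqP; split => w /=; rewrite /arrivals_off.
  by move=> H; exists (Q j k w) => //=; case: (Q j k w) H => [a|] //= [].
by move=> [u _] /=; case: u => [a|] [[-> H]].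
Qed.

Lemma measurable_deviation j k delta theta : measurable (deviation j k delta theta).
Proof.
rewrite (_ : deviation _ _ _ _ = \bigcup_v (Q j.+1 k @^-1` [set v] `&`
  [set w | arrivals_off delta theta (Q j k w) v k
             (X j.+1 w) (tau T j.+1 w) (T j.+1 w)])).
  apply: countable_bigcupT_measurable => // v; apply: measurableI.
    by apply: (history_measurable server (m := j.+1)); exact: discrete_Q.
  by apply: (time_measurable server (m := j)); exact: measurable_off.
by apply/seteqP; split => [w H|w [v _] [/= <-]//]; exists (Q j.+1 k w).
Qed.

(** Chebyshev's inequality for the arrivals at one site. *)
Lemma deviation_bound j k (delta theta : R) : (0 < delta)%R -> (0 < theta)%R ->
  P (deviation j k delta theta) <= (lambda / (delta ^+ 2 * theta))%:E.
Proof.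
move=> d0 th0; have c0 : (0 <= lambda / (delta ^+ 2 * theta))%R.
  by rewrite divr_ge0 ?mulr_ge0 ?sqr_ge0 ?ltW.
apply: (@le_trans _ _ ((lambda / (delta ^+ 2 * theta))%:E * P setT)); last first.
  by rewrite -[leRHS]mule1 lee_wpmul2l ?lee_fin ?probability_le1.
have hT : history_with_time Q X T xi j setT by exact: sigmaT.
rewrite -[X in P X <= _]setTI.
apply: (site_bound (k := k) (Bad := fun v => [set w | arrivals_off delta theta
  (Q j k w) v k (X j.+1 w) (tau T j.+1 w) (T j.+1 w)]) server hT).
  by move=> v; exact: measurable_off.
move=> w _; have s0 i : (0 <= (\1_([set w0 | arrivals_off delta theta (Q j k w0) (nth_count i) k
     (X j.+1 w0) (tau T j.+1 w0) (T j.+1 w0)]) w * site_mass lambda (Q j k w)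
     (X j.+1 w) (tau T j.+1 w) (T j.+1 w) k (nth_count i))%:E).
  by rewrite lee_fin mulr_ge0 ?site_mass_ge0// indicE.
rewrite nneseriesS// [X in X + _](_ : _ = 0) ?add0e; last first.
  rewrite indicE memNset ?mul0r// => /=.
  by rewrite /arrivals_off; case: (Q j k w) => [a|] [].
have [kx|kx] := eqVneq k (X j.+1 w).
  rewrite eseries0 ?lee_fin// => b _ _; rewrite indicE memNset ?mul0r// => /=.
  by rewrite /arrivals_off kx eqxx; case: (Q j _ w) => [a|] [].
rewrite /site_mass (negbTE kx).
case Qw : (Q j k w) => [a|].
  have := window_sum (tau T j.+1 w) d0 th0; apply: le_trans.
  rewrite (nneseries_split 0 a)//=; last by move=> b _; move: (s0 b.+1); rewrite /site_mass (negbTE kx) Qw.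
  rewrite add0n big_nat big1 ?add0e; last first.
    by move=> b /andP[_ ba]; rewrite leqNgt ba mulr0.
  rewrite -nneseries_addn; last by move=> b; move: (s0 b.+1); rewrite /site_mass (negbTE kx) Qw.
  apply: lee_nneseries => [b _ _|b _].
    by move: (s0 (b + a)%N.+1); rewrite /site_mass (negbTE kx) Qw.
  rewrite leq_addl addnK lee_fin ler_wpM2r ?poisson_mass_ge0// !indicE ler_nat.
  case: (boolP (w \in _)) => //; rewrite inE /= Qw => -[_].
  by rewrite natrD addrK => H; rewrite mem_set.
have := window_sum (T j.+1 w) d0 th0; apply: le_trans.
apply: lee_nneseries => [b _ _|b _].
  by move: (s0 b.+1); rewrite /site_mass (negbTE kx) Qw.
case: ifP => _; last by rewrite mulr0 lee_fin mulr_ge0 ?poisson_mass_ge0// indicE.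
rewrite lee_fin ler_wpM2r ?poisson_mass_ge0// !indicE ler_nat.
by case: (boolP (w \in _)) => //; rewrite inE /= Qw => -[_ H]; rewrite mem_set.
Qed.

Lemma no_deviation_inspected j k delta theta w a b : ~ deviation j k delta theta w ->
  Q j k w = Some a -> Q j.+1 k w = Some b -> k != X j.+1 w ->
  (theta <= tau T j.+1 w)%R ->
  (`|b%:R - a%:R - lambda * tau T j.+1 w| < delta * tau T j.+1 w)%R.
Proof.
rewrite /deviation /= => nD Qa Qb kx tt; rewrite Qa Qb in nD.
by rewrite ltNge; apply/negP => H; apply: nD.
Qed.

Lemma no_deviation_fresh j k delta theta w b : ~ deviation j k delta theta w ->
  Q j k w = None -> Q j.+1 k w = Some b -> k != X j.+1 w -> (theta <= T j.+1 w)%R ->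
  (`|b%:R - lambda * T j.+1 w| < delta * T j.+1 w)%R.
Proof.
rewrite /deviation /= => nD Qa Qb kx tt; rewrite Qa Qb in nD.
by rewrite ltNge; apply/negP => H; apply: nD.
Qed.

End Deviations.

(** * Only finitely many spoiling events occur *)

Section BorelCantelli.
Local Open Scope ereal_scope.
Context (d : measure_display) (Om : measurableType d) (R : realType).
Variable P : probability Om R.

Let geometric_sum (r : R) n : (0 <= r < 1)%R ->
  (\sum_(k < n) r ^+ k <= (1 - r)^-1)%R.
Proof.
move=> /andP[r0 r1]; have r10 : (0 < 1 - r)%R by rewrite subr_gt0.
rewrite -[leRHS]mul1r ler_pdivlMr// mulrC.
have -> : ((1 - r) * \sum_(k < n) r ^+ k = 1 - r ^+ n)%R.
  by elim: n => [|n IH]; [rewrite big_ord0 expr0; ring|rewrite big_ord_recr/= mulrDr IH exprS; ring].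
by rewrite gerBl exprn_ge0.
Qed.

Let summable_geometric (f : nat -> \bar R) (a r a' r' : R) :
  (0 <= r < 1)%R -> (0 <= r' < 1)%R -> (0 <= a)%R -> (0 <= a')%R ->
  (forall m, 0 <= f m) -> (forall m, f m <= (a * r ^+ m + a' * r' ^+ m)%:E) ->
  \sum_(0 <= m <oo) f m < +oo.
Proof.
move=> r1 r1' a0 a0' f0 fle.
apply: (@le_lt_trans _ _ (a / (1 - r) + a' / (1 - r'))%:E); last exact: ltry.
apply: lime_le; first exact: is_cvg_nneseries.
apply: nearW => n; rewrite big_mkord.
apply: (@le_trans _ _ (\sum_(k < n) (a * r ^+ k + a' * r' ^+ k)%:E)).
  by apply: lee_sum => k _; exact: fle.
rewrite sumEFin lee_fin big_split/= -!mulr_sumr.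
by rewrite lerD// ler_wpM2l// geometric_sum.
Qed.

Lemma borel_cantelli_geometric (F : nat -> set Om) (N : nat) (a r a' r' : R) :
  (0 <= r < 1)%R -> (0 <= r' < 1)%R -> (0 <= a)%R -> (0 <= a')%R ->
  (forall m, measurable (F m)) ->
  (forall m, (N <= m)%N -> P (F m) <= (a * r ^+ m + a' * r' ^+ m)%:E) ->
  {ae P, forall w, \forall m \near \oo, ~ F m w}.
Proof.
move=> r1 r1' a0 a0' mF PF; pose G m := if (N <= m)%N then F m else set0.
have mG m : measurable (G m) by rewrite /G; case: ifP.
have : P (lim_sup_set G) = 0.
  apply: lim_sup_set_cvg0 => //; apply: (summable_geometric r1 r1' a0 a0') => m.
    exact: measure_ge0.
  rewrite /G; case: ifP => [/PF//|_]; rewrite measure0 lee_fin.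
  have [/andP[r0 _] /andP[r0' _]] := (r1, r1').
  by rewrite addr_ge0// mulr_ge0// exprn_ge0.
have mlim : measurable (lim_sup_set G).
  by apply: bigcap_measurable => [|n _]; [exists 0%N|apply: bigcup_measurable].
move=> /(negligible_of_measure0 mlim); apply: filterS => w nG.
have [n /= Hn] : exists n, ~ (\bigcup_(j >= n) G j) w.
  by apply/existsNP => H; apply: nG => n _; exact: H.
exists (maxn n N) => //= m /=; rewrite geq_max => /andP[nm Nm] Fm.
by apply: Hn; exists m => //=; rewrite /G Nm.
Qed.

End BorelCantelli.

(** The server moves by one unit at each departure, so these sites include all
    those that it has met by the [m]-th one, with some margin. *)
Definition nearby m (i : nat) : int := (i%:Z - m.+4%:Z)%R.

Lemma nearbyP m k : (`|k| <= m.+4%:Z)%R -> exists2 i, (i < m.*2 + 9)%N & nearby m i = k.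
Proof.
move=> km; have k0 : (0 <= k + m.+4%:Z)%R by move: km; rewrite ler_norml => /andP[]; lia.
exists `|(k + m.+4%:Z)%R|%N.
  by move: km; rewrite ler_norml => /andP[]; lia.
by rewrite /nearby gez0_abs// addrK.
Qed.

Section UnusualEvents.
Local Open Scope ereal_scope.
Context (R : realType) (lambda : R) (zeta : nat -> set R -> \bar R).
Hypothesis lambda_gt0 : (0 < lambda)%R.
Context (d : measure_display) (Om : measurableType d) (P : probability Om R).
Variables (Q : nat -> int -> Om -> option nat) (X : nat -> Om -> int).
Variables (T : nat -> Om -> R) (xi : nat -> Om -> int).
Hypothesis server : greedy_server Q X T xi P lambda zeta.
Variable sigma : nat -> {measure set R -> \bar R}.
Hypothesis sigmaE : forall y B, measurable B ->
  sigma y B = service_law lambda zeta y B.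
Hypothesis sigma_le1 : forall y, sigma y setT <= 1.
Hypothesis sigma_laplace : forall y (x : R), (0 < x < 1)%R ->
  \int[sigma y]_t (expR (- (lambda * x ^+ 2 / (1 - x)) * t))%:E <=
  ((1 - x) ^+ y * expR (- (lambda * x)))%:E.
Hypothesis ae_regular : {ae P, forall w, regular_path Q X T xi w}.

Let scale m : R := (2%:R ^+ m)%R.

(** Arrivals at a nearby site that are far from their mean, in one of three
    senses: relatively to a long service by a constant factor, by the factor
    [scale m] during any service, by the factor [(scale m)^-1] during a very
    long one. *)
Definition odd_arrivals m j i : set Om :=
  deviation lambda Q X T j (nearby m i) (lambda / 2%:R) (scale m ^+ 4) `|`
  deviation lambda Q X T j (nearby m i) (scale m) 1 `|`
  deviation lambda Q X T j (nearby m i) (scale m)^-1 (scale m ^+ 6).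

(** A service that is not hasty is at least [scale m ^ 2] times as long as the
    previous one, provided that the arrivals at the queue left behind are not
    odd. *)
Definition hasty m j : set Om :=
  [set w | (lambda / 2%:R * scale m ^+ 4 <= (chosen Q X j w)%:R)%R /\
    (tau T j.+1 w < 2%:R / lambda * scale m ^+ 2 * (chosen Q X j w)%:R)%R].

Definition short_service m : set Om := [set w | (tau T m w < scale m ^+ 6)%R].

(** The events that may spoil the comparison of the queues met at the [m]-th
    departure. *)
Definition unusual m : set Om := short_service m `|`
  (\big[setU/set0]_(j < m) hasty m j `|`
   \big[setU/set0]_(j < m) \big[setU/set0]_(i < m.*2 + 9) odd_arrivals m j i).

Let scale_gt0 m : (0 < scale m)%R. Proof. by rewrite exprn_gt0. Qed.

Let scale_ge1 m : (1 <= scale m)%R. Proof. by rewrite exprn_ege1// ler1n. Qed.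

Let odd_constant : R := (4%:R / lambda + 2%:R * lambda)%R.

Let odd_arrivals_bound m j i : P (odd_arrivals m j i) <= (odd_constant / scale m ^+ 2)%:E.
Proof.
have B0 := scale_gt0 m; have B1 := scale_ge1 m; set B := scale m in B0 B1 *.
have l2 : (0 < lambda / 2%:R)%R by rewrite divr_gt0.
have D1 := deviation_bound lambda_gt0 server j (nearby m i) l2 (exprn_gt0 4 B0).
have D2 := deviation_bound lambda_gt0 server j (nearby m i) B0 ltr01.
have Bi : (0 < B^-1)%R by rewrite invr_gt0.
have D3 := deviation_bound lambda_gt0 server j (nearby m i) Bi (exprn_gt0 6 B0).
have mD := measurable_deviation server j (nearby m i).
rewrite /odd_arrivals -/B.
apply: (@le_trans _ _ ((lambda / ((lambda / 2%:R) ^+ 2 * B ^+ 4))%:E +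
  (lambda / (B ^+ 2 * 1))%:E + (lambda / (B^-1 ^+ 2 * B ^+ 6))%:E)).
  apply: (le_trans (measureU2 _ (measurableU _ _ (mD _ _) (mD _ _)) (mD _ _))).
  by apply: leeD => //; apply: (le_trans (measureU2 _ (mD _ _) (mD _ _))); exact: leeD.
rewrite -!EFinD lee_fin.
have -> : (lambda / ((lambda / 2%:R) ^+ 2 * B ^+ 4) + lambda / (B ^+ 2 * 1) +
   lambda / (B^-1 ^+ 2 * B ^+ 6) =
   (4%:R / lambda * (B ^+ 2)^-1 + lambda + lambda * (B ^+ 2)^-1) / B ^+ 2)%R.
  by field; rewrite !gt_eqF.
rewrite ler_wpM2r ?invr_ge0 ?exprn_ge0 ?(ltW B0)// /odd_constant.
have Bi1 : ((B ^+ 2)^-1 <= 1)%R by rewrite invf_le1 ?exprn_gt0// exprn_ege1.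
have h1 : (4%:R / lambda * (B ^+ 2)^-1 <= 4%:R / lambda)%R.
  by rewrite ler_piMr// divr_ge0// ltW.
have h2 : (lambda * (B ^+ 2)^-1 <= lambda)%R by rewrite ler_piMr// ltW.
lra.
Qed.

Let hasty_bound m j : P (hasty m j) <= (32%:R / lambda / scale m ^+ 2)%:E.
Proof.
have B0 := scale_gt0 m; have B1 := scale_ge1 m; rewrite /hasty; set B := scale m in B0 B1 *.
have B2 : (0 < B ^+ 2)%R by rewrite exprn_gt0.
have B21 : (1 <= B ^+ 2)%R by rewrite exprn_ege1.
(* the largest parameter to which [hasty_service] applies *)
have x0 : (0 < (8%:R * B ^+ 2)^-1 <= 2%:R^-1)%R.
  rewrite invr_gt0 mulr_gt0//= lef_pV2 ?posrE ?mulr_gt0//; lra.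
have c0 : (0 <= 2%:R / lambda * B ^+ 2)%R by rewrite !mulr_ge0 ?invr_ge0 ?ltW.
have xc : (2%:R * lambda * (8%:R * B ^+ 2)^-1 * (2%:R / lambda * B ^+ 2) <= 2%:R^-1)%R.
  rewrite le_eqVlt; apply/orP; left; apply/eqP; field.
  by rewrite !gt_eqF.
apply: (le_trans (hasty_service lambda_gt0 server sigmaE sigma_le1 sigma_laplace
  j (lambda / 2%:R * B ^+ 4) x0 c0 xc)).
rewrite lee_fin.
have -> : ((8%:R * B ^+ 2)^-1 * (lambda / 2%:R * B ^+ 4) / 2%:R = lambda * B ^+ 2 / 32%:R)%R.
  by field; rewrite gt_eqF.
set z := (lambda * B ^+ 2 / 32%:R)%R.
have z0 : (0 < z)%R by rewrite divr_gt0 ?mulr_gt0.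
have -> : (32%:R / lambda / B ^+ 2 = z^-1)%R by rewrite /z; field; rewrite !gt_eqF.
rewrite expRN lef_pV2 ?posrE ?expR_gt0//.
by have := expR_ge1Dx z; lra.
Qed.

Let measurable_short m : measurable (short_service m).
Proof.
have := measurable_tau server m measurableT (@measurable_itv _ `]-oo, (scale m ^+ 6)%R[).
by rewrite setTI; congr measurable; apply/seteqP; split => w; rewrite /= in_itv.
Qed.

Let measurable_odd m j i : measurable (odd_arrivals m j i).
Proof.
have mD := measurable_deviation server j (nearby m i).
by apply: measurableU => //; exact: measurableU.
Qed.

Let measurable_crowd m : measurable
  (\big[setU/set0]_(j < m) hasty m j `|`
   \big[setU/set0]_(j < m) \big[setU/set0]_(i < m.*2 + 9) odd_arrivals m j i).
Proof.
apply: measurableU; apply: bigsetU_measurable => j _.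
  exact: (measurable_hasty server).
by apply: bigsetU_measurable => i _.
Qed.

(** [service_growth] is used with half of the index spent on each parameter,
    which still gives a double exponential. *)
Let exponent_bound m : (14 <= m)%N -> (6 * m <= 2 ^ m./2)%N.
Proof.
move=> m14; have h7 : (7 <= m./2)%N by rewrite -[7%N]/(14./2); exact: half_leq.
have : (6 * (m./2.*2.+1) <= 2 ^ m./2)%N.
  move: (m./2) h7 => h; elim: h => // h IH; rewrite leq_eqVlt => /orP[/eqP<-//|].
  rewrite ltnS => h7; have := IH h7; rewrite expnS -!muln2.
  by move: (2 ^ h)%N => p; lia.
apply: leq_trans; rewrite leq_mul2l/= -{1}(odd_double_half m).
by case: (odd m); rewrite ?add1n ?add0n.
Qed.

Let short_service_bound m : (14 <= m)%N -> P (short_service m) <=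
  (expR (lambda / 2%:R) * expR (lambda / 4%:R) * expR (- (lambda / 8%:R)) ^+ m)%:E.
Proof.
move=> m14; pose i := m./2; pose p := (m - i).-1.
have im : (i < m)%N by rewrite /i; lia.
have mE : (p + i).+1 = m by rewrite /p; lia.
have mt := measurable_short m.
have mt' : measurable [set w | (tau T (p + i).+1 w < 2%:R ^+ (2 ^ i))%R].
  have := measurable_tau server (p + i).+1 measurableT
    (@measurable_itv _ `]-oo, (2%:R ^+ (2 ^ i))%R[).
  by rewrite setTI; congr measurable; apply/seteqP; split => w; rewrite /= in_itv.
apply: (@le_trans _ _ (P [set w | (tau T (p + i).+1 w < 2%:R ^+ (2 ^ i))%R])).
  apply: le_measure; rewrite ?inE// mE => w; rewrite /short_service /=.
  move=> /lt_le_trans; apply; rewrite /scale -exprM mulnC.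
  by rewrite ler_eXn2l ?ltr1n//; exact: exponent_bound.
apply: (le_trans (service_growth lambda_gt0 server sigmaE sigma_le1 sigma_laplace
  ae_regular p i)).
rewrite lee_fin -!expRM_natl -!expRD ler_expR.
have pm : (m%:R <= 2%:R * p%:R + 2%:R :> R)%R.
  by rewrite -natrM -natrD ler_nat /p /i; lia.
have l0 := lambda_gt0; nra.
Qed.

(** The number of pairs of a service and a site is negligible with respect to
    [4 ^ m]. *)
Let pairs_bound m : (m * (m.*2 + 9) <= 16 * 2 ^ m)%N.
Proof.
elim: m => // m IH; rewrite expnS doubleS.
have := ltn_expl m (isT : (1 < 2)%N); nia.
Qed.

Let union_bound n (A : nat -> set Om) (c : R) : (forall i, measurable (A i)) ->
  (forall i, P (A i) <= c%:E) ->
  P (\big[setU/set0]_(i < n) A i) <= (n%:R * c)%:E.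
Proof.
move=> mA Ac; elim: n => [|n IH]; first by rewrite big_ord0 measure0 mul0r.
rewrite big_ord_recr/= -natr1 mulrDl mul1r EFinD.
have mU : measurable (\big[setU/set0]_(i < n) A i) by exact: bigsetU_measurable.
exact: (le_trans (measureU2 P mU (mA n)) (leeD IH (Ac n))).
Qed.

Let crowd_constant : R := (odd_constant + 32%:R / lambda)%R.

Let crowd_bound m :
  P (\big[setU/set0]_(j < m) hasty m j `|`
     \big[setU/set0]_(j < m) \big[setU/set0]_(i < m.*2 + 9) odd_arrivals m j i) <=
  (16%:R * crowd_constant / 2%:R ^+ m)%:E.
Proof.
have B0 := scale_gt0 m; have B1 := scale_ge1 m.
have l0 := ltW lambda_gt0.
have mh j : measurable (hasty m j) by exact: (measurable_hasty server).
have mo j i := measurable_odd m j i.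
have mo' j : measurable (\big[setU/set0]_(i < m.*2 + 9) odd_arrivals m j i).
  exact: bigsetU_measurable.
have oc0 : (0 <= odd_constant)%R by rewrite addr_ge0 ?divr_ge0 ?mulr_ge0.
have lc0 : (0 <= 32%:R / lambda)%R by rewrite divr_ge0.
apply: (@le_trans _ _ ((m%:R * (32%:R / lambda / scale m ^+ 2))%:E +
    (m%:R * ((m.*2 + 9)%:R * (odd_constant / scale m ^+ 2)))%:E)).
  apply: (le_trans (measureU2 _ _ _)); [exact: bigsetU_measurable|exact: bigsetU_measurable|].
  apply: leeD; first exact: (union_bound _ mh (hasty_bound m)).
  apply: (union_bound _ mo') => j.
  exact: (union_bound _ (mo j) (odd_arrivals_bound m j)).
rewrite -EFinD lee_fin -/(scale m) /crowd_constant; set B := scale m in B0 B1 *.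
have hp : (m%:R * (m.*2 + 9)%:R <= 16%:R * B)%R.
  by rewrite /B /scale -natrX -!natrM ler_nat; exact: pairs_bound.
have hm : (m%:R <= 16%:R * B)%R.
  by apply: le_trans hp; rewrite -natrM ler_nat leq_pmulr// addn_gt0 orbT.
rewrite !mulrA -mulrDl ler_pdivrMr ?exprn_gt0//.
have -> : (16%:R * (odd_constant + 32%:R / lambda) / B * B ^+ 2 =
   16%:R * B * (odd_constant + 32%:R / lambda))%R by field; rewrite !gt_eqF.
rewrite -[X in (X + _ <= _)%R]mulrA addrC [leRHS]mulrDr.
exact: lerD (ler_wpM2r oc0 hp) (ler_wpM2r lc0 hm).
Qed.

(** The probabilities of the spoiling events are bounded by two geometric
    series. *)
Lemma ae_usual : {ae P, forall w, \forall m \near \oo, ~ unusual m w}.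
Proof.
have l0 := ltW lambda_gt0.
have cc0 : (0 <= 16%:R * crowd_constant)%R.
  by rewrite mulr_ge0// /crowd_constant /odd_constant !addr_ge0 ?divr_ge0 ?mulr_ge0.
have e0 : (0 <= expR (lambda / 2%:R) * expR (lambda / 4%:R))%R by rewrite mulr_ge0 ?expR_ge0.
apply: (borel_cantelli_geometric (N := 14) (a := (16%:R * crowd_constant)%R) (r := (2%:R^-1)%R)
  (a' := (expR (lambda / 2%:R) * expR (lambda / 4%:R))%R)
  (r' := expR (- (lambda / 8%:R))) _ _ cc0 e0).
- by apply/andP; split; lra.
- by rewrite expR_ge0 -expR0 ltr_expR oppr_lt0 divr_gt0.
- by move=> m; apply: measurableU; [exact: measurable_short|exact: measurable_crowd].
move=> m m14; rewrite /unusual EFinD addrC exprVn.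
apply: (le_trans (measureU2 _ _ _)).
- exact: measurable_short.
- exact: measurable_crowd.
- by apply: leeD; [exact: short_service_bound|exact: crowd_bound].
Qed.

End UnusualEvents.

(** * Consequences along one path *)

(** Below, [s] is the date of the previous departure, [t] the last service time,
    [B] the scale [2 ^ m] and [N] stands for [m]; the hypothesis
    [B ^ 2 * s <= N * t] says that the past is negligible. *)
Section BalanceAlgebra.
Variables (R : realType) (lambda B N s t : R).
Hypotheses (lambda_gt0 : 0 < lambda) (B_ge1 : 1 <= B) (N_ge1 : 1 <= N).
Hypothesis s_ge0 : 0 <= s.

Let E : R := (lambda + 2%:R) * N * (t / B).

Let time_bounds : 0 < t -> B ^+ 2 * s <= N * t ->
  [/\ 0 < t / B, t = B * (t / B), t / B <= N * (t / B), s <= N * (t / B) & B * s <= N * (t / B)].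
Proof.
move=> t0 st; have B0 : 0 < B by exact: lt_le_trans ltr01 B_ge1.
have z0 : 0 < t / B by rewrite divr_gt0.
have tE : t = B * (t / B) by rewrite mulrC divfK// gt_eqF.
have Bs : B * s <= N * (t / B).
  have e1 : B * (B * s) = B ^+ 2 * s by ring.
  have e2 : B * (N * (t / B)) = N * t by rewrite mulrCA -tE.
  by rewrite -(ler_pM2l B0) e1 e2.
split=> //; first by rewrite ler_peMl// ltW.
by apply: le_trans Bs; rewrite ler_peMl.
Qed.

Lemma balance_inspected a a0 : 0 < t -> B ^+ 2 * s <= N * t ->
  `|a - a0 - lambda * t| < B^-1 * t -> 0 <= a0 -> a0 <= (lambda + B) * s ->
  `|a - lambda * t| <= E.
Proof.
move=> t0 st h a00 a0s; have [z0 _ zN sN BsN] := time_bounds t0 st.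
move: h; rewrite ltr_norml [B^-1 * t]mulrC => /andP[h1 h2]; rewrite ler_norml /E.
have ls := ler_wpM2l (ltW lambda_gt0) sN.
move: (t / B) z0 zN sN BsN h1 h2 ls => z z0 zN sN BsN h1 h2 ls.
have -> : (lambda + 2%:R) * N * z = lambda * (N * z) + 2%:R * (N * z) by ring.
move: a0s; rewrite mulrDl => a0s.
by apply/andP; split; lra.
Qed.

Lemma balance_fresh a : 0 < t -> B ^+ 2 * s <= N * t ->
  `|a - lambda * (s + t)| < B^-1 * (s + t) -> `|a - lambda * t| <= E.
Proof.
move=> t0 st h; have [z0 _ zN sN BsN] := time_bounds t0 st.
have sB : B^-1 * s <= s.
  by rewrite ler_piMl// invf_le1// (lt_le_trans ltr01).
move: h; rewrite ltr_norml !mulrDr [B^-1 * t]mulrC => /andP[h1 h2]; rewrite ler_norml /E.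
have ls := ler_wpM2l (ltW lambda_gt0) sN.
have ls0 : 0 <= lambda * s by rewrite mulr_ge0// ltW.
move: (t / B) z0 zN sN BsN h1 h2 ls => z z0 zN sN BsN h1 h2 ls.
have -> : (lambda + 2%:R) * N * z = lambda * (N * z) + 2%:R * (N * z) by ring.
by apply/andP; split; lra.
Qed.

Lemma gap_inspected l y : `|l - lambda * t| <= E -> `|y - lambda * t| <= E ->
  `|l - y| <= 5%:R * E.
Proof.
by rewrite !ler_norml => /andP[h1 h2] /andP[h3 h4]; apply/andP; split; lra.
Qed.

Lemma gap_fresh y : B ^+ 2 <= t -> B ^+ 2 * s <= N * t ->
  `|y - lambda * t| <= E ->
  `|lambda * (s + t) - y| + B + lambda * (s + t) / B <= 5%:R * E.
Proof.
move=> Bt st yE; have B0 : 0 < B by exact: lt_le_trans ltr01 B_ge1.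
have t0 : 0 < t by apply: lt_le_trans Bt; rewrite exprn_gt0.
have [z0 tE zN sN BsN] := time_bounds t0 st.
have Bz : B <= t / B by rewrite ler_pdivlMr// -expr2.
have l0 := ltW lambda_gt0.
have ls := ler_wpM2l l0 sN.
have h1 : `|lambda * (s + t) - y| <= lambda * s + E.
  have -> : lambda * (s + t) - y = lambda * s - (y - lambda * t) by ring.
  apply: le_trans (ler_normB _ _) _; rewrite ger0_norm ?mulr_ge0//.
  by rewrite lerD2l.
have h2 : lambda * (s + t) / B <= lambda * s + lambda * (t / B).
  rewrite mulrDr mulrDl mulrA lerD2r ler_pdivrMr// ler_peMr ?mulr_ge0//.
have h3 := ler_wpM2l l0 zN.
have lNz0 := mulr_ge0 l0 (le_trans (ltW z0) zN).
rewrite /E in h1 *; move: h1 h2 h3 ls Bz zN.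
have -> : (lambda + 2%:R) * N * (t / B) = lambda * (N * (t / B)) + 2%:R * (N * (t / B)) by ring.
have := lNz0; lra.
Qed.

Lemma turn_error_algebra y gap : B ^+ 2 <= t -> `|y - lambda * t| <= E ->
  gap <= 5%:R * E -> 2%:R * (lambda + 2%:R) * N <= lambda * B ->
  0 < y /\ 3%:R * (gap + 3%:R * lambda) / y <=
    (30%:R * (lambda + 2%:R) / lambda + 18%:R) * (N / B).
Proof.
move=> Bt; rewrite ler_norml => /andP[yl _] gE large.
have B0 : 0 < B by exact: lt_le_trans ltr01 B_ge1.
have t0 : 0 < t by apply: lt_le_trans Bt; rewrite exprn_gt0.
have z0 : 0 < t / B by rewrite divr_gt0.
have tE : t = B * (t / B) by rewrite mulrC divfK// gt_eqF.
have lt0 : 0 < lambda * t by rewrite mulr_gt0.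
have E2 : 2%:R * E <= lambda * t.
  have := ler_wpM2r (ltW z0) large; rewrite -[lambda * B * _]mulrA -tE /E.
  lra.
have yh : lambda * t / 2%:R <= y by move: yl E2; lra.
have y0 : 0 < y by apply: lt_le_trans yh; rewrite divr_gt0.
split => //; rewrite ler_pdivrMr//.
set c := (_ + 18%:R) * (N / B).
have c0 : 0 <= c.
  have l0 := ltW lambda_gt0; have N0 := le_trans ler01 N_ge1.
  by apply: mulr_ge0; [rewrite addr_ge0// divr_ge0// mulr_ge0// addr_ge0|rewrite divr_ge0// ltW].
apply: le_trans (ler_wpM2l c0 yh).
have -> : c * (lambda * t / 2%:R) = 15%:R * E + 9%:R * lambda * (N * (t / B)).
  by rewrite /c /E; field; rewrite !gt_eqF.
have zN : 1 <= N * (t / B).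
  have z1 : 1 <= t / B.
    rewrite ler_pdivlMr// mul1r; apply: le_trans Bt.
    by rewrite expr2 ler_peMl// ltW.
  by apply: le_trans z1 _; rewrite ler_peMl// ltW.
have := ler_wpM2l (ltW lambda_gt0) zN; lra.
Qed.

End BalanceAlgebra.

Section UsualPaths.
Context (R : realType) (lambda : R) (zeta : nat -> set R -> \bar R).
Hypothesis lambda_gt0 : 0 < lambda.
Context (d : measure_display) (Om : measurableType d) (P : probability Om R).
Variables (Q : nat -> int -> Om -> option nat) (X : nat -> Om -> int).
Variables (T : nat -> Om -> R) (xi : nat -> Om -> int).
Hypothesis server : greedy_server Q X T xi P lambda zeta.
Variables (w : Om) (m : nat).
Hypothesis reg : regular_path Q X T xi w.
Hypothesis m_gt0 : (0 < m)%N.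
Hypothesis usual : ~ unusual lambda Q X T m w.

Let B : R := 2%:R ^+ m.
Let t j : R := tau T j w.
Let N : R := m%:R.

Let B_ge1 : 1 <= B. Proof. by rewrite exprn_ege1// ler1n. Qed.
Let B_gt0 : 0 < B. Proof. exact: lt_le_trans ltr01 B_ge1. Qed.

Let N_ge1 : 1 <= N. Proof. by rewrite ler1n. Qed.

Let t_ge1 j : 1 <= t j.+1. Proof. exact: rp_tau reg j. Qed.

Let TS j : T j.+1 w = T j w + t j.+1.
Proof. by rewrite /t /tau/= addrC subrK. Qed.

Let T_ge0 j : 0 <= T j w. Proof. exact: (gs_T_ge0 server). Qed.

Let position_step j : X j.+1 w - X j w = eta Q X xi j.+1 w.
Proof. by rewrite (gs_X server) addrC addKr. Qed.

Let eta_norm j : `|eta Q X xi j.+1 w| = 1.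
Proof. by case: (eta_sign j reg) => ->; rewrite ?normrN normr1. Qed.

Let position_bound j : `|X j w| <= j%:Z.
Proof.
elim: j => [|j IH]; first by rewrite (gs_X0 server) normr0.
rewrite (gs_X server) -addn1 PoszD; apply: le_trans (ler_normD _ _) _.
by rewrite lerD// eta_norm.
Qed.

Let neq_next j : X j w != X j.+1 w.
Proof.
rewrite eq_sym -subr_eq0 position_step -normr_eq0 eta_norm.
exact: oner_neq0.
Qed.

Let t_long : B ^+ 6 <= t m.
Proof. by rewrite leNgt; apply/negP => H; apply: usual; left. Qed.

Let not_hasty j : (j < m)%N -> lambda / 2%:R * B ^+ 4 <= (chosen Q X j w)%:R ->
  2%:R / lambda * B ^+ 2 * (chosen Q X j w)%:R <= t j.+1.
Proof.
move=> jm H; rewrite leNgt; apply/negP => H'; apply: usual; right; left.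
by rewrite -bigcup_mkord; exists j.
Qed.

Let not_odd j k : (j < m)%N -> `|k| <= m.+4%:Z ->
  [/\ ~ deviation lambda Q X T j k (lambda / 2%:R) (B ^+ 4) w,
      ~ deviation lambda Q X T j k B 1 w &
      ~ deviation lambda Q X T j k B^-1 (B ^+ 6) w].
Proof.
move=> jm /nearbyP[i im ik].
have no : ~ odd_arrivals lambda Q X T m j i w.
  move=> H; apply: usual; right; right.
  rewrite -(bigcup_mkord m (fun j => \big[setU/set0]_(i < m.*2 + 9)
    odd_arrivals lambda Q X T m j i)).
  by exists j => //; rewrite -bigcup_mkord; exists i.
by rewrite -ik; split => H; apply: no; [left; left|left; right|right].
Qed.

(** The queue left behind refills during a long service, so that the next
    service is much longer. *)
Let service_jump j : (j.+1 < m)%N -> B ^+ 4 <= t j.+1 -> B ^+ 2 * t j.+1 <= t j.+2.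
Proof.
move=> jm tj; set k := X j w.
have [b _ Qb] := rp_grow reg (neq_next j) (rp_empty reg j).
have km : `|k| <= m.+4%:Z.
  by apply: le_trans (position_bound j) _; rewrite lez_nat; lia.
have [nd _ _] := not_odd (ltnW jm) km.
have := no_deviation_inspected nd (rp_empty reg j) Qb (neq_next j) tj.
rewrite subr0 ltr_norml => /andP[bl _].
have kX : `|k - X j.+1 w| = 1 by rewrite distrC position_step eta_norm.
have := chosen_ge server reg kX; rewrite Qb /= -(ler_nat R) => bc.
have cl : lambda / 2%:R * t j.+1 <= (chosen Q X j.+1 w)%:R.
  by apply: le_trans bc; move: bl; rewrite /t; lra.
apply: le_trans (not_hasty jm _); last first.
  by apply: le_trans cl; rewrite ler_pM2l// divr_gt0.
have -> : B ^+ 2 * t j.+1 = 2%:R / lambda * B ^+ 2 * (lambda / 2%:R * t j.+1).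
  by field; rewrite gt_eqF.
by rewrite ler_pM2l// !mulr_gt0 ?invr_gt0 ?exprn_gt0.
Qed.

(** Once a service is long, the next ones only get longer. *)
Let service_chain j i : B ^+ 4 <= t j.+1 -> (j.+1 + i.+1 <= m)%N ->
  B ^+ 2 * t j.+1 <= t (j.+1 + i.+1).
Proof.
have B2 : 1 <= B ^+ 2 by rewrite exprn_ege1.
have B4 : B ^+ 4 = B ^+ 2 * B ^+ 2 by rewrite -exprD.
move=> tj; elim: i => [|i IH] jm.
  by rewrite addn1 in jm *; exact: service_jump.
have jm' : (j.+1 + i.+1 <= m)%N by lia.
have := IH jm'; rewrite !addSn !addnS => h.
have t0 : 0 <= t j.+1 by exact: le_trans ler01 (t_ge1 j).
apply: (le_trans h); apply: (@le_trans _ _ (B ^+ 2 * t (j + i).+2)).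
  by rewrite ler_peMl// (le_trans ler01)// t_ge1.
apply: service_jump; first by lia.
apply: le_trans h; rewrite B4 ler_pM2l ?exprn_gt0//; apply: le_trans tj.
by rewrite B4 ler_peMl// exprn_ge0// ltW.
Qed.

(** A service that is too short for the chain to start is dwarfed anyway. *)
Let service_dominated j : (j.+1 < m)%N -> B ^+ 2 * t j.+1 <= t m.
Proof.
move=> jm; have [tj|tj] := leP (B ^+ 4) (t j.+1).
  have := @service_chain j (m - j.+2) tj.
  by rewrite (_ : (j.+1 + (m - j.+2).+1 = m)%N); [apply|lia].
apply: le_trans t_long; have -> : B ^+ 6 = B ^+ 2 * B ^+ 4 by rewrite -exprD.
by rewrite ler_pM2l ?exprn_gt0// ltW.
Qed.

Let time_dominated j : (j < m)%N -> B ^+ 2 * T j w <= N * t m.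
Proof.
move=> jm; have tm0 : 0 <= t m.
  by apply: le_trans t_long; rewrite exprn_ge0// ltW.
apply: (@le_trans _ _ (j%:R * t m)); last by rewrite ler_wpM2r// ler_nat ltnW.
elim: j jm => [|j IH] jm; first by rewrite (gs_T0 server) mulr0 mul0r.
rewrite TS mulrDr -natr1 mulrDl mul1r lerD//; first exact: IH (ltnW jm).
exact: service_dominated.
Qed.

(** Before the last service, all queues are short. *)
Let queue_bound j k a : (j < m)%N -> `|k| <= m.+4%:Z -> Q j k w = Some a ->
  a%:R <= (lambda + B) * T j w.
Proof.
have lB : 0 <= lambda + B by rewrite addr_ge0// ltW.
move=> + km; elim: j a => [|j IH] a jm.
  rewrite (gs_Q0 server); case: ifP => // _ [<-].
  by rewrite mulr_ge0.
have [kX Qa|kX Qa] := eqVneq k (X j.+1 w).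
  by move: Qa; rewrite kX (rp_empty reg) => -[<-]; rewrite mulr_ge0.
have [_ nd _] := not_odd (ltnW jm) km.
case Q0 : (Q j k w) => [a0|].
  have := no_deviation_inspected nd Q0 Qa kX (t_ge1 j).
  rewrite ltr_norml => /andP[_ h].
  by have := IH a0 (ltnW jm) Q0; rewrite TS mulrDr /t; lra.
have T1 : 1 <= T j.+1 w by rewrite TS (le_trans (t_ge1 j))// lerDr.
have := no_deviation_fresh nd Q0 Qa kX T1.
by rewrite ltr_norml => /andP[_ h]; lra.
Qed.

Let E : R := (lambda + 2%:R) * N * (t m / B).

Let t_gt0 : 0 < t m. Proof. by apply: lt_le_trans t_long; rewrite exprn_gt0. Qed.

(** After the last service, the queues consist of the arrivals during that
    service, up to the few customers seen before. *)
Let queue_balance k a : `|k| <= m.+4%:Z -> k != X m w -> Q m k w = Some a ->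
  `|a%:R - lambda * t m| <= E.
Proof.
move=> km kX Qa; have [p mE] : exists p, m = p.+1 by exists m.-1; rewrite prednK.
have pm : (p < m)%N by rewrite mE.
have [_ _ nd] := not_odd pm km.
have tE : t m = tau T p.+1 w by rewrite /t mE.
rewrite mE in kX Qa.
have s0 := T_ge0 p; have s1 := time_dominated pm.
case Q0 : (Q p k w) => [a0|].
  have lt : B ^+ 6 <= tau T p.+1 w by rewrite -tE.
  have h := no_deviation_inspected nd Q0 Qa kX lt; rewrite -tE in h.
  have a0b := queue_bound pm km Q0.
  exact: (balance_inspected lambda_gt0 B_ge1 N_ge1 s0 t_gt0 s1 h (ler0n _ _) a0b).
have T1 : T p.+1 w = T p w + t m by rewrite TS /t mE.
have lt : B ^+ 6 <= T p.+1 w by rewrite T1 (le_trans t_long)// lerDr.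
have h := no_deviation_fresh nd Q0 Qa kX lt; rewrite T1 in h.
exact: (balance_fresh lambda_gt0 B_ge1 N_ge1 s0 t_gt0 s1 h).
Qed.

(** The chosen queue and the one beyond it are both within [E] of
    [lambda * t m], which is much larger than [E]. *)
Lemma usual_turn_error : 2%:R * (lambda + 2%:R) * m%:R <= lambda * 2%:R ^+ m ->
  (0 < chosen Q X m w)%N /\
  turn_error lambda (2%:R ^+ m) (Q m (X m.+1 w + eta Q X xi m.+1 w) w)
    (chosen Q X m w) (T m w) <=
  (30%:R * (lambda + 2%:R) / lambda + 18%:R) * (m%:R / 2%:R ^+ m).
Proof.
rewrite -/B -/N => large; have [p mE] : exists p, m = p.+1 by exists m.-1; rewrite prednK.
have pm : (p < m)%N by rewrite mE.
have s0 := T_ge0 p; have s1 := time_dominated pm.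
have T1 : T m w = T p w + t m by rewrite mE TS.
have k1X : X m.+1 w != X m w by rewrite eq_sym neq_next.
have k1m : `|X m.+1 w| <= m.+4%:Z.
  by apply: le_trans (position_bound _) _; rewrite lez_nat; lia.
have [y Qy] : exists y, Q m (X m.+1 w) w = Some y.
  have : Q m (X m.+1 w) w != None.
    have := @rp_neighbour _ _ _ _ _ _ _ _ reg p (X m.+1 w); rewrite -mE; apply.
    by rewrite position_step eta_norm.
  by case: (Q m (X m.+1 w) w) => [y|]// _; exists y.
have yE := queue_balance k1m k1X Qy.
have -> : chosen Q X m w = y by rewrite /chosen Qy.
set k2 := X m.+1 w + eta Q X xi m.+1 w.
have k2X : k2 != X m w.
  rewrite -subr_eq0 /k2 addrAC position_step.
  by case: (eta_sign m reg) => ->.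
have k2m : `|k2| <= m.+4%:Z.
  apply: le_trans (ler_normD _ _) _; rewrite eta_norm.
  by apply: le_trans (lerD (position_bound _) (lexx _)) _; rewrite -PoszD lez_nat; lia.
have B6 : B ^+ 2 <= t m.
  by apply: le_trans t_long; rewrite ler_weXn2l.
have gap : mean_gap lambda B (Q m k2 w) y (T m w) <= 5%:R * E.
  case Qk : (Q m k2 w) => [l|] /=.
    have lE := queue_balance k2m k2X Qk.
    exact: (gap_inspected lE yE).
  by rewrite T1; exact: (gap_fresh lambda_gt0 B_ge1 N_ge1 s0 B6 s1 yE).
have [y0 H] := turn_error_algebra lambda_gt0 B_ge1 N_ge1 B6 yE gap large.
by split => //; rewrite -(ltr0n R).
Qed.

End UsualPaths.

(** * The limit *)

Section ReferenceLaws.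
Local Open Scope ereal_scope.
Context (R : realType) (lambda : R).
Hypothesis lambda_gt0 : (0 < lambda)%R.

Lemma service_laplace (nu : nat -> {measure set R -> \bar R}) y
    (sigma : {measure set R -> \bar R}) (x : R) :
  (forall k (x : R), (0 < x < 1)%R ->
    \int[nu k]_t (expR (- (lambda * x ^+ 2 / (1 - x)) * t))%:E = ((1 - x) ^+ k)%:E) ->
  (forall f : R -> \bar R, measurable_fun setT f -> (forall t, 0 <= f t) ->
     \int[sigma]_t f t = \sum_(0 <= j <oo) (poisson_mass lambda j)%:E *
           \int[nu (y + j)%N]_t f (1 + t)%R) -> (0 < x < 1)%R ->
  \int[sigma]_t (expR (- (lambda * x ^+ 2 / (1 - x)) * t))%:E <=
  ((1 - x) ^+ y * expR (- (lambda * x)))%:E.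
Proof.
move=> nu_laplace sigma_int x01; have [x0 x1] := andP x01.
set s := (lambda * x ^+ 2 / (1 - x))%R.
have z0 : (0 <= 1 - x)%R by rewrite subr_ge0 ltW.
have s0 : (0 <= s)%R by rewrite divr_ge0// mulr_ge0 ?exprn_ge0// ltW.
have mexp : measurable_fun setT (fun t : R => (expR (- s * t))%:E).
  apply/measurable_EFinP; apply: (measurableT_comp (@measurable_expR R)).
  exact: measurable_funM.
rewrite sigma_int//=.
rewrite (eq_eseriesr (g := fun j => (expR (- s) * (1 - x) ^+ y)%:E *
    ((1 - x) ^+ j * poisson_mass lambda j)%:E)); last first.
  move=> j _.
  have -> : \int[nu (y + j)%N]_t (expR (- s * (1 + t)))%:E =
      (expR (- s))%:E * \int[nu (y + j)%N]_t (expR (- s * t))%:E.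
    rewrite -ge0_integralZl//.
    by apply: eq_integral => t _; rewrite mulrDr mulr1 expRD EFinM.
  by rewrite nu_laplace// -!EFinM exprD; congr (_%:E); ring.
rewrite nneseriesZl; last first.
  by move=> j _; rewrite lee_fin mulr_ge0 ?exprn_ge0 ?poisson_mass_ge0.
rewrite poisson_gen ?(ltW lambda_gt0)// -EFinM lee_fin.
have -> : (- (1 - (1 - x)) * lambda = - (lambda * x))%R by ring.
rewrite ler_wpM2r ?expR_ge0// ler_piMl ?exprn_ge0//.
by rewrite expR_le1 oppr_le0.
Qed.

Context (d : measure_display) (Om : measurableType d) (P : probability Om R).
Variables (A S : nat -> {RV P >-> R}).

Lemma zeta_law_neg k (B : set R) : B `<=` [set t | (t < 0)%R] ->
  zeta_law A S k B = 0.
Proof.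
move=> Bneg; rewrite /zeta_law (_ : [set w | _] = set0) ?measure0//.
apply/seteqP; split => // w /= [t tE /Bneg /= t0].
by have := time_to_empty_ge0 A S k w; rewrite tE lee_fin leNgt t0.
Qed.

Lemma zeta_law_le1 k : zeta_law A S k setT <= 1.
Proof.
rewrite /zeta_law; apply: probability_le1.
have := emeasurable_fin_num measurableT (measurable_time_to_empty A S k).
rewrite setTI; congr measurable; apply/seteqP; split => w /=.
  by move=> /fineK <-; exists (fine (time_to_empty A S k w)).
by move=> [t -> _].
Qed.

End ReferenceLaws.

Section Rate.
Variable R : realType.

Let half_exp_le2 m : expR (m%:R / 2%:R) <= (2%:R : R) ^+ m.
Proof.
rewrite mulrC expRM_natr lerXn2r// ?nnegrE ?expR_ge0//.
have := expR_ge1Dx (- 2%:R^-1 : R); rewrite expRN => h.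
have e0 : 0 < expR (2%:R^-1 : R) by exact: expR_gt0.
have h2 : (2%:R : R)^-1 <= (expR 2%:R^-1)^-1 by move: h; lra.
by rewrite lef_pV2 ?posrE in h2.
Qed.

Let linear_le_exp (C : R) m : 0 <= C -> 32%:R * C <= m%:R ->
  C * m%:R <= expR (m%:R / 4%:R).
Proof.
move=> C0 Cm; have m0 : 0 <= m%:R / 4%:R :> R by rewrite divr_ge0.
apply: le_trans (expR_ge1Dxn 1 m0).
by rewrite /= !factS fact0; nra.
Qed.

Lemma linear_le_pow2 (C : R) m : 0 <= C -> 32%:R * C <= m%:R ->
  C * m%:R <= 2%:R ^+ m.
Proof.
move=> C0 Cm; apply: le_trans (linear_le_exp C0 Cm) (le_trans _ (half_exp_le2 m)).
by rewrite ler_expR ler_wpM2l// lef_pV2 ?posrE// ler_nat.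
Qed.

(** The rate [m / 2 ^ m] beats [expR (- n `^ eps)] for every [eps < 1]; the
    exponent 1/2 is chosen for convenience. *)
Lemma rate_bound (C : R) m : 0 <= C -> 32%:R * C <= m%:R -> (63 <= m)%N ->
  C * (m%:R / 2%:R ^+ m) <= expR (- (m.+1%:R `^ 2%:R^-1)).
Proof.
move=> C0 Cm m63; have m0 : 0 <= m%:R :> R by [].
have m63' : 63%:R <= m%:R :> R by rewrite ler_nat.
have sq : m.+1%:R `^ 2%:R^-1 <= m%:R / 4%:R :> R.
  rewrite powR12_sqrt//; set r := Num.sqrt _.
  have r2 : r ^+ 2 = m%:R + 1 by rewrite sqr_sqrtr// -natr1.
  have r0 : 0 <= r by exact: sqrtr_ge0.
  have r8 : 8%:R <= r.
    rewrite leNgt; apply/negP => r8; have : r ^+ 2 < 64%:R by nra.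
    by rewrite r2; lra.
  nra.
rewrite mulrA ler_pdivrMr ?exprn_gt0//.
apply: (le_trans (linear_le_exp C0 Cm)).
apply: (@le_trans _ _ (expR (- (m%:R / 4%:R)) * expR (m%:R / 2%:R))).
  by rewrite -expRD ler_expR; lra.
have e4 : expR (- (m%:R / 4%:R)) <= expR (- (m.+1%:R `^ 2%:R^-1)) :> R.
  by rewrite ler_expR lerN2.
exact: (ler_pM (expR_ge0 _) (expR_ge0 _) e4 (half_exp_le2 m)).
Qed.

End Rate.

Unset Implicit Arguments.
Set Strict Implicit.
Set Printing Implicit Defensive.

Theorem proposition5p1 (R : realType) (lambda : R) (lambda_gt0 : 0 < lambda)
  (* a reference M/M/1 queue, which defines the laws of the zeta(k) *)
  (d' : measure_display) (Omega' : measurableType d')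
  (P' : probability Omega' R) (A S : nat -> {RV P' >-> R})
  (input_AS : MM1_input lambda lambda A S)
  (* the greedy server *)
  (d : measure_display) (Omega : measurableType d) (P : probability Omega R)
  (Q : nat -> int -> Omega -> option nat) (X : nat -> Omega -> int)
  (T : nat -> Omega -> R) (xi : nat -> Omega -> int)
  (server : greedy_server Q X T xi P lambda (zeta_law A S))
  (q : nat -> Omega -> R)
  (q_version : forall n : nat, (0 < n)%N ->
     is_cond_prob P (history Q X T xi n.-1)
       [set w | eta Q X xi n.+1 w != eta Q X xi n w] (q n)) :
  exists2 eps : R, 0 < eps &
    {ae P, forall w, \forall n \near \oo,
       `|q n w - 1 / 4%:R| <= expR (- (n%:R `^ eps))}.
Proof.
exists 2%:R^-1; first by rewrite invr_gt0.
have [nu nuP] := choice (zeta_measure_exists A S).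
have nuE k B : measurable B -> nu k B = zeta_law A S k B by exact: (nuP k).1.
have nu_neg k : nu k [set t | t < 0] = 0%E.
  rewrite nuE ?zeta_law_neg//.
  by rewrite -[X in measurable X]set_itvE; exact: measurable_itv.
have nu_le1 k : (nu k setT <= 1)%E by rewrite nuE// zeta_law_le1.
have nu_laplace k (x : R) (x01 : 0 < x < 1) :=
  zeta_laplace lambda_gt0 input_AS x01 (nuP k).2.
have [sigma sigmaP] := choice (service_measure_exists lambda nuE nu_le1).
have sigmaE y B : measurable B -> sigma y B = service_law lambda (zeta_law A S) y B.
  by have [h _ _] := sigmaP y; exact: h.
have sigma_le1 y : (sigma y setT <= 1)%E by have [] := sigmaP y.
have sigma_neg y : sigma y [set t | t < 0] = 0%E.
  rewrite sigmaE; last by rewrite -[X in measurable X]set_itvE; exact: measurable_itv.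
  rewrite /service_law eseries0// => j _ _.
  by rewrite zeta_law_neg ?mule0// => t /=; lra.
have sigma_laplace y (x : R) (x01 : 0 < x < 1) :
    (\int[sigma y]_t (expR (- (lambda * x ^+ 2 / (1 - x)) * t))%:E <=
    ((1 - x) ^+ y * expR (- (lambda * x)))%:E)%E.
  by have [_ _ h] := sigmaP y; exact: (service_laplace lambda_gt0 nu_laplace h x01).
have sigma_race y i : (\int[sigma y]_t \sum_(0 <= j <oo)
     (poisson_mass (2%:R * (lambda * t)) j * turn_prob R j i%:Z)%:E)%E =
     turn_back lambda nu i y.
  by have [_ _ h] := sigmaP y; exact: (service_race lambda_gt0 nu_neg nu_le1).
have tb_ge0 i y : (0 <= turn_back lambda nu i y)%E.
  apply: nneseries_ge0 => j _ _; rewrite mule_ge0 ?lee_fin ?poisson_mass_ge0//.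
  apply: nneseries_ge0 => l _ _; rewrite lee_fin mulr_ge0 ?poisson_mass_ge0//.
  by have /andP[] := corner_prob_bound lambda nu_le1 l i%:Z (y + j)%N.
have tb_quarter := turn_back_quarter lambda_gt0 nu_neg nu_le1 nu_laplace.
have regular := ae_regular_path server (fun k => zeta_law_neg A S k (@subset_refl _ _)).
have usual := ae_usual lambda_gt0 server sigmaE sigma_le1 sigma_laplace regular.
pose C : R := 30%:R * (lambda + 2%:R) / lambda + 18%:R.
have C0 : 0 <= C by rewrite addr_ge0// divr_ge0 ?(ltW lambda_gt0)// mulr_ge0// addr_ge0// ltW.
have near_quarter : {ae P, forall w, forall m, regular_path Q X T xi w -> (0 < m)%N ->
    (0 < chosen Q X m w)%N ->
    turn_error lambda (2%:R ^+ m) (Q m (X m.+1 w + eta Q X xi m.+1 w) w)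
      (chosen Q X m w) (T m w) <= C * (m%:R / 2%:R ^+ m) ->
    `|q m.+1 w - 1 / 4%:R| <= C * (m%:R / 2%:R ^+ m)}.
  apply: ae_countable => m; case: (posnP m) => [->|m0].
    by apply: aeW => w _.
  have B0 : 0 < (2%:R : R) ^+ m by rewrite exprn_gt0.
  have := cond_turn_quarter lambda_gt0 server sigmaE sigma_le1 sigma_neg tb_ge0
    sigma_race tb_quarter (C * (m%:R / 2%:R ^+ m)) B0 m0 (q_version m.+1 isT).
  by apply: filterS => w H reg _; exact: H.
pose C' : R := 2%:R * (lambda + 2%:R) / lambda.
have C'0 : 0 <= C' by rewrite divr_ge0 ?(ltW lambda_gt0)// mulr_ge0// addr_ge0// ltW.
move: regular usual near_quarter; apply: filterS3 => w reg usual near_quarter.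
have [N1 _ HN1] := usual.
pose N2 := Num.bound (32%:R * C); pose N3 := Num.bound (32%:R * C').
exists (maxn (maxn N1 63) (maxn N2 N3)).+1 => // -[//|m] /=.
rewrite ltnS !geq_max => /andP[/andP[N1m m63] /andP[N2m N3m]].
have le_arch (c : R) (N : nat) : 0 <= c -> N = Num.bound c -> (N <= m)%N -> c <= m%:R.
  move=> c0 NE Nm; apply: le_trans (ltW (archi_boundP c0)) _.
  by rewrite -NE ler_nat.
have Cm : 32%:R * C <= m%:R by apply: le_arch N2m => //; rewrite mulr_ge0.
have C'm : 32%:R * C' <= m%:R by apply: le_arch N3m => //; rewrite mulr_ge0.
have m0 : (0 < m)%N by exact: leq_trans m63.
have large : 2%:R * (lambda + 2%:R) * m%:R <= lambda * 2%:R ^+ m.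
  have := ler_wpM2l (ltW lambda_gt0) (linear_le_pow2 C'0 C'm).
  have -> // : lambda * (C' * m%:R) = 2%:R * (lambda + 2%:R) * m%:R.
  by rewrite /C'; field; rewrite gt_eqF.
have [c0 te] := usual_turn_error lambda_gt0 server reg m0 (HN1 m N1m) large.
apply: le_trans (near_quarter m reg m0 c0 te) _.
exact: rate_bound.
Qed.
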